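(* Assume the spiked tensor model described in the context, and assume moreover that the ratio $\|\mathcal{P}\|_F^2/\sigma_N$ remains bounded as $N\to+\infty$. Fix $\ell\in[d]$ and, for $\tilde z\in\mathbb{C}\setminus\mathbb{R}$, let $$\widetilde{Q}^{(\ell)}(\tilde z)=\Big(\tfrac{1}{\sigma_N}\big[T^{(\ell)}T^{(\ell)\top}-\mu^{(\ell)}_N I_{n_\ell}\big]-\tilde z I_{n_\ell}\Big)^{-1}.$$ Then for every $\tilde z\in\mathbb{C}\setminus\mathbb{R}$, $\frac{1}{n_\ell}\operatorname{Tr}\widetilde Q^{(\ell)}(\tilde z)$ converges almost surely as $N\to+\infty$ to a deterministic limit $\widetilde m(\tilde z)$, which does not depend on $\ell$ and satisfies $$\widetilde m(\tilde z)^2+\tilde z\,\widetilde m(\tilde z)+1=0\qquad(\text{with }\operatorname{Im}\tilde z\,\operatorname{Im}\widetilde m(\tilde z)>0),$$ and $\widetilde Q^{(\ell)}(\tilde z)\longleftrightarrow \bar Q^{(\ell)}(\tilde z)$ in the sense of deterministic equivalents, where $$\bar Q^{(\ell)}(\tilde z)=\Big(\tfrac{1}{\sigma_N}P^{(\ell)}P^{(\ell)\top}+\tfrac{1}{\widetilde m(\tilde z)}I_{n_\ell}\Big)^{-1}.$$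
   Context: Spiked tensor model: $d\ge 3$ is fixed; $N\to+\infty$ is a positive integer parameter; dimensions $n_1,\dots,n_d$ depend on $N$ so that $n_\ell/N=c_\ell$ is a fixed positive constant for all $N$ larger than some $N_0$; ranks $r_1,\dots,r_d\ge1$ are fixed. $\mathcal{N}\in\mathbb{R}^{n_1\times\cdots\times n_d}$ has i.i.d. $\mathcal{N}(0,1)$ entries; $\mathcal{P}\in\mathbb{R}^{n_1\times\cdots\times n_d}$ is deterministic of the form $\mathcal{P}=\sum_{q_1\le r_1,\dots,q_d\le r_d}\mathcal{H}_{q_1,\dots,q_d}\,x^{(1)}_{q_1}\otimes\cdots\otimes x^{(d)}_{q_d}$, where $\mathcal{H}\in\mathbb{R}^{r_1\times\cdots\times r_d}$ and $X^{(\ell)}=[x^{(\ell)}_1,\dots,x^{(\ell)}_{r_\ell}]\in\mathbb{R}^{n_\ell\times r_\ell}$ has orthonormal columns. The observation is $\mathcal{T}=\mathcal{P}+\frac{1}{\sqrt N}\mathcal{N}$. For a tensor $\mathcal{A}$, the mode-$\ell$ unfolding $A^{(\ell)}$ is the $n_\ell\times\prod_{\ell'\ne\ell}n_{\ell'}$ matrix whose columns are the mode-$\ell$ fibers of $\mathcal{A}$ (vectors obtained by fixing all indices except the $\ell$-th), ordered so that $[y^{(1)}\otimes\cdots\otimes y^{(d)}]^{(\ell)}=y^{(\ell)}\big(\boxtimes_{\ell'\ne\ell}y^{(\ell')}\big)^\top$ with $\boxtimes$ the Kronecker product taken over $\ell'$ in increasing order. Define $\mu^{(\ell)}_N=\frac1N\prod_{\ell'\ne\ell}n_{\ell'}$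 and $\sigma_N=\frac1N\sqrt{\prod_{\ell\in[d]}n_\ell}$. Deterministic equivalent: for random $X$ and deterministic $\bar X$ (both $n\times n$, depending on $N$), $X\leftrightarrow\bar X$ means that for all deterministic sequences of matrices $A\in\mathbb{R}^{n\times n}$ with bounded spectral norm and vectors $a,b\in\mathbb{R}^n$ with bounded Euclidean norms, $\frac1n\operatorname{Tr}A(X-\bar X)\to0$ and $a^\top(X-\bar X)b\to0$ almost surely as $N\to+\infty$. *)

(* Defs.v *)
From HB Require Import structures.
From mathcomp Require Import all_boot all_order all_algebra.
From mathcomp Require Import all_classical all_reals all_analysis.
From mathcomp Require Import complex.
Set Implicit Arguments. Unset Strict Implicit. Unset Printing Implicit Defensive.
Import Order.TTheory GRing.Theory Num.Theory.
Import numFieldNormedType.Exports.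
Local Open Scope classical_set_scope.
Local Open Scope ring_scope.

Notation midx d n := {dffun forall l : 'I_d, 'I_(n l)}.

Definition toC (R : realType) (x : R) : R[i] := Complex x 0.

Definition frob2 (R : realType) (d : nat) (n : 'I_d -> nat)
  (A : midx d n -> R) : R := \sum_(k : midx d n) A k ^+ 2.

(* The Gram matrix A^(l) A^(l)^T of the mode-l unfolding A^(l): its (i,j)
   entry is the sum over all columns c (= all choices of the indices other
   than the l-th) of A^(l)_{i,c} A^(l)_{j,c}, i.e. the sum over pairs of
   multi-indices k, k' that agree outside coordinate l and have k_l = i,
   k'_l = j.  (This does not depend on the ordering of the columns.) *)
Definition unfold_gram (R : realType) (d : nat) (n : 'I_d -> nat)
  (A : midx d n -> R) (l : 'I_d) : 'M[R]_(n l) :=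
  \matrix_(i, j) \sum_(k : midx d n) \sum_(k' : midx d n |
       [&& k l == i, k' l == j &
           [forall l' : 'I_d, (l' != l) ==> (k l' == k' l')]])
     A k * A k'.

Definition signal (R : realType) (d : nat) (n r : 'I_d -> nat)
  (H : midx d r -> R) (X : forall l : 'I_d, 'M[R]_(n l, r l))
  : midx d n -> R :=
  fun k => \sum_(q : midx d r) H q * \prod_(l < d) X l (k l) (q l).

Definition mu_N (R : realType) (d : nat) (n : 'I_d -> nat) (N : nat)
  (l : 'I_d) : R :=
  N%:R^-1 * \prod_(l' < d | l' != l) (n l')%:R.

Definition sigma_N (R : realType) (d : nat) (n : 'I_d -> nat) (N : nat) : R :=
  N%:R^-1 * Num.sqrt (\prod_(l < d) (n l)%:R).

Definition vnorm (R : realType) (k : nat) (v : 'cV[R]_k) : R :=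
  Num.sqrt (\sum_(i < k) v i 0 ^+ 2).

Definition spec_bounded (R : realType) (n : nat -> nat)
  (A : forall N, 'M[R]_(n N)) : Prop :=
  exists K : R, forall N (x : 'cV[R]_(n N)), vnorm (A N *m x) <= K * vnorm x.

Definition vec_bounded (R : realType) (n : nat -> nat)
  (a : forall N, 'cV[R]_(n N)) : Prop :=
  exists K : R, forall N, vnorm (a N) <= K.

Definition cvgC (R : realType) (u : nat -> R[i]) (z : R[i]) : Prop :=
  (fun N => complex.Re (u N)) @ \oo --> complex.Re z /\
  (fun N => complex.Im (u N)) @ \oo --> complex.Im z.

Definition as_cvgC (R : realType) (d0 : measure_display)
  (Omega : measurableType d0) (P : probability Omega R)
  (u : nat -> Omega -> R[i]) (z : R[i]) : Prop :=
  {ae P, forall w, cvgC (fun N => u N w) z}.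

Definition mutually_independent (R : realType) (d0 : measure_display)
  (Omega : measurableType d0) (P : probability Omega R) (I : finType)
  (X : I -> Omega -> R) : Prop :=
  forall (J : {set I}) (B : I -> set R), (forall i, measurable (B i)) ->
    P (\bigcap_(i in [set i | i \in J]) (X i @^-1` B i)) =
    (\prod_(i in J) P (X i @^-1` B i))%E.

Definition det_equiv (R : realType) (d0 : measure_display)
  (Omega : measurableType d0) (P : probability Omega R) (n : nat -> nat)
  (X : forall N, Omega -> 'M[R[i]]_(n N)) (Xb : forall N, 'M[R[i]]_(n N))
  : Prop :=
  forall (A : forall N, 'M[R]_(n N)) (a b : forall N, 'cV[R]_(n N)),
    spec_bounded A -> vec_bounded a -> vec_bounded b ->
    as_cvgC P (fun N w => toC (n N)%:R^-1 *
                 \tr (map_mx (@toC R) (A N) *m (X N w - Xb N))) 0 /\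
    as_cvgC P (fun N w => ((map_mx (@toC R) (a N))^T *m (X N w - Xb N)
                 *m map_mx (@toC R) (b N)) 0 0) 0.

(* Main.v *)
(** The resolvent Q of the centred Gram matrix is compared with the resolvent Q0
    of its pure-noise part. Write m0 for the normalised trace of Q0 and
    x = - (z + m0)^-1. By the Schur complement of one row of the noise, the
    diagonal entry of Q0 differs from x by the fluctuation of a quadratic form in
    independent Gaussian variables, whose fourth moment is O(n^-2). Gaussian noise
    is invariant under rotations, so the same bound holds for u^T Q0 u with u any
    unit vector, and by polarisation a^T Q0 b - x a^T b has a fourth moment
    O(n^-2), which is summable: the convergences hold almost surely, whatever the
    joint law of the noises for different N.

    Averaging over the diagonal gives m0 - x -> 0, so m0 converges to the root m
    of m^2 + z m + 1 = 0 in the half plane of z, thanks to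
    (m0 - m) (m0 - m^-1) = (m0 - x) (z + m0). Finally, if D and E denote the signal
    and cross terms of the Gram matrix,
      Q - Qbar = m^-1 Qbar ((Q0 - m) (1 - D Q) - Q0 E Q),
    where D has bounded Frobenius norm since |P|^2 / sigma_N is bounded, and
    the Frobenius norm of E tends to 0 almost surely. *)

Require Import Defs.
From HB Require Import structures.
From mathcomp Require Import all_boot all_order all_algebra.
From mathcomp Require Import all_classical all_reals all_analysis.
From mathcomp Require Import measurable_realfun.
From mathcomp Require Import complex.
From mathcomp Require Import ring lra.
Import Order.TTheory GRing.Theory Num.Theory.
Import numFieldNormedType.Exports.
Local Open Scope classical_set_scope.
Local Open Scope ring_scope.
Set Implicit Arguments. Unset Strict Implicit. Unset Printing Implicit Defensive.

(** * Squared modulus of complex numbers, with values in the real field *)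

Section ComplexModulus.
Variable R : realType.
Implicit Types (z a b : R[i]) (x y : R).

(** The semicircle equation is forced by d >= 3. An unfolding of size n x p then satisfies n^2 <= K
    p, and with s^2 n p = 1 the drift s (n + z tr R) left in the Schur complement, R being the
    resolvent without the removed row, has squared modulus of order n / p = O(1/n). For p of order n
    it would survive and change the limiting equation.

    Estimates are stated for squared moduli and squared Frobenius norms, so that a fourth moment is
    the second moment of a squared modulus. Fourth moments of Gaussian quadratic forms come from
    inserting one variable X at a time: the increment X L + b (X^2 - 1) is centred given the earlier
    variables, hence the term of first order drops out and a bound of the form (constant times
    variance)^2 propagates by induction.

    Isotropic estimates on Q0 hold for deterministic vectors only, whereas Q b is random. In the
    final identity the left factor Qbar a / m is deterministic, and Cauchy-Schwarz over the columns
    of D removes Q b on the right. *)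

Definition nq z : R := complex.Re z ^+ 2 + complex.Im z ^+ 2.

Lemma nq_ge0 z : 0 <= nq z.
Proof. by rewrite addr_ge0// sqr_ge0. Qed.

Lemma nqM a b : nq (a * b) = nq a * nq b.
Proof. by case: a => a1 a2; case: b => b1 b2; rewrite /nq /=; ring. Qed.

Lemma nqN a : nq (- a) = nq a.
Proof. by case: a => a1 a2; rewrite /nq /=; ring. Qed.

Lemma nqD a b : nq (a + b) <= 2 * nq a + 2 * nq b.
Proof.
case: a => a1 a2; case: b => b1 b2; rewrite /nq /=.
have := sqr_ge0 (a1 - b1); have := sqr_ge0 (a2 - b2); nra.
Qed.

Lemma nqB a b : nq (a - b) <= 2 * nq a + 2 * nq b.
Proof. by rewrite -(nqN b) nqD. Qed.

Lemma nq0 : nq 0 = 0.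
Proof. by rewrite /nq /= !expr0n addr0. Qed.

Lemma nq1 : nq 1 = 1.
Proof. by rewrite /nq /= expr0n expr1n addr0. Qed.

Lemma nq_eq0 z : (nq z == 0) = (z == 0).
Proof. by case: z => a b; rewrite /nq /= paddr_eq0 ?sqr_ge0// !sqrf_eq0 eq_complex. Qed.

Lemma nqV z : nq z^-1 = (nq z)^-1.
Proof.
have [->|z0] := eqVneq z 0; first by rewrite invr0 nq0 invr0.
have n0 : nq z != 0 by rewrite nq_eq0.
by apply: (mulfI n0); rewrite -nqM !divff// nq1.
Qed.

Lemma nq_toC x : nq (toC x) = x ^+ 2.
Proof. by rewrite /nq /= expr0n addr0. Qed.

Lemma Im2_le_nq z : complex.Im z ^+ 2 <= nq z.
Proof. by rewrite lerDr sqr_ge0. Qed.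

Lemma Re2_le_nq z : complex.Re z ^+ 2 <= nq z.
Proof. by rewrite lerDl sqr_ge0. Qed.

(** Cauchy-Schwarz for the product without conjugation, by induction on the sum. Nonnegativity of
    both partial sums is carried along because the inductive step ends with the arithmetic-geometric
    inequality. *)
Lemma nq_sumCS (I : Type) (r : seq I) (P : pred I) (f g : I -> R[i]) :
  nq (\sum_(i <- r | P i) f i * g i) <=
  (\sum_(i <- r | P i) nq (f i)) * \sum_(i <- r | P i) nq (g i).
Proof.
suff [] : [/\ 0 <= \sum_(i <- r | P i) nq (f i),
   0 <= \sum_(i <- r | P i) nq (g i) & nq (\sum_(i <- r | P i) f i * g i) <=
  (\sum_(i <- r | P i) nq (f i)) * \sum_(i <- r | P i) nq (g i)] by [].
elim/big_rec3: _ => [|i S B A _ [A0 B0 hS]]; first by rewrite nq0 mul0r.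
have := nq_ge0 (f i); have := nq_ge0 (g i) => g0 f0.
split; try by rewrite addr_ge0.
move: hS g0 f0; rewrite /nq; case: S => s t; case: (f i) => a b; case: (g i) => c d /=.
set u := (_ * _ - _ * _); set v := (_ * _ + _ * _) => hS g0 f0.
have uv : u ^+ 2 + v ^+ 2 = (a ^+ 2 + b ^+ 2) * (c ^+ 2 + d ^+ 2).
  by rewrite /u /v; ring.
pose X' := (a ^+ 2 + b ^+ 2) * B; pose Y' := (c ^+ 2 + d ^+ 2) * A.
have X0' : 0 <= X' by rewrite mulr_ge0.
have Y0' : 0 <= Y' by rewrite mulr_ge0.
(* Here u + iv is the new term and s + it the previous sum, so this is the cross term of the squared
   modulus. Its square is at most 4 X' Y', hence at most (X' + Y')^2. *)
suff: 2 * (u * s + v * t) <= X' + Y' by rewrite /X' /Y'; nra.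
have h : (u * s + v * t) ^+ 2 <= X' * Y'.
  apply: (@le_trans _ _ ((u ^+ 2 + v ^+ 2) * (s ^+ 2 + t ^+ 2))).
    by have := sqr_ge0 (u * t - v * s); nra.
  rewrite uv /X' /Y'.
  have := ler_wpM2l (mulr_ge0 f0 g0) hS; nra.
apply: le_trans (ler_norm _) _; rewrite -ler_sqr ?nnegrE ?addr_ge0//.
by rewrite real_normK ?num_real//; have := sqr_ge0 (X' - Y'); nra.
Qed.

End ComplexModulus.

(** * Squared Frobenius norm; on a column it is the squared Euclidean norm *)

Section Frobenius.
Variable R : realType.
Local Notation C := R[i].

Definition fro2 m n (A : 'M[C]_(m, n)) : R := \sum_i \sum_j nq (A i j).

Lemma fro2_ge0 m n (A : 'M[C]_(m, n)) : 0 <= fro2 A.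
Proof. by do 2 (apply: sumr_ge0 => ? _); exact: nq_ge0. Qed.

Lemma fro2_eq0 m n (A : 'M[C]_(m, n)) : fro2 A <= 0 -> A = 0.
Proof.
move=> A0; apply/matrixP => i j; rewrite mxE; apply/eqP; rewrite -nq_eq0 eq_le nq_ge0 andbT.
apply: le_trans A0; rewrite /fro2 (bigD1 i)//= (bigD1 j)//= -addrA lerDl.
by apply: addr_ge0; do ?(apply: sumr_ge0 => ? _); rewrite ?nq_ge0.
Qed.

Lemma fro2_col m n (A : 'M[C]_(m, n)) : fro2 A = \sum_j fro2 (col j A).
Proof.
rewrite /fro2 exchange_big; apply: eq_bigr => j _; apply: eq_bigr => i _.
by rewrite big_ord1 mxE.
Qed.

Lemma fro2_tr m n (A : 'M[C]_(m, n)) : fro2 A^T = fro2 A.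
Proof. by rewrite /fro2 exchange_big; do 2 (apply: eq_bigr => ? _); rewrite mxE. Qed.

Lemma fro2_entry m n (A : 'M[C]_(m, n)) i j : nq (A i j) <= fro2 A.
Proof.
rewrite /fro2 (bigD1 i)//= (bigD1 j)//= -addrA lerDl.
by apply: addr_ge0; do ?(apply: sumr_ge0 => ? _); rewrite ?nq_ge0.
Qed.

Lemma fro2M m n p (A : 'M[C]_(m, n)) (B : 'M[C]_(n, p)) :
  fro2 (A *m B) <= fro2 A * fro2 B.
Proof.
rewrite [fro2 B]fro2_col /fro2 mulr_suml; apply: ler_sum => i _.
rewrite mulr_sumr; apply: ler_sum => j _; rewrite mxE.
apply: le_trans (nq_sumCS _ _ _ _) _; rewrite le_eqVlt; apply/orP; left; apply/eqP.
by congr (_ * _); apply: eq_bigr => k _; rewrite big_ord1 mxE.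
Qed.

Lemma fro2D m n (A B : 'M[C]_(m, n)) : fro2 (A + B) <= 2 * fro2 A + 2 * fro2 B.
Proof.
rewrite /fro2 !mulr_sumr -big_split; apply: ler_sum => i _.
rewrite !mulr_sumr -big_split; apply: ler_sum => j _; rewrite mxE; exact: nqD.
Qed.

Lemma fro2N m n (A : 'M[C]_(m, n)) : fro2 (- A) = fro2 A.
Proof. by do 2 (apply: eq_bigr => ? _); rewrite mxE nqN. Qed.

Lemma fro2B m n (A B : 'M[C]_(m, n)) : fro2 (A - B) <= 2 * fro2 A + 2 * fro2 B.
Proof. by rewrite -(fro2N B) fro2D. Qed.

Lemma fro2Z m n a (A : 'M[C]_(m, n)) : fro2 (a *: A) = nq a * fro2 A.
Proof.
rewrite /fro2 mulr_sumr; apply: eq_bigr => i _; rewrite mulr_sumr.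
by apply: eq_bigr => j _; rewrite mxE nqM.
Qed.

Lemma fro2_scalar n (a : C) : fro2 (a%:M : 'M[C]_n) = n%:R * nq a.
Proof.
rewrite /fro2 (eq_bigr (fun _ => nq a)).
  by rewrite sumr_const card_ord mulr_natl.
move=> i _; rewrite (bigD1 i)//= big1 ?addr0 ?mxE ?eqxx//.
by move=> j ji; rewrite mxE eq_sym (negbTE ji) nq0.
Qed.

Lemma nq_trM m n (A : 'M[C]_(m, n)) (B : 'M[C]_(n, m)) :
  nq (\tr (A *m B)) <= fro2 A * fro2 B.
Proof.
rewrite /mxtrace; under eq_bigr do rewrite mxE.
rewrite -(fro2_tr B) /fro2 !pair_bigA/=.
apply: le_trans (nq_sumCS _ _ _ _) _.
by rewrite le_eqVlt; apply/orP; left; apply/eqP; congr (_ * _); apply: eq_bigr => k _; rewrite mxE.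
Qed.

Definition Cmx m n (A : 'M[R]_(m, n)) : 'M[C]_(m, n) := map_mx (@toC R) A.

Lemma CmxE m n (A : 'M[R]_(m, n)) : Cmx A = map_mx (real_complex R) A.
Proof. by []. Qed.

Lemma CmxD m n (A B : 'M[R]_(m, n)) : Cmx (A + B) = Cmx A + Cmx B.
Proof. by rewrite !CmxE map_mxD. Qed.

Lemma CmxM m n p (A : 'M[R]_(m, n)) (B : 'M[R]_(n, p)) : Cmx (A *m B) = Cmx A *m Cmx B.
Proof. by rewrite !CmxE map_mxM. Qed.

Lemma CmxZ m n a (A : 'M[R]_(m, n)) : Cmx (a *: A) = toC a *: Cmx A.
Proof. by rewrite !CmxE map_mxZ. Qed.

Lemma CmxT m n (A : 'M[R]_(m, n)) : (Cmx A)^T = Cmx A^T.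
Proof. by rewrite map_trmx. Qed.

Lemma Cmx_scalar n (a : R) : Cmx (a%:M : 'M[R]_n) = (toC a)%:M.
Proof. by rewrite CmxE map_scalar_mx. Qed.

Lemma fro2_Cmx m n (A : 'M[R]_(m, n)) : fro2 (Cmx A) = \sum_i \sum_j A i j ^+ 2.
Proof. by do 2 (apply: eq_bigr => ? _); rewrite mxE nq_toC. Qed.

(** * Resolvents of real symmetric matrices at a non-real point *)

Section Resolvent.
Variables (n : nat) (S : 'M[R]_n) (z : C).
Hypothesis symS : S^T = S.
Hypothesis z0 : complex.Im z != 0.
Let D := Cmx S - z%:M.

(** As S is real symmetric, v^* S v is real: exchanging the two summation indices changes the sign
    of its imaginary part. Only the term in z remains. *)
Lemma Im_sesq (v : 'cV[C]_n) :
  complex.Im (\sum_i conjc (v i 0) * (D *m v) i 0) = - complex.Im z * fro2 v.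
Proof.
have -> : \sum_i conjc (v i 0) * (D *m v) i 0 =
   \sum_i \sum_j conjc (v i 0) * toC (S i j) * v j 0 - z * \sum_i conjc (v i 0) * v i 0.
  rewrite mulr_sumr -sumrB; apply: eq_bigr => i _.
  rewrite /D mulmxBl mul_scalar_mx !mxE mulrBr mulr_sumr; congr (_ - _); last by ring.
  by apply: eq_bigr => j _; rewrite mxE mulrA.
have -> : \sum_i conjc (v i 0) * v i 0 = toC (fro2 v).
  rewrite -[toC _]/(real_complex R _) rmorph_sum; apply: eq_bigr => i _.
  rewrite big_ord1; case: (v i 0) => a b; apply/eqP; rewrite eq_complex /nq /=; apply/andP; split; apply/eqP; ring.
rewrite raddfB /= raddf_sum; set X := \sum_i _.
suff -> : X = 0 by case: z => a b /=; ring.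
have X2 : X + X = 0.
  rewrite /X; under eq_bigr do rewrite raddf_sum.
  rewrite [X in X + _]exchange_big -big_split big1// => i _; rewrite -big_split big1// => j _ /=.
  rewrite -{1}symS mxE; case: (v i 0) => a b; case: (v j 0) => c d /=; ring.
by lra.
Qed.

(* Taking imaginary parts of v^* (S - z) v and applying Cauchy-Schwarz avoids
   the spectral theorem. *)
Lemma resolvent_lbound k (X : 'M[C]_(n, k)) :
  complex.Im z ^+ 2 * fro2 X <= fro2 (D *m X).
Proof.
rewrite fro2_col [leRHS]fro2_col mulr_sumr; apply: ler_sum => j _.
rewrite !colE -mulmxA; move: (X *m _) => v {X}.
have v0 := fro2_ge0 v.
have h : (complex.Im z * fro2 v) ^+ 2 <= fro2 v * fro2 (D *m v).
  rewrite -[leLHS]sqrrN -mulNr -Im_sesq; apply: le_trans (Im2_le_nq _) _.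
  apply: le_trans (nq_sumCS _ _ _ _) _; rewrite le_eqVlt; apply/orP; left; apply/eqP.
  rewrite /fro2; congr (_ * _); apply: eq_bigr => i _; rewrite big_ord1//.
  by case: (v i 0) => a b; rewrite /nq /=; ring.
have [->|vn0] := eqVneq (fro2 v) 0; first by rewrite mulr0 fro2_ge0.
have vp : 0 < fro2 v by rewrite lt_neqAle eq_sym vn0.
by rewrite -(ler_pM2l vp); apply: le_trans h; rewrite exprMn; nra.
Qed.

Lemma resolvent_unit : D \in unitmx.
Proof.
rewrite unitmxE unitfE; apply/negP => /det0P[v v0 vD].
have := resolvent_lbound (v^T).
have -> : D *m v^T = 0.
  have symD : D^T = D by rewrite /D linearB /= CmxT symS tr_scalar_mx.
  by rewrite -{1}symD -trmx_mul vD trmx0.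
have -> : fro2 (0 : 'cV[C]_n) = 0.
  by rewrite /fro2 big1// => i _; rewrite big1// => j _; rewrite mxE nq0.
rewrite pmulr_rle0 ?exprn_even_gt0// => /fro2_eq0 vT0.
by move: v0; rewrite -[v]trmxK vT0 trmx0 eqxx.
Qed.

Lemma resolvent_bound k (X : 'M[C]_(n, k)) :
  fro2 (invmx D *m X) <= fro2 X / complex.Im z ^+ 2.
Proof.
rewrite ler_pdivlMr ?exprn_even_gt0// mulrC.
by apply: le_trans (resolvent_lbound _) _; rewrite mulKVmx// resolvent_unit.
Qed.

Lemma resolvent_tr : (invmx D)^T = invmx D.
Proof. by rewrite trmx_inv /D linearB /= CmxT symS tr_scalar_mx. Qed.

Lemma resolvent_bound_r k (X : 'M[C]_(k, n)) :
  fro2 (X *m invmx D) <= fro2 X / complex.Im z ^+ 2.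
Proof.
by rewrite -fro2_tr trmx_mul resolvent_tr -(fro2_tr X) resolvent_bound.
Qed.

Lemma fro2_resolvent : fro2 (invmx D) <= n%:R / complex.Im z ^+ 2.
Proof.
have := resolvent_bound 1%:M; rewrite mulmx1 => /le_trans; apply.
by rewrite fro2_scalar nq1 mulr1.
Qed.

(** The Ward identity. With v = Q u, the number v^* D v is the conjugate of u^T Q u because u is
    real, and [Im_sesq] gives its imaginary part. *)
Lemma Im_resolvent_quad (u : 'cV[R]_n) :
  complex.Im (((Cmx u)^T *m invmx D *m Cmx u) 0 0) =
  complex.Im z * fro2 (invmx D *m Cmx u).
Proof.
set v := invmx D *m Cmx u.
have Dv : D *m v = Cmx u by rewrite mulKVmx// resolvent_unit.
have := Im_sesq v; rewrite Dv.
have -> : \sum_i conjc (v i 0) * Cmx u i 0 = conjc (((Cmx u)^T *m invmx D *m Cmx u) 0 0).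
  rewrite -mulmxA -/v mxE rmorph_sum; apply: eq_bigr => i _.
  by rewrite !mxE rmorphM mulrC; congr (_ * _); rewrite /= /toC oppr0.
by case: (_ 0 0) => a b /=; rewrite mulNr => /oppr_inj.
Qed.

End Resolvent.
End Frobenius.

(** * Schur complement of one row of the noise *)

Section NoiseResolvent.
Variable R : realType.
Local Notation C := R[i].
Implicit Types (s : R) (z : C).

(** For standard Gaussian entries p I is the mean of W W^T, so this is the centred Gram matrix. *)
Definition gramc n p s (W : 'M[R]_(n, p)) : 'M[R]_n := s *: (W *m W^T - p%:R%:M).

Lemma gramc_sym n p s (W : 'M[R]_(n, p)) : (gramc s W)^T = gramc s W.
Proof. by rewrite /gramc linearZ /= linearB /= trmx_mul trmxK tr_scalar_mx. Qed.

Definition noiseQ n p s z (W : 'M[R]_(n, p)) : 'M[C]_n :=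
  invmx (Cmx (gramc s W) - z%:M).

Definition stieltjes n (Q : 'M[C]_n) : C := toC (n%:R)^-1 * \tr Q.

(* At a fixed point m = xstar, m^2 + z m + 1 = 0: this is the candidate diagonal
   entry produced by the Schur complement formula. *)
Definition xstar n z (Q : 'M[C]_n) : C := - (z + stieltjes Q)^-1.

Section Schur.
Variables (n p : nat) (s : R) (z : C) (w : 'M[R]_(1, p)) (V : 'M[R]_(n, p)).
Hypothesis z0 : complex.Im z != 0.
Let Q : 'M[C]_(1 + n) := noiseQ s z (col_mx w V).
Let RV := noiseQ s z V.
Let u : 'cV[R]_n := s *: (V *m w^T).
Let a : C := toC (s * ((w *m w^T) 0 0 - p%:R)) - z.
Let h : C := ((Cmx u)^T *m RV *m Cmx u) 0 0.
Let F := fro2 (RV *m Cmx u).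

Lemma schur_D : Cmx (gramc s (col_mx w V)) - z%:M =
  block_mx a%:M (Cmx u)^T (Cmx u) (Cmx (gramc s V) - z%:M).
Proof.
have -> : gramc s (col_mx w V) =
    block_mx (s * ((w *m w^T) 0 0 - p%:R))%:M u^T u (gramc s V) :> 'M[R]_(1 + n).
  rewrite /gramc tr_col_mx mul_col_row scalar_mx_block opp_block_mx add_block_mx.
  rewrite scale_block_mx !oppr0 !addr0 /u linearZ /= trmx_mul trmxK; congr block_mx.
  by apply/matrixP => i j; rewrite !ord1 !mxE /= !mulr1n.
rewrite {1}/Cmx map_block_mx scalar_mx_block opp_block_mx add_block_mx !oppr0 !addr0.
rewrite -!/(Cmx _) CmxT; congr block_mx.
by rewrite Cmx_scalar -raddfB.
Qed.

(** By the Ward identity the imaginary parts of a and of - h both have the sign opposite to Im z, so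
    they add up. Besides invertibility of the Schur complement this gives the factor 1 + F that
    [schur_tr] consumes. *)
Lemma schur_Im : complex.Im (a - h) = - complex.Im z * (1 + F).
Proof.
rewrite /a /h raddfB /= Im_resolvent_quad ?gramc_sym// -/RV -/F.
by case: z => z1 z2 /=; ring.
Qed.

Lemma schur_neq0 : a - h != 0.
Proof.
apply/eqP => e; have := schur_Im; rewrite e /= => /esym/eqP.
rewrite mulf_eq0 oppr_eq0 (negbTE z0) /= => /eqP.
by have := fro2_ge0 (RV *m Cmx u); rewrite -/F; lra.
Qed.

Let g := (a - h)^-1.

(** Checked by multiplying the candidate on the left by the block form of the matrix to be
    inverted. *)
Lemma schur_Q : Q = block_mx g%:M (- g *: ((Cmx u)^T *m RV)) (- g *: (RV *m Cmx u))
   (RV + g *: (RV *m Cmx u *m ((Cmx u)^T *m RV))).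
Proof.
have U : Cmx (gramc s (col_mx w V)) - z%:M \in unitmx.
  by apply: resolvent_unit => //; exact: gramc_sym.
have UV : Cmx (gramc s V) - z%:M \in unitmx.
  by apply: resolvent_unit => //; exact: gramc_sym.
rewrite /Q /noiseQ; apply: (can_inj (mulKmx U)); rewrite mulmxV// schur_D.
have hE : (Cmx u)^T *m (RV *m Cmx u) = h%:M by rewrite mulmxA [LHS]mx11_scalar.
have gE : g * (a - h) = 1 by rewrite mulVf// schur_neq0.
rewrite mulmx_block scalar_mx_block; congr block_mx.
- rewrite -scalemxAr hE -gE; apply/matrixP => i j.
  by rewrite !ord1 !mxE big_ord1 !mxE /= !mulr1n mulrBr mulrC mulNr.
- rewrite mulmxDr -!scalemxAr (mulmxA _ (_ *m _)) hE !mul_scalar_mx !scalerA addrCA -scalerDl.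
  rewrite -[X in X + _]scale1r -scalerDl.
  suff -> : 1 + (- g * a + g * h) = 0 by rewrite scale0r.
  by rewrite -gE mulrBr mulNr; ring.
- rewrite mul_mx_scalar -scalemxAr /RV /noiseQ mulKVmx// -scalerDl subrr scale0r//.
- rewrite mulmxDr -!scalemxAr /RV /noiseQ mulmxV// -/(noiseQ s z V) -/RV.
  rewrite -mulmxA {2}/RV /noiseQ mulKVmx// mulmxA addrCA scaleNr.
  by rewrite addNr addr0.
Qed.

Lemma schur_Q00 : Q 0 0 * (a - h) = 1.
Proof.
have -> : Q 0 0 = g.
  rewrite schur_Q; have -> : (0 : 'I_(1 + n)) = lshift n (0 : 'I_1) by apply: val_inj.
  by rewrite block_mxEul mxE mulr1n.
by rewrite mulVf// schur_neq0.
Qed.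

(** The difference of traces is g (1 + t) with t = tr (R u u^T R) and |t| <= F, while |g| <= 1 /
    (|Im z| (1 + F)). The factors 1 + F cancel, so removing a row costs O(1) whatever the size of
    u. *)
Lemma schur_tr : nq (\tr Q - \tr RV) <= (complex.Im z ^+ 2)^-1.
Proof.
rewrite schur_Q mxtrace_block linearD /= linearZ /= mxtrace_mulC.
rewrite (_ : \tr g%:M = g); last by rewrite mxtrace_scalar.
set t := \tr (_ *m (_ *m _)).
rewrite (_ : _ - _ = g * (1 + t)); last by rewrite addrCA addrAC subrr add0r mulrDr mulr1.
have F0 : 0 <= F by exact: fro2_ge0.
have t1 : nq t <= F ^+ 2.
  apply: le_trans (nq_trM _ _) _.
  rewrite -{1}fro2_tr trmx_mul trmxK.
  by rewrite (resolvent_tr _ (gramc_sym s V)) expr2.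
have t2 : nq (1 + t) <= (1 + F) ^+ 2.
  move: t1; case: t => x y; rewrite /nq /= => t1.
  suff : x <= F by nra.
  apply: le_trans (ler_norm _) _; rewrite -ler_sqr ?nnegrE// real_normK ?num_real//.
  by have := sqr_ge0 y; lra.
rewrite nqM nqV.
have y2 : 0 < complex.Im z ^+ 2 by rewrite exprn_even_gt0.
have n1 : complex.Im z ^+ 2 * (1 + F) ^+ 2 <= nq (a - h).
  by apply: le_trans (Im2_le_nq _); rewrite schur_Im exprMn sqrrN.
have F2 : 0 < (1 + F) ^+ 2 by apply: exprn_gt0; lra.
have nn : 0 < nq (a - h) by apply: lt_le_trans n1; rewrite mulr_gt0.
rewrite mulrC ler_pdivrMr// mulrC ler_pdivlMr// mulrC.
by apply: le_trans n1; rewrite ler_pM2l.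
Qed.

End Schur.

Lemma conj_Cmx m n (A : 'M[R]_(m, n)) : map_mx (@conjc R) (Cmx A) = Cmx A.
Proof. by apply/matrixP => i j; rewrite !mxE /= oppr0. Qed.

Lemma fro2_conj m n (A : 'M[C]_(m, n)) : fro2 (map_mx (@conjc R) A) = fro2 A.
Proof.
do 2 (apply: eq_bigr => ? _); rewrite mxE; case: (A _ _) => x y.
by rewrite /nq /= sqrrN.
Qed.

Lemma fro2_trE m n (A : 'M[C]_(m, n)) : toC (fro2 A) = \tr (A *m (map_mx (@conjc R) A)^T).
Proof.
rewrite -[toC _]/(real_complex R _) rmorph_sum /mxtrace; apply: eq_bigr => i _.
rewrite rmorph_sum mxE; apply: eq_bigr => j _; rewrite !mxE.
case: (A i j) => x y; apply/eqP; rewrite eq_complex /nq /=; apply/andP; split; apply/eqP; ring.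
Qed.

(** With G = V V^T, cyclicity turns the trace form of the left side into tr (S G conj(S) G), to
    which Cauchy-Schwarz applies. The p x p matrix is thereby controlled by an n x n one, S G, which
    is explicit when S is the resolvent. *)
Lemma fro2_sandwich n p (S : 'M[C]_n) (V : 'M[R]_(n, p)) : S^T = S ->
  fro2 ((Cmx V)^T *m S *m Cmx V) <= fro2 (S *m Cmx (V *m V^T)).
Proof.
move=> symS; rewrite -ler_sqr ?nnegrE ?fro2_ge0// -nq_toC fro2_trE.
have -> : (map_mx (@conjc R) ((Cmx V)^T *m S *m Cmx V))^T =
    (Cmx V)^T *m (map_mx (@conjc R) S *m Cmx V).
  by rewrite map_trmx !trmx_mul trmxK symS !CmxT !map_mxM !conj_Cmx.
have -> : \tr ((Cmx V)^T *m S *m Cmx V *m ((Cmx V)^T *m (map_mx (@conjc R) S *m Cmx V))) =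
    \tr (S *m Cmx (V *m V^T) *m (map_mx (@conjc R) S *m Cmx (V *m V^T))).
  by rewrite -!mulmxA mxtrace_mulC !CmxM -CmxT -!mulmxA.
apply: le_trans (nq_trM _ _) _; rewrite expr2 ler_wpM2l ?fro2_ge0//.
by rewrite -[leRHS]fro2_conj map_mxM conj_Cmx.
Qed.

End NoiseResolvent.

(** * Distance from a diagonal entry of the resolvent to [xstar] *)

Section RowBound.
Variable R : realType.
Local Notation C := R[i].
Implicit Types (s : R) (z : C).

Lemma toCM (x y : R) : toC (x * y) = toC x * toC y.
Proof. by rewrite -![toC _]/(real_complex R _) rmorphM. Qed.
Lemma toCD (x y : R) : toC (x + y) = toC x + toC y.
Proof. by rewrite -![toC _]/(real_complex R _) rmorphD. Qed.
Lemma toCN (x : R) : toC (- x) = - toC x.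
Proof. by rewrite -![toC _]/(real_complex R _) rmorphN. Qed.
Lemma toC_nat (n : nat) : toC (n%:R : R) = n%:R.
Proof. by rewrite -![toC _]/(real_complex R _) rmorph_nat. Qed.
Lemma toC1 : toC (1 : R) = 1. Proof. by []. Qed.
Lemma toC_eq0 (x : R) : (toC x == 0) = (x == 0).
Proof. by rewrite -![toC _]/(real_complex R _) fmorph_eq0. Qed.

Section Stieltjes.
Variables (n : nat) (S : 'M[R]_n) (z : C).
Hypothesis symS : S^T = S.
Hypothesis z0 : complex.Im z != 0.
Let Q := invmx (Cmx S - z%:M).

(** The Ward identity summed over the basis vectors. *)
Lemma Im_stieltjes : complex.Im (stieltjes Q) = complex.Im z * (fro2 Q / n%:R).
Proof.
have -> : complex.Im (stieltjes Q) = n%:R^-1 * complex.Im (\tr Q).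
  by rewrite /stieltjes; case: (\tr Q) => x y /=; ring.
have -> : complex.Im (\tr Q) = complex.Im z * fro2 Q.
  rewrite raddf_sum fro2_col mulr_sumr; apply: eq_bigr => i _.
  have := Im_resolvent_quad symS z0 (delta_mx i 0).
  have -> : Cmx (delta_mx i 0 : 'cV[R]_n) = delta_mx i 0 :> 'cV[C]_n.
    by rewrite CmxE map_delta_mx.
  by rewrite -/Q (colE i Q) => <-; rewrite trmx_delta -rowE -colE !mxE.
by ring.
Qed.

(** The imaginary parts of z and of the normalised trace have the same sign and cannot
    compensate. *)
Lemma nq_zst : complex.Im z ^+ 2 <= nq (z + stieltjes Q).
Proof.
apply: le_trans (Im2_le_nq _); rewrite raddfD /= Im_stieltjes.
rewrite -{2}[complex.Im z]mulr1 -mulrDr exprMn ler_peMr ?sqr_ge0//.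
by rewrite exprn_ege1// lerDl divr_ge0// fro2_ge0.
Qed.

Lemma zst_neq0 : z + stieltjes Q != 0.
Proof.
rewrite -nq_eq0 gt_eqF//; apply: lt_le_trans nq_zst.
by rewrite exprn_even_gt0.
Qed.

Lemma nq_xstar : nq (xstar z Q) <= (complex.Im z ^+ 2)^-1.
Proof.
have y2 : 0 < complex.Im z ^+ 2 by rewrite exprn_even_gt0.
rewrite /xstar nqN nqV lef_pV2 ?posrE ?nq_zst//.
exact: lt_le_trans nq_zst.
Qed.

Lemma nq_tr_resolvent : nq (\tr Q) <= n%:R ^+ 2 / complex.Im z ^+ 2.
Proof.
rewrite -[Q]mulmx1; apply: le_trans (nq_trM _ _) _.
rewrite fro2_scalar nq1 mulr1 mulrC expr2 -mulrA ler_wpM2l//.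
exact: fro2_resolvent.
Qed.

Lemma nq_stieltjes : nq (stieltjes Q) <= (complex.Im z ^+ 2)^-1.
Proof.
rewrite /stieltjes; have [n0|n0] := posnP n.
  have -> : n%:R = 0 :> R by rewrite n0.
  by rewrite invr0 mul0r nq0 invr_ge0 sqr_ge0.
have np : 0 < n%:R :> R by rewrite ltr0n.
rewrite nqM nq_toC exprVn mulrC ler_pdivrMr ?exprn_gt0// mulrC.
exact: nq_tr_resolvent.
Qed.

End Stieltjes.

Section Bound.
Variables (n p : nat) (s K : R) (z : C) (w : 'M[R]_(1, p)) (V : 'M[R]_(n, p)).
Hypothesis z0 : complex.Im z != 0.
Let N : R := n.+1%:R.
Hypothesis hs : s ^+ 2 * (N * p%:R) = 1.
Hypothesis hK : N ^+ 2 <= K * p%:R.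
Let Q : 'M[C]_(1 + n) := noiseQ s z (col_mx w V).
Let RV := noiseQ s z V.
Let y2 := complex.Im z ^+ 2.

(* The term - s I accounts for the diagonal entry s (w w^T - p): the random part of
   the Schur complement of the row w is then minus quadc rowB w. *)
Definition rowB n p s z (V : 'M[R]_(n, p)) : 'M[C]_p :=
  toC (s ^+ 2) *: ((Cmx V)^T *m noiseQ s z V *m Cmx V) - (toC s)%:M.

(** The subtracted trace is the mean of the quadratic form for a standard Gaussian row. *)
Definition quadc p (B : 'M[C]_p) (w : 'M[R]_(1, p)) : C :=
  (Cmx w *m B *m (Cmx w)^T) 0 0 - \tr B.

(** [cst1] bounds N times the squared Frobenius norm of [rowB]. [cst2] collects the two
    deterministic errors of [row_bound]: the change of trace (1 / y2) and the drift [e2], with the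
    factors 2 of two successive uses of |x + y|^2 <= 2 |x|^2 + 2 |y|^2. *)
Definition cst1 (K : R) z : R :=
  2 * (4 * K * (1 + nq z / complex.Im z ^+ 2) + 4 / complex.Im z ^+ 2) + 2.
Definition cst2 (K : R) z : R :=
  2 * (2 / complex.Im z ^+ 2 + 2 * (K * (2 + 2 * nq z / complex.Im z ^+ 2))).

Let y2p : 0 < y2. Proof. by rewrite exprn_even_gt0. Qed.
Let N1 : 1 <= N. Proof. by rewrite ler1n. Qed.
Let Np : 0 < N. Proof. by rewrite ltr0n. Qed.
Let s0 : s != 0.
Proof. by apply: contra_eq_neq hs => ->; rewrite expr0n mul0r eq_sym oner_eq0. Qed.
Let p0 : 0 < p%:R :> R.
Proof.
rewrite ltr0n lt0n; apply: contra_eqN hs => /eqP ->.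
by rewrite mulr0 mulr0 eq_sym oner_eq0.
Qed.
Let nN : n%:R <= N. Proof. by rewrite ler_nat. Qed.
Let K0 : 0 <= K.
Proof. by rewrite -(pmulr_lge0 _ p0); apply: le_trans hK; exact: sqr_ge0. Qed.
Let NK : N <= K * p%:R.
Proof. by apply: le_trans hK; rewrite expr2 ler_peMr// ltW. Qed.

(** Since s V V^T is the matrix inverted by R plus the scalar z + s p, the product R V V^T depends
    on R alone. Bounds on R then suffice, with none on the norm of V. *)
Let RG : toC s *: (RV *m Cmx (V *m V^T)) = 1%:M + (z + toC (s * p%:R)) *: RV.
Proof.
have UV : Cmx (gramc s V) - z%:M \in unitmx.
  by apply: resolvent_unit => //; exact: gramc_sym.
have -> : toC s *: (RV *m Cmx (V *m V^T)) =
    RV *m ((Cmx (gramc s V) - z%:M) + (z + toC (s * p%:R))%:M).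
  rewrite scalemxAr -CmxZ; congr (_ *m _).
  rewrite raddfD /= addrA subrK -Cmx_scalar -CmxD /gramc scalerBr; congr Cmx.
  by rewrite scale_scalar_mx subrK.
by rewrite mulmxDr /RV /noiseQ mulVmx// mul_mx_scalar.
Qed.

(** [fro2_sandwich] and [RG] reduce the claim to the resolvent bound. The term 1 + z R is paid by
    s^2 n N <= K, the term s p R by s^4 p^2 n N <= 1, and the diagonal correction s I by s^2 p = 1 /
    N. *)
Lemma fro2_rowB : fro2 (rowB s z V) <= cst1 K z / N.
Proof.
have f1 : fro2 (RV *m Cmx (V *m V^T)) * s ^+ 2 <=
    4 * (n%:R * (1 + nq z / y2)) + (4 * (s * p%:R) ^+ 2) * (n%:R / y2).
  rewrite mulrC -nq_toC -fro2Z RG scalerDl addrA.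
  apply: le_trans (fro2D _ _) _; rewrite fro2Z nq_toC.
  have fR : fro2 RV <= n%:R / y2 by apply: fro2_resolvent => //; exact: gramc_sym.
  have f2 : fro2 (1%:M + z *: RV) <= 2 * (n%:R * (1 + nq z / y2)).
    apply: le_trans (fro2D _ _) _; rewrite fro2_scalar nq1 fro2Z.
    have := ler_wpM2l (nq_ge0 z) fR; rewrite !mulrDr !mulrA [nq z * n%:R]mulrC; lra.
  have := ler_wpM2l (sqr_ge0 (s * p%:R)) fR.
  have := mulr_ge0 (sqr_ge0 (s * p%:R)) (fro2_ge0 RV).
  lra.
have f3 : fro2 (rowB s z V) <=
    2 * (s ^+ 2 * (fro2 (RV *m Cmx (V *m V^T)) * s ^+ 2)) + 2 * (p%:R * s ^+ 2).
  apply: le_trans (fro2B _ _) _; rewrite fro2Z fro2_scalar !nq_toC lerD2r.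
  have := fro2_sandwich V (resolvent_tr z (gramc_sym s V)).
  by move/(ler_wpM2l (sqr_ge0 (s ^+ 2))); rewrite -/(noiseQ s z V) -/RV; lra.
apply: le_trans f3 _.
have sp : p%:R * s ^+ 2 = N^-1.
  apply: (mulIf (lt0r_neq0 Np)); rewrite mulVf ?gt_eqF//; apply: etrans hs; ring.
have sN : s ^+ 2 * n%:R * N <= K.
  rewrite -(ler_pM2r p0); apply: le_trans NK.
  have -> : s ^+ 2 * n%:R * N * p%:R = s ^+ 2 * (N * p%:R) * n%:R by ring.
  by rewrite hs mul1r.
have s4 : s ^+ 2 * (s * p%:R) ^+ 2 * n%:R * N <= 1.
  have -> : s ^+ 2 * (s * p%:R) ^+ 2 * n%:R * N = (p%:R * s ^+ 2) ^+ 2 * N * n%:R by ring.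
  rewrite sp -mulrA expr2 -mulrA mulKf ?gt_eqF// ler_pdivrMl// mulr1//.
have i0 : 0 <= y2^-1 by rewrite invr_ge0 ltW.
have z1 : 0 <= 1 + nq z / y2 by rewrite addr_ge0// mulr_ge0// nq_ge0.
rewrite ler_pdivlMr// sp mulrDl divfK ?gt_eqF// /cst1 -/y2 lerD2r.
have s2N : 0 <= s ^+ 2 * N by rewrite mulr_ge0 ?sqr_ge0// ltW.
have := ler_wpM2r s2N f1.
have := ler_wpM2r z1 sN; have := ler_wpM2r i0 s4.
lra.
Qed.

Lemma tr_rowB : \tr (rowB s z V) =
  toC s * (n%:R + (z + toC (s * p%:R)) * \tr RV) - p%:R * toC s.
Proof.
rewrite /rowB linearB /= mxtrace_scalar; congr (_ - _); last by rewrite mulr_natl.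
rewrite linearZ /= mxtrace_mulC mulmxA mxtrace_mulC CmxT -CmxM.
rewrite expr2 toCM -mulrA; congr (_ * _).
by have := congr1 (@mxtrace _ _) RG; rewrite linearZ linearD /= linearZ /= mxtrace1.
Qed.

(** The entry is 1 / ah and [xstar] is - 1 / (z + m), so their difference is (ah + z + m) / (ah (z +
    m)), where both factors below have modulus at least |Im z|. The numerator consists of the random
    quadratic form, the change of trace due to the removed row, and the drift [e2]. *)
Lemma row_bound : nq (Q 0 0 - xstar z Q) <=
  (2 * nq (quadc (rowB s z V) w) + cst2 K z / N) / y2 ^+ 2.
Proof.
have := schur_Q00 s w V z0; have := schur_Im s w V z0.
set ah := (X in complex.Im X) => Iah Qah.
set F := fro2 _ in Iah.
have F0 : 0 <= F by exact: fro2_ge0.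
have nah : y2 <= nq ah.
  apply: le_trans (Im2_le_nq _); rewrite Iah exprMn sqrrN ler_peMr ?sqr_ge0//.
  by rewrite exprn_ege1// lerDl.
have ah0 : ah != 0 by rewrite -nq_eq0 gt_eqF//; apply: lt_le_trans nah.
have symg := gramc_sym s (col_mx w V).
have zm0 := zst_neq0 symg z0; have nzm := nq_zst symg z0.
have hst := nq_stieltjes symg z0.
rewrite -/(noiseQ s z (col_mx w V)) -/Q in zm0 nzm hst.
set m := stieltjes Q in zm0 nzm hst *.
set q := quadc _ _.
(* What is left of tr [rowB] plus s p once the main term tr R / N, coming from s (s p) = 1 / N, is
   taken out. It is small because s^2 N^2 = N / p <= K / N. *)
pose e2 := toC s * (n%:R + z * \tr RV).
have Nc : toC N = n.+1%:R by rewrite toC_nat.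
have delta : ah = - (z + m) + (- q + (m - toC N^-1 * \tr RV - e2)).
  rewrite /ah /q /quadc tr_rowB /e2.
  set r := \tr RV.
  have -> : (Cmx w *m rowB s z V *m (Cmx w)^T) 0 0 =
     ((Cmx (s *: (V *m w^T)))^T *m noiseQ s z V *m Cmx (s *: (V *m w^T))) 0 0
     - toC s * toC ((w *m w^T) 0 0).
    rewrite /rowB mulmxBr mulmxBl mxE [(- (_ *m _)) 0 0]mxE; congr (_ - _).
      have -> : Cmx (s *: (V *m w^T)) = toC s *: (Cmx V *m (Cmx w)^T).
        by rewrite CmxZ CmxM CmxT.
      rewrite [(_ *: _)^T]linearZ /= trmx_mul trmxK -!scalemxAl -!scalemxAr scalerA.
      by rewrite -?scalemxAl -toCM -expr2 !mulmxA.
    by rewrite mul_mx_scalar -scalemxAl mxE CmxT -CmxM mxE.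
  set h := _ 0 0; set ww := (_ *m _) 0 0.
  have hN : toC N^-1 = toC s * toC (s * p%:R).
    rewrite -toCM; congr toC; apply: (mulIf (lt0r_neq0 Np)).
    by rewrite mulVf ?gt_eqF//; apply: etrans (esym hs) _; ring.
  by rewrite hN !toCM toCD toCN toC_nat; ring.
have ne2 : nq e2 <= K * (2 + 2 * nq z / y2) / N.
  rewrite ler_pdivlMr// -(ler_pM2r p0) nqM nq_toC.
  have ->: forall t : R, s ^+ 2 * t * N * p%:R = s ^+ 2 * (N * p%:R) * t by move=> t; ring.
  rewrite hs mul1r mulrAC.
  have h1 : nq (n%:R + z * \tr RV) <= N ^+ 2 * (2 + 2 * nq z / y2).
    apply: le_trans (nqD _ _) _; rewrite -toC_nat nq_toC nqM.
    have h2 : nq (\tr RV) <= N ^+ 2 / y2.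
      apply: le_trans (nq_tr_resolvent (gramc_sym s V) z0) _.
      by rewrite ler_pM2r ?invr_gt0// lerXn2r// nnegrE.
    have h3 : n%:R ^+ 2 <= N ^+ 2 :> R by rewrite lerXn2r// nnegrE.
    have := ler_wpM2l (nq_ge0 z) h2; lra.
  apply: le_trans h1 _; rewrite ler_wpM2r// addr_ge0// mulr_ge0//.
    by rewrite mulr_ge0// nq_ge0.
  by rewrite invr_ge0 ltW.
have nm : nq (m - toC N^-1 * \tr RV) <= y2^-1 / N.
  have -> : m - toC N^-1 * \tr RV = toC N^-1 * (\tr Q - \tr RV).
    by rewrite /m /stieltjes mulrBr.
  rewrite nqM nq_toC exprVn mulrC.
  apply: ler_pM; rewrite ?nq_ge0 ?invr_ge0 ?exprn_ge0 ?(ltW Np)//.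
    exact: schur_tr.
  rewrite lef_pV2 ?posrE ?exprn_gt0//.
  by rewrite expr2 ler_peMr// ltW.
have -> : Q 0 0 - xstar z Q = (- q + (m - toC N^-1 * \tr RV - e2)) / (ah * (z + m)).
  have -> : Q 0 0 = ah^-1 by apply: (mulIf ah0); rewrite mulVf.
  have -> : (- q + (m - toC N^-1 * \tr RV - e2)) = ah + (z + m).
    by rewrite delta; ring.
  by rewrite /xstar -/m opprK; field; rewrite ah0 zm0.
have yy : 0 < y2 ^+ 2 by rewrite exprn_gt0.
rewrite nqM nqV nqM.
apply: ler_pM; rewrite ?nq_ge0 ?invr_ge0 ?mulr_ge0 ?nq_ge0//; last first.
  have h : y2 ^+ 2 <= nq ah * nq (z + m) by rewrite expr2 ler_pM// ltW.
  by rewrite lef_pV2 ?posrE//; apply: lt_le_trans h.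
apply: le_trans (nqD _ _) _; rewrite nqN lerD2l.
have h3 := nqB (m - toC N^-1 * \tr RV) e2.
rewrite /cst2 -/y2. move: h3 nm ne2; set X := nq (_ - e2); set Y := nq (_ - _); set Z := nq e2.
by generalize (y2^-1) (N^-1) X Y Z => {X Y Z} i1 i2 X Y Z; lra.
Qed.

End Bound.
End RowBound.

Import HBNNSimple.

(** * Integration against a measure given by a density *)

Section Density.
Local Open Scope ereal_scope.
Context d (T : measurableType d) (R : realType).
Variables (mu nu : {measure set T -> \bar R}) (g : T -> R).
Hypothesis mg : measurable_fun setT g.
Hypothesis g0 : forall x, (0 <= g x)%R.
Hypothesis nuE : forall A, measurable A -> nu A = \int[mu]_(x in A) (g x)%:E.

(** Both sides commute with increasing limits of simple functions, and on level sets the claim is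
    the hypothesis on [nu]. *)
Lemma ge0_integral_density (f : T -> \bar R) :
  measurable_fun setT f -> (forall x, 0 <= f x) ->
  \int[nu]_x f x = \int[mu]_x (f x * (g x)%:E).
Proof.
move=> mf f0.
pose h := nnsfun_approx measurableT mf.
have hf x : EFin \o (h ^~ x) @ \oo --> f x by apply: cvg_nnsfun_approx.
transitivity (limn (fun n => \int[nu]_x (h n x)%:E)).
  rewrite -monotone_convergence//.
  - by apply: eq_integral => x _; apply/esym/cvg_lim => //; exact: hf.
  - by move=> n; exact/measurable_EFinP/measurable_funP.
  - by move=> n x _; rewrite lee_fin.
  - by move=> x _ m n mn; rewrite lee_fin; exact/lefP/nd_nnsfun_approx.
transitivity (limn (fun n => \int[mu]_x ((h n x)%:E * (g x)%:E))); last first.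
  rewrite -monotone_convergence//.
  - apply: eq_integral => x _; apply/cvg_lim => //.
    by apply: cvgeZr => //; exact: hf.
  - move=> n; apply: emeasurable_funM; first exact/measurable_EFinP/measurable_funP.
    exact/measurable_EFinP.
  - by move=> n x _; rewrite mule_ge0// lee_fin.
  - move=> x _ m n mn; rewrite lee_wpmul2r ?lee_fin//.
    exact/lefP/nd_nnsfun_approx.
congr (limn _); apply/funext => n.
under eq_integral do rewrite fimfunE -fsumEFin//.
rewrite ge0_integral_fsum//; last 2 first.
- by move=> r; exact/measurable_EFinP/measurable_funM.
- by move=> r x _; rewrite nnfun_muleindic_ge0.
have e x : (h n x)%:E * (g x)%:E =
    \sum_(r \in range (h n)) ((r * \1_(h n @^-1` [set r]) x)%:E * (g x)%:E).
  rewrite fimfunE -fsumEFin// ge0_mule_fsuml// => r; exact: nnfun_muleindic_ge0.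
under [RHS]eq_integral do rewrite e.
rewrite ge0_integral_fsum//; last 2 first.
- move=> r; apply: emeasurable_funM; last exact/measurable_EFinP.
  exact/measurable_EFinP/measurable_funM.
- by move=> r x _; apply: mule_ge0; [exact: nnfun_muleindic_ge0|rewrite lee_fin].
apply: eq_fsbigr => r _.
rewrite integralZl_indic_nnsfun// integral_indic// setIT nuE//.
have [r0|r0] := ltP r 0%R.
  rewrite preimage_nnfun0// integral_set0 mule0 integral0_eq// => x _.
  by rewrite indic0 mulr0 mul0e.
rewrite [X in r%:E * X]integral_mkcond -ge0_integralZl//; last 2 first.
- apply/(measurable_restrictT _ _).1 => //; apply: measurable_funTS.
  exact/measurable_EFinP.
- by move=> x _; rewrite patchE; case: ifP => // _; rewrite lee_fin.
apply: eq_integral => x _; rewrite patchE indicE.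
by case: ifP => _; rewrite ?mulr1 ?mulr0 ?mul0e ?mule0.
Qed.

End Density.

(** * Rotation invariance of the planar Gaussian measure *)

Section Rotation.
Local Open Scope ereal_scope.
Variable R : realType.
Local Notation lam := (@lebesgue_measure R).
Local Notation RR := (measurableTypeR R).

Lemma lebesgue_measure_translate (t : R) (A : set R) : measurable A ->
  pushforward lam ((fun x => x + t)%R : RR -> RR) A = lam A.
Proof.
move=> mA; apply/esym/lebesgue_measure_unique => //=.
  by apply: measurable_funD.
move=> ? _ [[a b]] _ <-.
have -> : pushforward lam ((fun x => x + t)%R : RR -> RR) `]a, b]%classic =
    lam `](a - t)%R, (b - t)%R]%classic.
  rewrite /pushforward; congr (lam _); apply/seteqP; split => x /=.
    by rewrite !in_itv /= ltrBlDr lerBrDr.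
  by rewrite !in_itv /= ltrBlDr lerBrDr.
rewrite !lebesgue_measure_itv/= !lte_fin ltrD2r.
by case: ifP => // _; rewrite -!EFinD; congr EFin; lra.
Qed.

Lemma ge0_integral_translate (t : R) (f : R -> \bar R) :
  measurable_fun setT f -> (forall x, 0 <= f x) ->
  \int[lam]_x f (x + t)%R = \int[lam]_x f x.
Proof.
move=> mf f0.
have mt : measurable_fun setT ((fun x => x + t)%R : RR -> RR).
  by apply: measurable_funD.
have := ge0_integral_pushforward mt lam measurableT mf.
rewrite preimage_setT => /(_ (fun y _ => f0 y)) <-.
by apply: eq_measure_integral => A mA _; exact: lebesgue_measure_translate.
Qed.

Let J (h : R * R -> \bar R) := \int[lam]_x \int[lam]_y h (x, y).

Let J_swap h : measurable_fun setT h -> (forall u, 0 <= h u) ->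
  J h = \int[lam]_y \int[lam]_x h (x, y).
Proof. by move=> mh h0; exact: (@fubini_tonelli _ _ _ _ R lam lam h mh h0). Qed.

Let J_shear2 (b : R) h : measurable_fun setT h -> (forall u, 0 <= h u) ->
  J (fun u => h (u.1, u.2 + b * u.1)%R) = J h.
Proof.
move=> mh h0; rewrite /J; apply: eq_integral => x _ /=.
rewrite (ge0_integral_translate (b * x) (f := fun y => h (x, y)))//.
by apply: measurableT_comp.
Qed.

Let J_shear1 (a : R) h : measurable_fun setT h -> (forall u, 0 <= h u) ->
  J (fun u => h (u.1 + a * u.2, u.2)%R) = J h.
Proof.
move=> mh h0; rewrite !J_swap//.
  apply: eq_integral => y _ /=.
  rewrite (ge0_integral_translate (a * y) (f := fun x => h (x, y)))//.
  by apply: measurableT_comp.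
apply: measurableT_comp => //; apply: measurable_fun_pair => //.
by apply: measurable_funD => //; apply: measurable_funM.
Qed.

(** A rotation of angle t is the product of three shears, with parameters a, s, a where a = (c - 1)
    / s = - tan (t / 2). Each shear translates one coordinate by a multiple of the other, so it
    preserves the iterated integral by Tonelli and translation invariance. The hypothesis s != 0 is
    what makes a meaningful. *)
Let J_rot (c s : R) h : (s != 0)%R -> (c ^+ 2 + s ^+ 2 = 1)%R ->
  measurable_fun setT h -> (forall u, 0 <= h u) ->
  J (fun u => h (c * u.1 - s * u.2, s * u.1 + c * u.2)%R) = J h.
Proof.
move=> s0 cs mh h0; pose a := ((c - 1) / s)%R.
pose h1 u := h (u.1 + a * u.2, u.2)%R.
pose h2 u := h1 (u.1, u.2 + s * u.1)%R.
have mh1 : measurable_fun setT h1.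
  apply: measurableT_comp => //; apply: measurable_fun_pair => //.
  by apply: measurable_funD => //; apply: measurable_funM.
have mh2 : measurable_fun setT h2.
  apply: measurableT_comp => //; apply: measurable_fun_pair => //.
  by apply: measurable_funD => //; apply: measurable_funM.
transitivity (J h1); last exact: (J_shear1 a mh h0).
transitivity (J h2); last by apply: (J_shear2 s mh1) => u; exact: h0.
transitivity (J (fun u => h2 (u.1 + a * u.2, u.2)%R)); last by apply: (J_shear1 a mh2) => u; exact: h0.
congr J; apply/funext => -[x y]; rewrite /h2 /h1 /=; congr (h (_, _)).
  rewrite /a; apply: (mulfI s0).
  have -> : (s * (x + (c - 1) / s * y + (c - 1) / s * (y + s * (x + (c - 1) / s * y))) =
    s * c * x + (c ^+ 2 - 1) * y)%R by field.
  have -> : (c ^+ 2 = 1 - s ^+ 2)%R by rewrite -cs; ring.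
  by ring.
by rewrite /a; field.
Qed.

Local Notation gam := (@normal_prob R 0 1).
Local Notation phi := (normal_pdf (0:R) 1).

Lemma normal_pdf_rot (c s x y : R) : (c ^+ 2 + s ^+ 2 = 1)%R ->
  (phi (c * x - s * y) * phi (s * x + c * y) = phi x * phi y)%R.
Proof.
move=> cs; rewrite !normal_pdfE ?oner_eq0//.
rewrite mulrACA [RHS]mulrACA; congr (_ * _)%R.
rewrite /normal_fun -!expRD; congr expR.
rewrite -!mulrDl; congr (_ / _)%R; rewrite !subr0 -!opprD; congr (- _)%R.
have -> : ((c * x - s * y) ^+ 2 + (s * x + c * y) ^+ 2 =
  (c ^+ 2 + s ^+ 2) * (x ^+ 2 + y ^+ 2))%R by ring.
by rewrite cs mul1r.
Qed.

Lemma normal_prob_integral (f : R -> \bar R) :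
  measurable_fun setT f -> (forall x, 0 <= f x) ->
  \int[gam]_x f x = \int[lam]_x (f x * (phi x)%:E).
Proof.
move=> mf f0; apply: ge0_integral_density => //; first exact: measurable_normal_pdf.
by move=> x; exact: normal_pdf_ge0.
Qed.

Let gauss2E (A : set (R * R)) : measurable A ->
  (gam \x gam) A = J (fun u => (\1_A u * (phi u.1 * phi u.2))%:E).
Proof.
move=> mA; rewrite /J /product_measure1 normal_prob_integral; last 2 first.
- exact: measurable_fun_xsection.
- by move=> x; exact: measure_ge0.
have mphi := @measurable_normal_pdf R 0 1.
apply: eq_integral => x _ /=.
have mxA : measurable (xsection A x) by exact: measurable_xsection.
rewrite /normal_prob muleC -ge0_integralZl//; last 3 first.
- by apply: measurable_funTS; exact/measurable_EFinP.
- by move=> y _; rewrite lee_fin normal_pdf_ge0.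
- by rewrite lee_fin normal_pdf_ge0.
rewrite integral_mkcond; apply: eq_integral => y _.
rewrite patchE mem_xsection indicE; case: ifP => _; rewrite ?mul0r ?mul1r//.
Qed.

Lemma normal_prob2_rot (c s : R) (A : set (R * R)) : (s != 0)%R ->
  (c ^+ 2 + s ^+ 2 = 1)%R -> measurable A ->
  (gam \x gam) ((fun u => (c * u.1 - s * u.2, s * u.1 + c * u.2)%R) @^-1` A) =
  (gam \x gam) A.
Proof.
move=> s0 cs mA.
have mr : measurable_fun setT (fun u : R * R => (c * u.1 - s * u.2, s * u.1 + c * u.2)%R).
  apply: measurable_fun_pair; first by apply: measurable_funB; apply: measurable_funM.
  by apply: measurable_funD; apply: measurable_funM.
have mphi := @measurable_normal_pdf R 0 1.
have mrA : measurable ((fun u : R * R => (c * u.1 - s * u.2, s * u.1 + c * u.2)%R) @^-1` A).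
  by rewrite -[X in measurable X]setTI; exact: mr.
rewrite (gauss2E mrA) (gauss2E mA).
apply: (etrans _ (@J_rot c s (fun u => (\1_A u * (phi u.1 * phi u.2))%:E) s0 cs _ _)).
- congr J; apply/funext => -[x y] /=.
  by rewrite normal_pdf_rot.
- apply/measurable_EFinP; apply: measurable_funM; first exact: measurable_indic.
  apply: measurable_funM.
    by apply: (measurableT_comp mphi measurable_fst).
  by apply: (measurableT_comp mphi measurable_snd).
- by move=> u; rewrite lee_fin !mulr_ge0// normal_pdf_ge0.
Qed.

End Rotation.

(** * Finite families of independent standard Gaussian variables *)

Section GaussianFamily.
Context (R : realType) (d0 : measure_display) (Omega : measurableType d0).
Variable P : probability Omega R.
Local Notation gam := (@normal_prob R 0 1).
Local Open Scope ereal_scope.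

(** Independence and the marginal laws in one formula on boxes; subfamilies are recovered by taking
    [B i] equal to [setT]. *)
Definition gfam (I : finType) (X : I -> Omega -> R) : Prop :=
  (forall i, measurable_fun setT (X i)) /\
  forall B : I -> set R, (forall i, measurable (B i)) ->
    P [set w | forall i, B i (X i w)] = \prod_i gam (B i).

Lemma gfam_of_independent (I : finType) (X : I -> Omega -> R) :
  (forall i, measurable_fun setT (X i)) -> mutually_independent P X ->
  (forall i B, measurable B -> P (X i @^-1` B) = gam B) -> gfam X.
Proof.
move=> mX indX lawX; split=> // B mB.
have := indX [set: I]%SET B mB.
have -> : \bigcap_(i in [set i | i \in [set: I]%SET]) (X i @^-1` B i) =
          [set w | forall i, B i (X i w)].
  by apply/seteqP; split => w /= h i; [apply: h; rewrite /= inE|move=> _; exact: h].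
move=> ->; under eq_bigl do rewrite inE.
by apply: eq_bigr => i _; exact: lawX.
Qed.

Lemma measurable_gfam_event d (T : measurableType d) (I : finType) (A : {set I})
    (X : I -> T -> R) (B : I -> set R) :
  (forall i, i \in A -> measurable_fun setT (X i)) -> (forall i, measurable (B i)) ->
  measurable [set w | forall i, i \in A -> B i (X i w)].
Proof.
move=> mX mB.
have -> : [set w | forall i, i \in A -> B i (X i w)] =
   \bigcap_(i in [set i | i \in A]) (X i @^-1` B i).
  by apply/seteqP; split.
apply: fin_bigcap_measurable => [|i iA]; first exact: finite_finset.
by rewrite -[X in measurable X]setTI; apply: mX.
Qed.

Lemma gfam_event (I : finType) (X : I -> Omega -> R) (A : {set I}) (B : I -> set R) :
  gfam X -> (forall i, measurable (B i)) ->
  P [set w | forall i, i \in A -> B i (X i w)] = \prod_(i in A) gam (B i).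
Proof.
move=> [mX lawX] mB; pose B' i := if i \in A then B i else setT.
have -> : [set w | forall i, i \in A -> B i (X i w)] = [set w | forall i, B' i (X i w)].
  apply/seteqP; split => w /= h i; rewrite /B'; first by case: ifP => // /h.
  by move=> iA; have := h i; rewrite /B' iA.
rewrite lawX; last by move=> i; rewrite /B'; case: ifP.
rewrite [RHS]big_mkcond; apply: eq_bigr => i _; rewrite /B'; case: ifP => // _.
exact: probability_setT.
Qed.

Lemma gfam_inj (I J : finType) (X : I -> Omega -> R) (f : J -> I) : injective f ->
  gfam X -> gfam (fun j => X (f j)).
Proof.
move=> injf gX; split=> [j|B mB]; first exact: gX.1.
pose B' i := if [pick j | f j == i] is Some j then B j else setT.
have B'f j : B' (f j) = B j.
  rewrite /B'; case: pickP => [k /eqP /injf ->//|/(_ j)]; by rewrite eqxx.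
have mB' i : measurable (B' i) by rewrite /B'; case: pickP.
have := gfam_event (f @: [set: J])%SET gX mB'.
have -> : [set w | forall i, i \in (f @: [set: J])%SET -> B' i (X i w)] =
    [set w | forall j, B j (X (f j) w)].
  apply/seteqP; split => w /= h; first by move=> j; rewrite -B'f; apply/h/imset_f; rewrite inE.
  by move=> i /imsetP[j _ ->]; rewrite B'f.
move=> ->; rewrite big_imset /=; last by move=> ? ? _ _; exact: injf.
by under eq_bigl do rewrite inE; apply: eq_bigr => j _; rewrite B'f.
Qed.

Lemma gfam_law (I : finType) (X : I -> Omega -> R) i (B : set R) : gfam X ->
  measurable B -> P (X i @^-1` B) = gam B.
Proof.
move=> gX mB; have := gfam_event [set i]%SET gX (fun _ => mB); rewrite big_set1 => <-.
by congr (P _); apply/seteqP; split => w /= h; [move=> j /set1P ->|apply: h; rewrite inE].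
Qed.

Lemma pi_system_unique d (T : measurableType d) (G : set (set T))
    (m1 m2 : {measure set T -> \bar R}) :
  G `<=` measurable -> setI_closed G -> G setT -> m1 setT < +oo ->
  (forall A, G A -> m1 A = m2 A) -> forall A, <<s G >> A -> m1 A = m2 A.
Proof.
move=> Gm GI GT m1T m12.
apply: (g_sigma_algebra_measure_unique G Gm (fun=> setT)) => //.
by apply/seteqP; split => // x _; exists 0%N.
Qed.

Definition image_measure d d' (T1 : measurableType d) (T2 : measurableType d')
    (m : {measure set T1 -> \bar R}) (f : T1 -> T2) (mf : measurable_fun setT f) :
    {measure set T2 -> \bar R} :=
  measure_function_pushforward__canonical__measure_function_Measure m mf.

Section Rotate.
Variables (I : finType) (X : I -> Omega -> R) (k k' : I) (c s : R).
Hypothesis gX : gfam X.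
Hypothesis kk' : k != k'.
Hypothesis s0 : (s != 0)%R.
Hypothesis cs : (c ^+ 2 + s ^+ 2 = 1)%R.

Definition rotate_pair (i : I) (w : Omega) : R :=
  (if i == k then c * X k w - s * X k' w
  else if i == k' then s * X k w + c * X k' w else X i w)%R.

(** The event E on the other coordinates is frozen. Restricted to E, the pair (X k, X k') has image
    measure P(E) times the planar Gaussian measure: the two agree on rectangles, a pi-system.
    Rotation invariance in the plane then concludes. *)
Lemma gfam_rotate_pair : gfam rotate_pair.
Proof.
have mX i := gX.1 i.
split=> [i|B mB].
  rewrite /rotate_pair; case: eqP => _.
    by apply: measurable_funB; apply: measurable_funM.
  by case: eqP => _ //; apply: measurable_funD; apply: measurable_funM.
pose A := (~: [set k; k'])%SET.
pose E := [set w | forall i, i \in A -> B i (X i w)].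
have mE : measurable E by apply: measurable_gfam_event.
pose RT := measurableTypeR R.
pose pr (w : Omega) : RT * RT := (X k w, X k' w).
have mpr : measurable_fun setT pr by apply: measurable_fun_pair; exact: mX.
(* P(E) as a nonnegative real, the form in which a measure is scaled. *)
pose r : {nonneg R} := NngNum (fine_ge0 (measure_ge0 P E)).
have PE : P E = r%:num%:E by rewrite /= fineK// fin_num_measure.
pose m1 := image_measure (mrestr P mE) mpr.
pose m2 : {measure set (RT * RT)%type -> \bar R} := mscale r (gam \x gam).
have split2 (F : I -> \bar R) :
    \prod_i F i = F k * F k' * \prod_(i in A) F i.
  rewrite (bigD1 k)//= (bigD1 k')//= 1?eq_sym// muleA; congr (_ * _).
  by apply: eq_bigl => i; rewrite !inE negb_or.
have PEE : P E = \prod_(i in A) gam (B i) by exact: gfam_event.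
have m12 D : measurable D -> m1 D = m2 D.
  pose G : set (set (RT * RT)) := [set C | exists C1 C2,
     [/\ measurable C1, measurable C2 & C = C1 `*` C2]].
  have mG : (measurable : set (set (RT * RT))) = <<s G >>.
    rewrite measurable_prod_measurableType; congr (<<s _ >>).
    apply/seteqP; split => [_ [C1 m1' [C2 m2' <-]]|C [C1 [C2 [m1' m2' ->]]]].
      by exists C1, C2.
    by exists C1 => //; exists C2.
  rewrite mG; apply: pi_system_unique.
  - by move=> C [C1 [C2 [m1' m2' ->]]]; exact: measurableX.
  - move=> _ _ [C1 [C2 [m1' m2' ->]]] [D1 [D2 [n1 n2 ->]]].
    by exists (C1 `&` D1), (C2 `&` D2); split; rewrite ?setXI//; exact: measurableI.
  - by exists setT, setT; split; rewrite ?setXTT.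
  - by rewrite /m1 /= /pushforward /mrestr; apply: le_lt_trans (probability_le1 _ _) _;
      rewrite ?ltry// preimage_setT setTI.
  move=> _ [C1 [C2 [m1' m2' ->]]].
  have -> : m2 (C1 `*` C2) = P E * (gam C1 * gam C2).
    by rewrite PE; congr (_ * _); exact: product_measure1E.
  have -> : m1 (C1 `*` C2) = P (pr @^-1` (C1 `*` C2) `&` E) by [].
  rewrite PEE.
  pose B' i := if i == k then C1 else if i == k' then C2 else B i.
  have -> : pr @^-1` (C1 `*` C2) `&` E = [set w | forall i, B' i (X i w)].
    apply/seteqP; split => w /=.
      move=> [[h1 h2] hE] i; rewrite /B'; case: eqP => [->//|/eqP ik].
      by case: eqP => [->//|/eqP ik']; apply: hE; rewrite !inE negb_or ik.
    move=> h; split; first split.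
    - by have := h k; rewrite /B' eqxx.
    - by have := h k'; rewrite /B' eqxx eq_sym (negbTE kk').
    - by move=> i; rewrite !inE negb_or => /andP[/negbTE ik /negbTE ik']; have := h i; rewrite /B' ik ik'.
  rewrite gX.2; last by move=> i; rewrite /B'; do 2 (case: ifP => // _).
  rewrite split2 /B' eqxx eq_sym (negbTE kk') eqxx muleC; congr (_ * _).
  by apply: eq_bigr => i; rewrite !inE negb_or => /andP[/negbTE -> /negbTE ->].
have -> : [set w | forall i, B i (rotate_pair i w)] =
    pr @^-1` ((fun u => (c * u.1 - s * u.2, s * u.1 + c * u.2)%R) @^-1` (B k `*` B k')) `&` E.
  apply/seteqP; split => w /=.
    move=> h; split; first split.
    - by have := h k; rewrite /rotate_pair eqxx.
    - by have := h k'; rewrite /rotate_pair eqxx eq_sym (negbTE kk').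
    - by move=> i; rewrite !inE negb_or => /andP[/negbTE ik /negbTE ik']; have := h i; rewrite /rotate_pair ik ik'.
  move=> [[h1 h2] hE] i; rewrite /rotate_pair; case: eqP => [->//|/eqP ik].
  by case: eqP => [->//|/eqP ik']; apply: hE; rewrite !inE negb_or ik.
transitivity (m1 ((fun u => (c * u.1 - s * u.2, s * u.1 + c * u.2)%R) @^-1` (B k `*` B k'))) => //.
have mr : measurable_fun setT (fun u : RT * RT => (c * u.1 - s * u.2, s * u.1 + c * u.2)%R).
  apply: measurable_fun_pair; first by apply: measurable_funB; apply: measurable_funM.
  by apply: measurable_funD; apply: measurable_funM.
have mBB : measurable (B k `*` B k') by exact: measurableX.
rewrite m12; last by rewrite -[X in measurable X]setTI; exact: mr.
transitivity (P E * (gam (B k) * gam (B k'))); last by rewrite split2 -PEE muleC.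
rewrite PE; congr (_ * _).
transitivity ((gam \x gam) (B k `*` B k')); first exact: normal_prob2_rot.
by apply: product_measure1E; exact: mB.
Qed.
End Rotate.

(** * Independent blocks of coordinates and Tonelli's theorem *)

Section IndependentBlocks.
Variables (I : finType) (X : I -> Omega -> R).
Hypothesis gX : gfam X.

Definition cyl (A : {set I}) : set (set Omega) :=
  [set E | exists B : I -> set R, (forall i, measurable (B i)) /\
    E = [set w | forall i, i \in A -> B i (X i w)]].

(* Omega itself with the sigma-algebra generated by X on A: functions of X on
   disjoint index sets are then integrated by Tonelli on Omega x Omega. *)
Definition sub_sigma (A : {set I}) := g_sigma_algebraType (cyl A).

Lemma cyl_setI A : setI_closed (cyl A).
Proof.
move=> _ _ [B [mB ->]] [C [mC ->]]; exists (fun i => B i `&` C i); split.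
  by move=> i; exact: measurableI.
apply/seteqP; split => w /=; first by move=> [h1 h2] i iA; split; [exact: h1|exact: h2].
by move=> h; split => i iA; have [] := h i iA.
Qed.

Lemma cyl_setT A : cyl A setT.
Proof. by exists (fun=> setT); split => //; apply/seteqP; split. Qed.

Lemma cyl_measurable A : cyl A `<=` measurable.
Proof. by move=> _ [B [mB ->]]; apply: measurable_gfam_event => // i _; exact: gX.1. Qed.

Lemma measurable_sub_sigma (A : {set I}) i : i \in A -> measurable_fun setT (X i : sub_sigma A -> R).
Proof.
move=> iA _ B mB; rewrite setTI; apply: sub_sigma_algebra.
exists (fun j => if j == i then B else setT); split; first by move=> j; case: ifP.
apply/seteqP; split => w /=; first by move=> h j _; case: eqP => [->|].
by move=> /(_ i iA); rewrite eqxx.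
Qed.

Lemma measurable_id_sub_sigma A : measurable_fun setT (fun w : Omega => w : sub_sigma A).
Proof.
move=> _ B mB; rewrite setTI preimage_id.
exact: (smallest_sub (@sigma_algebra_measurable _ Omega) (@cyl_measurable A)).
Qed.

(** Two monotone-class arguments: [step] extends the product rule from cylinders to the generated
    sigma-algebra in one factor while the other event stays fixed. For two cylinders over disjoint
    sets, the intersection is a cylinder over the union and the product of laws splits. *)
Lemma independent_blocks (A B : {set I}) E F : (forall i, i \in A -> i \notin B) ->
  <<s cyl A >> E -> <<s cyl B >> F -> P (E `&` F) = P E * P F.
Proof.
move=> AB sE sF.
have sub C G : <<s cyl C >> G -> measurable G.
  exact: (smallest_sub (@sigma_algebra_measurable _ Omega) (@cyl_measurable C)).
have step (G : set Omega) (mG : measurable G) C :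
    (forall D, cyl C D -> P (D `&` G) = P D * P G) ->
    forall D, <<s cyl C >> D -> P (D `&` G) = P D * P G.
  move=> h D sD.
  pose r : {nonneg R} := NngNum (fine_ge0 (measure_ge0 P G)).
  have PG : P G = r%:num%:E by rewrite /= fineK// fin_num_measure.
  have := @pi_system_unique _ _ (cyl C) (mrestr P mG) (mscale r P)
    (@cyl_measurable C) (@cyl_setI C) (cyl_setT C).
  have -> : P D * P G = mscale r P D by rewrite muleC PG.
  apply => //.
    apply: le_lt_trans (probability_le1 P _) (ltry _).
    by apply: measurableI.
  by move=> D' /h hD'; apply: etrans hD' _; rewrite muleC PG.
apply: (step F (sub _ _ sF) A) => //.
move=> D cD; rewrite setIC muleC; move: F sF; apply: (step D (cyl_measurable cD) B).
move=> F [BF [mBF ->]]; case: cD => BD [mBD ->].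
rewrite !(gfam_event _ gX)//.
pose C i := if i \in A then BD i else BF i.
have mC i : measurable (C i) by rewrite /C; case: ifP.
have -> : [set w | forall i, i \in B -> BF i (X i w)] `&` [set w | forall i, i \in A -> BD i (X i w)] =
   [set w | forall i, i \in (A :|: B)%SET -> C i (X i w)].
  apply/seteqP; split => w /=.
    move=> [h1 h2] i; rewrite inE /C; case: ifP => /= [/h2//|_]; exact: h1.
  move=> h; split => i iC; have := h i; rewrite inE iC ?orbT => /(_ isT); rewrite /C.
    by case: ifP => // /AB; rewrite iC.
  by rewrite iC.
have dAB : fintype.disjoint (mem A) (mem B).
  by rewrite disjoint_subset; apply/fintype.subsetP => i /AB.
rewrite (gfam_event _ gX)// (eq_bigl [predU A & B]); last by move=> i; rewrite !inE.
rewrite bigU//= muleC; congr (_ * _); apply: eq_bigr => i iC; rewrite /C ?iC//.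
by case: ifP => // /AB; rewrite iC.
Qed.

(** By independence the image of P under w -> (w, w) is the product of the two marginal laws on
    [sub_sigma A] and [sub_sigma B]; the integral over the diagonal is therefore a double
    integral. *)
Lemma independent_tonelli (A B : {set I}) (f : sub_sigma A * sub_sigma B -> \bar R) :
  (forall i, i \in A -> i \notin B) -> measurable_fun setT f -> (forall u, 0 <= f u) ->
  \int[P]_w f (w, w) = \int[P]_w2 \int[P]_w1 f (w1, w2).
Proof.
move=> AB mf f0.
have mA := @measurable_id_sub_sigma A; have mB := @measurable_id_sub_sigma B.
pose iA : {mfun Omega >-> sub_sigma A} := HB.pack (fun w : Omega => w : sub_sigma A)
  (isMeasurableFun.Build _ _ _ _ _ mA).
pose iB : {mfun Omega >-> sub_sigma B} := HB.pack (fun w : Omega => w : sub_sigma B)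
  (isMeasurableFun.Build _ _ _ _ _ mB).
pose PA := distribution P iA; pose PB := distribution P iB.
pose dg (w : Omega) : sub_sigma A * sub_sigma B := (w, w).
have mdg : measurable_fun setT dg by exact: measurable_fun_pair.
have e := @product_measure_unique _ _ _ _ R PA PB (image_measure P mdg).
transitivity (\int[image_measure P mdg]_u f u).
  rewrite ge0_integral_pushforward//.
transitivity (\int[PA \x PB]_u f u).
  apply: eq_measure_integral => D mD _; apply/esym/e => // E F mE mF.
  by rewrite /= /pushforward -(independent_blocks AB mE mF).
rewrite fubini_tonelli2// /fubini_G ge0_integral_pushforward//; last 2 first.
- exact: measurable_fun_fubini_tonelli_G.
- by move=> w _; exact: integral_ge0.
apply: eq_integral => w2 _ /=; rewrite ge0_integral_pushforward//.
by apply: measurableT_comp.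
Qed.

Lemma measurable_block_integral (A B : {set I}) (f : sub_sigma A * sub_sigma B -> \bar R) :
  measurable_fun setT f -> (forall u, 0 <= f u) ->
  measurable_fun setT (fun w2 : Omega => \int[P]_w1 f (w1, w2)).
Proof.
move=> mf f0.
have mA := @measurable_id_sub_sigma A; have mB := @measurable_id_sub_sigma B.
pose iA : {mfun Omega >-> sub_sigma A} := HB.pack (fun w : Omega => w : sub_sigma A)
  (isMeasurableFun.Build _ _ _ _ _ mA).
have mf' : measurable_fun setT (fun u : sub_sigma B * sub_sigma A => f (u.2, u.1)).
  by apply: measurableT_comp => //; apply: measurable_fun_pair.
have mG := @measurable_fun_fubini_tonelli_F _ _ _ _ R (distribution P iA)
  (fun u : sub_sigma B * sub_sigma A => f (u.2, u.1)) mf' (fun u => f0 _).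
have := measurableT_comp mG mB.
apply: eq_measurable_fun => w _ /=; rewrite /fubini_F ge0_integral_pushforward//.
have m1 : measurable_fun setT (fun y : sub_sigma A => (y, w) : sub_sigma A * sub_sigma B).
  by apply: measurable_fun_pair.
exact: (measurableT_comp mf m1).
Qed.

(** Plays the role of conditioning: the block B is frozen at w2, a bound is proved for the block A
    alone, and it is then averaged. *)
Lemma independent_le (A B : {set I}) (f : sub_sigma A * sub_sigma B -> \bar R)
    (g : Omega -> \bar R) :
  (forall i, i \in A -> i \notin B) -> measurable_fun setT f -> (forall u, 0 <= f u) ->
  measurable_fun setT g -> (forall w2, \int[P]_w1 f (w1, w2) <= g w2) ->
  \int[P]_w f (w, w) <= \int[P]_w g w.
Proof.
move=> AB mf f0 mg fg; rewrite (independent_tonelli AB mf f0); apply: ge0_le_integral => //.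
- by move=> w _; exact: integral_ge0.
- exact: measurable_block_integral.
Qed.

End IndependentBlocks.

End GaussianFamily.

(** * Random variables with finite moments of all orders *)

Section AllMoments.
Context (R : realType) (d0 : measure_display) (Omega : measurableType d0).
Variable P : probability Omega R.
Implicit Types f g : Omega -> R.

(** Stable under sums and products, so that integrability of any polynomial expression follows from
    its shape. *)
Definition Lall f := measurable_fun setT f /\
  forall k, P.-integrable setT (fun w => (`|f w| ^+ k)%:E).

Definition Ex f : R := fine (\int[P]_w (f w)%:E)%E.

Lemma Lall_cst c : Lall (fun=> c).
Proof.
by split => // k; apply: (finite_measure_integrable_cst P (`|c| ^+ k)).
Qed.

Let measurable_absX f k : measurable_fun setT f ->
  measurable_fun setT (fun w => (`|f w| ^+ k)%:E).
Proof.
by move=> mf; apply/measurable_EFinP; apply: measurable_funX; apply: measurableT_comp.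
Qed.

Lemma Lall_dom f (h : nat -> Omega -> R) : measurable_fun setT f ->
  (forall k, P.-integrable setT (EFin \o h k)) ->
  (forall k w, `|f w| ^+ k <= h k w) -> Lall f.
Proof.
move=> mf ih fh; split=> // k; apply: le_integrable (ih k) => //.
  exact: measurable_absX.
move=> w _ /=; rewrite lee_fin [leLHS]ger0_norm ?exprn_ge0//.
by apply: le_trans (fh k w) (ler_norm _).
Qed.

Lemma LallD f g : Lall f -> Lall g -> Lall (fun w => f w + g w).
Proof.
move=> [mf If] [mg Ig].
apply: (@Lall_dom _ (fun k w => 2 ^+ k * (`|f w| ^+ k + `|g w| ^+ k))).
- exact: measurable_funD.
- move=> k; rewrite [X in P.-integrable _ X](_ : _ = fun w =>
    ((2 ^+ k)%:E * ((`|f w| ^+ k)%:E + (`|g w| ^+ k)%:E))%E) //.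
  by apply: integrableZl => //; apply: integrableD.
move=> k w; have h a b : 0 <= a -> a <= b -> (a + b) ^+ k <= 2 ^+ k * (a ^+ k + b ^+ k) :> R.
  move=> a0 ab; have b0 := le_trans a0 ab.
  apply: (@le_trans _ _ ((2 * b) ^+ k)).
    by rewrite lerXn2r ?nnegrE ?addr_ge0 ?mulr_ge0//; lra.
  by rewrite exprMn ler_wpM2l ?exprn_ge0// lerDr exprn_ge0.
apply: (@le_trans _ _ ((`|f w| + `|g w|) ^+ k)).
  by rewrite lerXn2r ?nnegrE ?addr_ge0// ler_normD.
have [fg|/ltW gf] := leP `|f w| `|g w|; first exact: h.
by rewrite addrC [X in _ * X]addrC; exact: h.
Qed.

Lemma LallM f g : Lall f -> Lall g -> Lall (fun w => f w * g w).
Proof.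
move=> [mf If] [mg Ig].
apply: (@Lall_dom _ (fun k w => `|f w| ^+ (k + k) + `|g w| ^+ (k + k))).
- exact: measurable_funM.
- by move=> k; exact: (integrableD measurableT (If (k + k)%N) (Ig (k + k)%N)).
move=> k w; rewrite normrM exprMn !exprD.
have h (a b : R) : a * b <= a * a + b * b.
  by have := sqr_ge0 (a - b); have := sqr_ge0 (a + b); nra.
exact: h.
Qed.

Lemma LallX f k : Lall f -> Lall (fun w => f w ^+ k).
Proof.
move=> Lf; elim: k => [|k IH].
  by under eq_fun do rewrite expr0; exact: Lall_cst.
by under eq_fun do rewrite exprS; exact: LallM.
Qed.

Lemma LallN f : Lall f -> Lall (fun w => - f w).
Proof.
by move=> Lf; under eq_fun do rewrite -mulN1r; apply: LallM => //; exact: Lall_cst.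
Qed.

Lemma LallB f g : Lall f -> Lall g -> Lall (fun w => f w - g w).
Proof. by move=> Lf Lg; apply: LallD => //; exact: LallN. Qed.

Lemma Lall_sum (I : Type) (r : seq I) (Q : pred I) (F : I -> Omega -> R) :
  (forall i, Lall (F i)) -> Lall (fun w => \sum_(i <- r | Q i) F i w).
Proof.
move=> LF; elim: r => [|i r IH].
  by under eq_fun do rewrite big_nil; exact: Lall_cst.
under eq_fun do rewrite big_cons.
by case: (Q i) => //; apply: LallD.
Qed.

Lemma Lall_integrable f : Lall f -> P.-integrable setT (EFin \o f).
Proof.
move=> [mf /(_ 1%N) If]; apply: le_integrable If => //.
  exact/measurable_EFinP.
by move=> w _ /=; rewrite expr1 lee_fin normr_id.
Qed.

Lemma ExE f : Lall f -> (\int[P]_w (f w)%:E = (Ex f)%:E)%E.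
Proof.
by move=> /Lall_integrable If; rewrite /Ex fineK// integrable_fin_num.
Qed.

Lemma ExD f g : Lall f -> Lall g -> Ex (fun w => f w + g w) = Ex f + Ex g.
Proof.
move=> Lf Lg; apply: EFin_inj; rewrite EFinD -!ExE//; last exact: LallD.
rewrite -integralD//; exact: Lall_integrable.
Qed.

Lemma ExZ c f : Lall f -> Ex (fun w => c * f w) = c * Ex f.
Proof.
move=> Lf; apply: EFin_inj; rewrite EFinM -!ExE//; last by apply: LallM => //; exact: Lall_cst.
rewrite -integralZl//; exact: Lall_integrable.
Qed.

Lemma Ex_cst c : Ex (fun=> c) = c.
Proof. by rewrite /Ex integral_cst//= probability_setT mule1. Qed.

Lemma Ex_le f g : Lall f -> Lall g -> (forall w, f w <= g w) -> Ex f <= Ex g.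
Proof.
move=> Lf Lg fg; rewrite -lee_fin -!ExE//.
by apply: le_integral => //; [exact: Lall_integrable|exact: Lall_integrable|move=> w _; rewrite lee_fin].
Qed.

Lemma Ex_ge0 f : Lall f -> (forall w, 0 <= f w) -> 0 <= Ex f.
Proof. by move=> Lf f0; rewrite -[leLHS](Ex_cst 0) Ex_le//; exact: Lall_cst. Qed.

End AllMoments.

(** * Moments of the standard Gaussian law *)

Section GaussianMoments.
Variable R : realType.
Local Notation lam := (@lebesgue_measure R).
Local Notation gam := (@normal_prob R 0 1).

(** The quarter turn c = 0, s = 1 sends (x, y) to (- y, x); invariance on the strip B x R compares
    the law of - y with that of x. *)
Lemma normal_prob_sym (B : set R) : measurable B -> gam (-%R @^-1` B) = gam B.
Proof.
move=> mB.
have mNB : measurable (-%R @^-1` B) by rewrite -[X in measurable X]setTI; exact: oppr_measurable.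
have h := @normal_prob2_rot R 0 1 (B `*` setT) (oner_neq0 _).
have : (gam \x gam)%E (setT `*` (-%R @^-1` B)) = (gam \x gam)%E (B `*` setT).
  rewrite -h.
  - congr ((gam \x gam)%E _); apply/seteqP; split => -[x y] /=.
      by move=> [_ yB]; rewrite mul0r mul1r sub0r.
    by rewrite mul0r mul1r sub0r => -[yB _].
  - by rewrite expr0n expr1n add0r.
  - exact: measurableX.
have -> : (gam \x gam)%E (setT `*` (-%R @^-1` B)) = gam (-%R @^-1` B).
  by rewrite product_measure1E// -[RHS]mul1e; congr (_ * _)%E; exact: probability_setT.
move=> ->; rewrite product_measure1E// -[RHS]mule1; congr (_ * _)%E.
exact: probability_setT.
Qed.

(** Multiplying the standard density by this exponential gives r times the density of standard
    deviation r. *)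
Lemma integral_normal_expR (r : R) : 0 < r ->
  (\int[gam]_x (expR (- (r ^- 2 - 1) * x ^+ 2 / 2))%:E = r%:E)%E.
Proof.
move=> r0; rewrite normal_prob_integral; last 2 first.
- apply/measurable_EFinP; apply: measurableT_comp => //; apply: measurable_funM => //.
  by apply: measurable_funM => //; exact: measurable_funX.
- by move=> x; rewrite lee_fin expR_ge0.
have rn0 : r != 0 by rewrite gt_eqF.
transitivity (\int[lam]_x (r%:E * (normal_pdf 0 r x)%:E))%E; last first.
  rewrite ge0_integralZl//.
  - by rewrite integral_normal_pdf mule1.
  - by apply/measurable_EFinP; exact: measurable_normal_pdf.
  - by move=> x _; rewrite lee_fin normal_pdf_ge0.
  - by rewrite lee_fin ltW.
apply: eq_integral => x _; rewrite -!EFinM; congr EFin.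
rewrite !normal_pdfE ?oner_eq0// mulrCA.
have -> : normal_peak 1 = r * normal_peak r.
  rewrite /normal_peak -!mulrnAr expr1n mul1r sqrtrM ?sqr_ge0// sqrtr_sqr.
  by rewrite gtr0_norm// invfM mulrA mulfV// mul1r.
rewrite -[_ * normal_peak r * _]mulrA; congr (_ * (_ * _)).
rewrite /normal_fun -expRD; congr expR; rewrite !subr0 expr1n.
by rewrite -mulr_natr; field.
Qed.

End GaussianMoments.

Section GaussianVariable.
Context (R : realType) (d0 : measure_display) (Omega : measurableType d0).
Variable P : probability Omega R.
Local Notation gam := (@normal_prob R 0 1).
Local Notation Lall := (Lall P).
Local Notation Ex := (Ex P).

(** These moments stay symbolic: finiteness, from [Lall_gauss], and nonnegativity are what the
    estimates use. *)
Definition gmom (k : nat) : R := fine (\int[@normal_prob R 0 1]_x (`|x| ^+ k)%:E).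

Variable X : Omega -> R.
Hypothesis mX : measurable_fun setT X.
Hypothesis lawX : forall B, measurable B -> P (X @^-1` B) = gam B.

Lemma integral_law (f : R -> \bar R) : measurable_fun setT f -> (forall x, 0 <= f x)%E ->
  (\int[P]_w f (X w) = \int[gam]_x f x)%E.
Proof.
move=> mf f0; have mX' : measurable_fun setT (X : Omega -> measurableTypeR R) by [].
transitivity (\int[image_measure P mX']_x f x)%E.
  by rewrite ge0_integral_pushforward.
by apply: eq_measure_integral => A mA _; exact: lawX.
Qed.

Let quarter_expR : P.-integrable setT (fun w => (expR (X w ^+ 2 / 4))%:E).
Proof.
apply/integrableP; split.
  apply/measurable_EFinP; apply: measurableT_comp => //; apply: measurable_funM => //; exact: measurable_funX.
under eq_integral do rewrite gee0_abs ?lee_fin ?expR_ge0//.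
rewrite (integral_law (f := fun x => (expR (x ^+ 2 / 4))%:E)); last 2 first.
- apply/measurable_EFinP; apply: measurableT_comp => //; apply: measurable_funM => //; exact: measurable_funX.
- by move=> x; rewrite lee_fin expR_ge0.
(* For r = sqrt 2 the exponent - (r^-2 - 1) x^2 / 2 equals x^2 / 4. *)
have s2 : 0 < Num.sqrt 2 :> R by rewrite sqrtr_gt0.
have := integral_normal_expR s2.
rewrite sqr_sqrtr// => e.
rewrite [X in (X < _)%E](_ : _ = (Num.sqrt 2)%:E) ?ltry// -e.
by apply: eq_integral => x _; congr (expR _)%:E; field.
Qed.

(** (x^2)^k = (4 k)^k (x^2 / (4 k))^k <= (4 k)^k exp (x^2 / 4) by t <= exp t, and this exponential
    is integrable. The case k = 0 is apart because of the division by k. *)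
Lemma Lall_gauss : Lall X.
Proof.
apply: (@Lall_dom _ _ _ _ _ (fun k w => 1 + (4 * k%:R) ^+ k * expR (X w ^+ 2 / 4))) => //.
- move=> k.
  have i1 := finite_measure_integrable_cst P (1 : R) measurableT.
  have i2 := integrableZl measurableT ((4 * k%:R) ^+ k) quarter_expR.
  exact: (integrableD measurableT i1 i2).
move=> k w; set x := X w.
have [->|k0] := posnP k.
  by rewrite !expr0 mul1r lerDl expR_ge0.
have k0' : 0 < k%:R :> R by rewrite ltr0n.
have h1 : `|x| ^+ k <= 1 + (x ^+ 2) ^+ k.
  have [x1|/ltW x1] := leP `|x| 1.
    by apply: (@le_trans _ _ 1); [exact: exprn_ile1|rewrite lerDl exprn_ge0// sqr_ge0].
  apply: (@le_trans _ _ ((x ^+ 2) ^+ k)); last by rewrite lerDr.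
  rewrite lerXn2r ?nnegrE ?sqr_ge0//.
  by rewrite -[leRHS]real_normK ?num_real// expr2 ler_peMr.
apply: le_trans h1 _; rewrite lerD2l.
have -> : x ^+ 2 = 4 * k%:R * (x ^+ 2 / 4 / k%:R) by field; rewrite gt_eqF.
rewrite exprMn ler_wpM2l ?exprn_ge0 ?mulr_ge0//.
have -> : 4 * k%:R * (x ^+ 2 / 4 / k%:R) / 4 = (x ^+ 2 / 4 / k%:R) * k%:R.
  by field; rewrite gt_eqF.
rewrite expRM_natr.
rewrite lerXn2r ?nnegrE ?expR_ge0 ?divr_ge0 ?sqr_ge0//.
by apply: le_trans (expR_ge1Dx _); rewrite lerDr.
Qed.

Lemma Ex_abs_gauss k : Ex (fun w => `|X w| ^+ k) = gmom k.
Proof.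
rewrite /Ex /gmom (integral_law (f := fun x => (`|x| ^+ k)%:E))//.
by apply/measurable_EFinP; apply: measurable_funX; exact: normr_measurable.
Qed.

End GaussianVariable.

(** * Mean and variance of a Gaussian variable; Cauchy-Schwarz for expectations *)

Section MeanVariance.
Context (R : realType) (d0 : measure_display) (Omega : measurableType d0).
Variable P : probability Omega R.
Local Notation gam := (@normal_prob R 0 1).
Local Notation Lall := (Lall P).
Local Notation Ex := (Ex P).
Variable X : Omega -> R.
Hypothesis mX : measurable_fun setT X.
Hypothesis lawX : forall B, measurable B -> P (X @^-1` B) = gam B.
Let LX : Lall X. Proof. exact: Lall_gauss. Qed.

Lemma Ex_gauss : Ex X = 0.
Proof.
have mX' : measurable_fun setT (X : Omega -> measurableTypeR R) by [].
have mNX : measurable_fun setT ((fun w => - X w) : Omega -> measurableTypeR R).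
  exact: measurable_funN.
have IX := Lall_integrable LX; have INX := Lall_integrable (LallN LX).
have mE : measurable_fun setT (EFin : measurableTypeR R -> \bar R) by [].
have e : (\int[P]_w (X w)%:E = \int[P]_w (- X w)%:E)%E.
  rewrite -(integral_pushforward mX' mE IX measurableT).
  rewrite -(integral_pushforward mNX mE INX measurableT).
  apply: eq_measure_integral => A mA _.
  transitivity (gam A); first exact: lawX.
  rewrite -normal_prob_sym//.
  have mNA : measurable (-%R @^-1` A : set R).
    by rewrite -[X in measurable X]setTI; exact: oppr_measurable.
  by rewrite -lawX.
have : Ex X = Ex (fun w => - X w) by rewrite /Ex e.
have -> : Ex (fun w => - X w) = - Ex X.
  by rewrite -mulN1r -ExZ//; congr (Ex _); apply/funext => w; rewrite mulN1r.
by lra.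
Qed.

Lemma Ex_gauss2 : Ex (fun w => X w ^+ 2) = 1.
Proof.
set v := Ex _.
have L2 : Lall (fun w => X w ^+ 2) by exact: LallX.
(* 1 + x <= exp x at x = - (r^-2 - 1) X^2 / 2, whose exponential has mean r;
   r -> 1 from both sides then forces v = 1. *)
have main (r : R) : 0 < r -> 1 - (r ^- 2 - 1) * v / 2 <= r.
  move=> r0.
  have -> : 1 - (r ^- 2 - 1) * v / 2 =
      Ex (fun w => 1 + (- (r ^- 2 - 1) / 2) * X w ^+ 2).
    rewrite ExD; last 2 first.
    - exact: Lall_cst.
    - by apply: LallM => //; exact: Lall_cst.
    by rewrite Ex_cst ExZ// -/v; field; rewrite gt_eqF.
  have LL : Lall (fun w => 1 + (- (r ^- 2 - 1) / 2) * X w ^+ 2).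
    by apply: LallD; [exact: Lall_cst|apply: LallM => //; exact: Lall_cst].
  have me : measurable_fun setT (fun x : R => expR (- (r ^- 2 - 1) * x ^+ 2 / 2)).
    apply: measurableT_comp => //; apply: measurable_funM => //.
    by apply: measurable_funM => //; exact: measurable_funX.
  have e : (\int[P]_w (expR (- (r ^- 2 - 1) * X w ^+ 2 / 2))%:E = r%:E)%E.
    rewrite -(integral_normal_expR r0).
    rewrite (integral_law mX lawX (f := fun x => (expR (- (r ^- 2 - 1) * x ^+ 2 / 2))%:E))//.
    exact/measurable_EFinP.
  rewrite -lee_fin -ExE// -e; apply: le_integral => //.
  - exact: Lall_integrable.
  - apply/integrableP; split.
      by apply/measurable_EFinP; exact: (measurableT_comp me mX).
    by under eq_integral do rewrite gee0_abs ?lee_fin ?expR_ge0//; rewrite e ltry.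
  - move=> w _; rewrite lee_fin; apply: le_trans (expR_ge1Dx _).
    by rewrite mulrAC.
have main2 (r : R) : 0 < r -> r ^+ 2 * (1 - r) <= (1 - r ^+ 2) * v / 2.
  move=> r0; have r2 : 0 < r ^+ 2 by rewrite exprn_gt0.
  have := ler_wpM2l (ltW r2) (main r r0).
  have -> : r ^+ 2 * (1 - (r ^- 2 - 1) * v / 2) = r ^+ 2 - (1 - r ^+ 2) * v / 2.
    by field; rewrite gt_eqF.
  by rewrite mulrBr mulr1; lra.
have v0 : 0 <= v by apply: Ex_ge0 => // w; exact: sqr_ge0.
apply/eqP; rewrite eq_le; apply/andP; split; rewrite leNgt; apply/negP => v1.
  (* At r = 1 + e, after division by e, [main2] reads (2 + e) v / 2 <= (1 + e)^2, which fails when v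
     >= 1 + 4 e. *)
  pose e := Num.min 1 ((v - 1) / 4).
  have e0 : 0 < e by rewrite lt_min ltr01; lra.
  have e1 : e <= 1 by rewrite ge_min lexx.
  have e2 : e <= (v - 1) / 4 by rewrite ge_min lexx orbT.
  have /main2 : 0 < 1 + e by lra.
  have -> : (1 - (1 + e) ^+ 2) * v / 2 = - e * ((2 + e) * v / 2) by ring.
  have -> : (1 + e) ^+ 2 * (1 - (1 + e)) = - e * (1 + e) ^+ 2 by ring.
  rewrite !mulNr lerN2 ler_pM2l//; nra.
(* At r = 1 - e it reads (1 - e)^2 <= (2 - e) v / 2, which fails for v = 1 - 3 e, where e <= 1/3
   since v >= 0. *)
pose e := (1 - v) / 3.
have e0 : 0 < e by rewrite /e; lra.
have e1 : v = 1 - 3 * e by rewrite /e; field.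
have /main2 : 0 < 1 - e by lra.
have -> : (1 - (1 - e) ^+ 2) * v / 2 = e * ((2 - e) * v / 2) by field.
have -> : (1 - e) ^+ 2 * (1 - (1 - e)) = e * (1 - e) ^+ 2 by ring.
by rewrite ler_pM2l// e1; nra.
Qed.

(** The quadratic polynomial t -> E (f + t g)^2 is nonnegative. If its leading coefficient vanishes
    it is affine, and a suitable t shows that the linear coefficient vanishes as well. *)
Lemma CS_Ex (f g : Omega -> R) : Lall f -> Lall g ->
  Ex (fun w => f w * g w) ^+ 2 <= Ex (fun w => f w ^+ 2) * Ex (fun w => g w ^+ 2).
Proof.
move=> Lf Lg; set A := Ex (fun w => f w ^+ 2); set C := Ex (fun w => g w ^+ 2).
set B := Ex _.
have Lf2 : Lall (fun w => f w ^+ 2) by exact: LallX.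
have Lg2 : Lall (fun w => g w ^+ 2) by exact: LallX.
have Lfg : Lall (fun w => f w * g w) by exact: LallM.
have h t : 0 <= A + (2 * t * B + t ^+ 2 * C).
  have := @Ex_ge0 _ _ _ P (fun w => (f w + t * g w) ^+ 2) _ (fun w => sqr_ge0 _).
  have LZ c F : Lall F -> Lall (fun w => c * F w).
    by move=> LF; apply: LallM => //; exact: Lall_cst.
  have -> : (fun w => (f w + t * g w) ^+ 2) =
     (fun w => f w ^+ 2 + (2 * t * (f w * g w) + t ^+ 2 * g w ^+ 2)).
    by apply/funext => w; ring.
  rewrite !ExD//; try by [exact: LZ | apply: LallD; exact: LZ].
  rewrite !ExZ//; apply; apply: LallD => //; apply: LallD; exact: LZ.
have C0 : 0 <= C by apply: Ex_ge0 => // w; exact: sqr_ge0.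
have A0 : 0 <= A by apply: Ex_ge0 => // w; exact: sqr_ge0.
have [C1|C1] := eqVneq C 0.
  rewrite C1 mulr0; rewrite C1 in h.
  have [->|B0] := eqVneq B 0; first by rewrite expr0n.
  have := h (- (A + 1) / (2 * B)).
  have -> : 2 * (- (A + 1) / (2 * B)) * B = - (A + 1) by field; rewrite B0.
  by rewrite mulr0; lra.
have Cp : 0 < C by rewrite lt_neqAle eq_sym C1.
have := h (- B / C).
have -> : A + (2 * (- B / C) * B + (- B / C) ^+ 2 * C) = (A * C - B ^+ 2) / C by field.
by rewrite pmulr_lge0 ?invr_gt0// subr_ge0.
Qed.

End MeanVariance.

(** * Fourth moments of linear and quadratic forms in Gaussian variables *)

Section FourthMoments.
Context (R : realType) (d0 : measure_display) (Omega : measurableType d0).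
Variable P : probability Omega R.
Local Notation Lall := (Lall P).
Local Notation Ex := (Ex P).

(** 192 = 24 * 8 is the largest coefficient in [fourth_moment1]; the summand 1 also gives kappa >=
    1, so that powers of kappa can be compared. *)
Definition kappa : R := 192 * (gmom R 4 + gmom R 8 + 1).

Lemma gmom_ge0 k : 0 <= gmom R k.
Proof. by rewrite fine_ge0// integral_ge0// => x _; rewrite lee_fin exprn_ge0. Qed.

Lemma kappa_ge1 : 1 <= kappa.
Proof. by rewrite /kappa; have := gmom_ge0 4; have := gmom_ge0 8; lra. Qed.

(** With S, L, b constant, the increment X L + b (X^2 - 1) has mean 0, so S^3 appears in no term of
    the bound: this is what makes the induction over the variables close. *)
Lemma fourth_moment1 (X : Omega -> R) (S L b : R) : measurable_fun setT X ->
  (forall B, measurable B -> P (X @^-1` B) = normal_prob 0 1 B) ->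
  Ex (fun w => (S + X w * L + b * (X w ^+ 2 - 1)) ^+ 4) <=
  S ^+ 4 + kappa * (S ^+ 2 * (L ^+ 2 + b ^+ 2) + (L ^+ 4 + b ^+ 4)).
Proof.
move=> mX lawX.
have LX : Lall X by exact: Lall_gauss.
have Lc c : Lall (fun=> c) by exact: Lall_cst.
have L2 : Lall (fun w => X w ^+ 2) by exact: LallX.
have L4 : Lall (fun w => X w ^+ 4) by exact: LallX.
have L8 : Lall (fun w => X w ^+ 8) by exact: LallX.
have LZ c F : Lall F -> Lall (fun w => c * F w) by move=> LF; exact: LallM.
have E4 : Ex (fun w => X w ^+ 4) = gmom R 4.
  rewrite -(Ex_abs_gauss mX lawX 4); congr (Ex _); apply/funext => w.
  by rewrite -normrX ger0_norm// exprn_even_ge0.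
have E8 : Ex (fun w => X w ^+ 8) = gmom R 8.
  rewrite -(Ex_abs_gauss mX lawX 8); congr (Ex _); apply/funext => w.
  by rewrite -normrX ger0_norm// exprn_even_ge0.
(* Coefficients of a polynomial in X that dominates the fourth power. The terms 4 S^3 b of [c0] and
   [c2] cancel in the mean since E X^2 = 1, and [c1] disappears since E X = 0. *)
pose c0 := S ^+ 4 - 4 * S ^+ 3 * b + 32 * S ^+ 2 * b ^+ 2 + 192 * b ^+ 4.
pose c1 := 4 * S ^+ 3 * L.
pose c2 := 4 * S ^+ 3 * b + 16 * S ^+ 2 * L ^+ 2.
pose c4 := 32 * S ^+ 2 * b ^+ 2 + 24 * L ^+ 4.
pose c8 := 192 * b ^+ 4.
pose T1 w := c4 * X w ^+ 4 + c8 * X w ^+ 8.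
pose T2 w := c1 * X w + (c2 * X w ^+ 2 + T1 w).
have LT1 : Lall T1 by apply: LallD; exact: LZ.
have LT2' : Lall (fun w => c2 * X w ^+ 2 + T1 w) by apply: LallD => //; exact: LZ.
have LT2 : Lall T2 by apply: LallD => //; exact: LZ.
apply: (@le_trans _ _ (Ex (fun w => c0 + T2 w))).
  apply: Ex_le.
  - by apply: LallX; do ?[apply: LallD|apply: LallM] => //; apply: LallN.
  - exact: LallD.
  move=> w; rewrite /T2 /T1 /c0 /c1 /c2 /c4 /c8; move: (X w) => x.
  have gen (e e1 e2 : R) : e = e1 + e2 ->
      (S + e) ^+ 4 <= S ^+ 4 + 4 * S ^+ 3 * e + 16 * S ^+ 2 * (e1 ^+ 2 + e2 ^+ 2)
         + 24 * (e1 ^+ 4 + e2 ^+ 4).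
    move=> ee.
    have h1 : (S + e) ^+ 4 <= S ^+ 4 + 4 * S ^+ 3 * e + 8 * S ^+ 2 * e ^+ 2 + 3 * e ^+ 4.
      suff : 0 <= 2 * e ^+ 2 * (S - e) ^+ 2 by lra.
      by rewrite mulr_ge0 ?sqr_ge0// mulr_ge0// sqr_ge0.
    have h2 : e ^+ 2 <= 2 * (e1 ^+ 2 + e2 ^+ 2) by rewrite ee; have := sqr_ge0 (e1 - e2); lra.
    have h3 : e ^+ 4 <= 8 * (e1 ^+ 4 + e2 ^+ 4).
      have := lerXn2r 2 (sqr_ge0 e) (mulr_ge0 (ler0n _ 2) (addr_ge0 (sqr_ge0 e1) (sqr_ge0 e2))) h2.
      have := sqr_ge0 (e1 ^+ 2 - e2 ^+ 2); rewrite -!exprM; lra.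
    have := ler_wpM2l (sqr_ge0 S) h2; lra.
  rewrite -addrA; apply: le_trans (gen _ _ _ erefl) _.
  have h2 : (b * (x ^+ 2 - 1)) ^+ 2 <= b ^+ 2 * (2 * x ^+ 4 + 2).
    by rewrite exprMn ler_wpM2l ?sqr_ge0//; have := sqr_ge0 (x ^+ 2 + 1); lra.
  have h4 : (b * (x ^+ 2 - 1)) ^+ 4 <= b ^+ 4 * (8 * x ^+ 8 + 8).
    rewrite exprMn ler_wpM2l ?exprn_even_ge0//.
    have k2 : (x ^+ 2 - 1) ^+ 2 <= 2 * x ^+ 4 + 2 by have := sqr_ge0 (x ^+ 2 + 1); lra.
    have q2 : 0 <= 2 * x ^+ 4 + 2 by have := exprn_even_ge0 x (n := 4) isT; lra.
    have := lerXn2r 2 (sqr_ge0 (x ^+ 2 - 1)) q2 k2.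
    have := sqr_ge0 (x ^+ 4 - 1); rewrite -!exprM; lra.
  have := ler_wpM2l (sqr_ge0 S) h2; rewrite !exprMn; lra.
have eT1 : Ex T1 = c4 * gmom R 4 + c8 * gmom R 8.
  by rewrite /T1 ExD ?(ExZ c4) ?(ExZ c8) ?E4 ?E8//; exact: LZ.
have eT2 : Ex T2 = c2 + Ex T1.
  rewrite /T2 ExD//; last exact: LZ.
  rewrite (ExZ c1)// (Ex_gauss mX lawX) mulr0 add0r ExD//; last exact: LZ.
  by rewrite (ExZ c2)// (Ex_gauss2 mX lawX) mulr1.
rewrite ExD// Ex_cst eT2 eT1 {eT1 eT2 LT1 LT2' LT2 T1 T2}.
rewrite /c0 /c2 /c4 /c8 /kappa.
have g4 := gmom_ge0 4; have g8 := gmom_ge0 8.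
have p1 : 0 <= S ^+ 2 * L ^+ 2 by rewrite mulr_ge0 ?sqr_ge0.
have p2 : 0 <= S ^+ 2 * b ^+ 2 by rewrite mulr_ge0 ?sqr_ge0.
have p3 : 0 <= L ^+ 4 by rewrite exprn_even_ge0.
have p4 : 0 <= b ^+ 4 by rewrite exprn_even_ge0.
have := mulr_ge0 p1 g4; have := mulr_ge0 p1 g8.
have := mulr_ge0 p2 g4; have := mulr_ge0 p2 g8.
have := mulr_ge0 p3 g4; have := mulr_ge0 p3 g8.
have := mulr_ge0 p4 g4; have := mulr_ge0 p4 g8.
by move: (gmom R 4) (gmom R 8) g4 g8 => m4 m8; lra.
Qed.

Section Step.
Variables (I : finType) (X : I -> Omega -> R).
Hypothesis gX : gfam P X.

Let LXi i : Lall (X i).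
Proof. by apply: Lall_gauss; [exact: gX.1|move=> B mB; exact: gfam_law]. Qed.

(** S and L depend on the block A and X k is independent of it: [fourth_moment1] is applied with S
    and L frozen, then averaged. *)
Lemma fourth_moment_step (A : {set I}) k (S L : Omega -> R) (b : R) :
  k \notin A -> Lall S -> Lall L ->
  measurable_fun setT (S : sub_sigma X A -> R) ->
  measurable_fun setT (L : sub_sigma X A -> R) ->
  Ex (fun w => (S w + X k w * L w + b * (X k w ^+ 2 - 1)) ^+ 4) <=
  Ex (fun w => S w ^+ 4) + kappa * (Ex (fun w => (S w * L w) ^+ 2) +
   b ^+ 2 * Ex (fun w => S w ^+ 2) + (Ex (fun w => L w ^+ 4) + b ^+ 4)).
Proof.
move=> kA LS LL mS mL.
have Lc c : Lall (fun=> c) by exact: Lall_cst.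
have LZ c F : Lall F -> Lall (fun w => c * F w) by move=> LF; exact: LallM.
pose q (x s l : R) := (s + x * l + b * (x ^+ 2 - 1)) ^+ 4.
pose f (u : sub_sigma X [set k]%SET * sub_sigma X A) := (q (X k u.1) (S u.2) (L u.2))%:E.
have disj i : i \in [set k]%SET -> i \notin A by move=> /set1P ->.
have mk : measurable_fun setT (X k : sub_sigma X [set k]%SET -> R).
  by apply: measurable_sub_sigma; rewrite inE.
have mf : measurable_fun setT f.
  have m1 : measurable_fun setT (fun u : sub_sigma X [set k]%SET * sub_sigma X A => X k u.1).
    exact: (measurableT_comp mk measurable_fst).
  have m2 : measurable_fun setT (fun u : sub_sigma X [set k]%SET * sub_sigma X A => S u.2).
    exact: (measurableT_comp mS measurable_snd).
  have m3 : measurable_fun setT (fun u : sub_sigma X [set k]%SET * sub_sigma X A => L u.2).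
    exact: (measurableT_comp mL measurable_snd).
  apply/measurable_EFinP; apply: measurable_funX; apply: measurable_funD.
    by apply: measurable_funD => //; apply: measurable_funM.
  apply: measurable_funM => //; apply: measurable_funB => //.
  exact: measurable_funX.
have f0 u : (0 <= f u)%E by rewrite lee_fin exprn_even_ge0.
pose T w := S w ^+ 4 + kappa * (((S w * L w) ^+ 2 + b ^+ 2 * S w ^+ 2) + (L w ^+ 4 + b ^+ 4)).
have L4 : Lall (fun w => L w ^+ 4) by exact: LallX.
have S4 : Lall (fun w => S w ^+ 4) by exact: LallX.
have S2 : Lall (fun w => S w ^+ 2) by exact: LallX.
have SL2 : Lall (fun w => (S w * L w) ^+ 2) by apply: LallX; exact: LallM.
have Lb : Lall (fun w => b ^+ 2 * S w ^+ 2) by exact: LZ.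
have La : Lall (fun w => (S w * L w) ^+ 2 + b ^+ 2 * S w ^+ 2) by exact: LallD.
have Ld : Lall (fun w => L w ^+ 4 + b ^+ 4) by exact: LallD.
have Le : Lall (fun w => ((S w * L w) ^+ 2 + b ^+ 2 * S w ^+ 2) + (L w ^+ 4 + b ^+ 4)) by exact: LallD.
have LT : Lall T by apply: LallD => //; exact: LZ.
have Lq : Lall (fun w => q (X k w) (S w) (L w)).
  apply: LallX; apply: LallD; first by apply: LallD => //; exact: LallM.
  by apply: LZ; apply: LallB => //; exact: LallX.
have : (\int[P]_w f (w, w) <= \int[P]_w (T w)%:E)%E.
  apply: (independent_le gX disj mf f0); first by apply/measurable_EFinP; exact: LT.1.
  move=> w.
    have Lqw : Lall (fun w1 => q (X k w1) (S w) (L w)).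
      apply: LallX; apply: LallD; first by apply: LallD => //; exact: LallM.
      by apply: LZ; apply: LallB => //; exact: LallX.
    rewrite /f /= ExE// lee_fin /q /T.
    apply: le_trans (fourth_moment1 _ _ _ (gX.1 k) (fun B mB => gfam_law _ gX mB)) _.
    by rewrite exprMn; lra.
rewrite /f /= !ExE// lee_fin => /le_trans; apply.
by rewrite /T ExD ?ExZ ?ExD ?ExZ ?ExD ?Ex_cst//; exact: LZ.
Qed.

Lemma Ex_sqr_le (S : Omega -> R) (M : R) : Lall S -> 0 <= M ->
  Ex (fun w => S w ^+ 4) <= M ^+ 2 -> Ex (fun w => S w ^+ 2) <= M.
Proof.
move=> LS M0 SM; have L2 : Lall (fun w => S w ^+ 2) by exact: LallX.
have Lc : Lall (fun=> 1) by exact: Lall_cst.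
have := CS_Ex L2 Lc.
have -> : (fun w => S w ^+ 2 * 1) = (fun w => S w ^+ 2) by apply/funext => w; rewrite mulr1.
have -> : (fun w => (S w ^+ 2) ^+ 2) = (fun w => S w ^+ 4).
  by apply/funext => w; rewrite -exprM.
have -> : (fun w : Omega => (1 : R) ^+ 2) = (fun=> 1) by apply/funext => w; rewrite expr1n.
rewrite Ex_cst mulr1 => /le_trans /(_ SM).
by rewrite ler_sqr ?nnegrE//; apply: Ex_ge0 => // w; exact: sqr_ge0.
Qed.

Definition lin (A : {set I}) (v : I -> R) (w : Omega) : R := \sum_(j in A) v j * X j w.

Definition quad (A : {set I}) (B : I -> I -> R) (w : Omega) : R :=
  \sum_(i in A) \sum_(j in A) B i j * (X i w * X j w) - \sum_(i in A) B i i.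

Lemma Lall_lin A v : Lall (lin A v).
Proof. by apply: Lall_sum => j; apply: LallM => //; exact: Lall_cst. Qed.

Lemma Lall_quad A B : Lall (quad A B).
Proof.
apply: LallB; last exact: Lall_cst.
apply: Lall_sum => i; apply: Lall_sum => j.
by apply: LallM; [exact: Lall_cst|exact: LallM].
Qed.

Let measurable_sum_in d (T : measurableType d) (A : {set I}) (F : I -> T -> R) :
  (forall i, i \in A -> measurable_fun setT (F i)) ->
  measurable_fun setT (fun w => \sum_(i in A) F i w).
Proof.
move=> mF; under eq_fun do rewrite big_mkcond.
apply: measurable_sum => i; case: (boolP (i \in A)) => [/mF//|_].
exact: measurable_cst.
Qed.

Lemma measurable_lin A v : measurable_fun setT (lin A v : sub_sigma X A -> R).
Proof.
by apply: measurable_sum_in => i iA; apply: measurable_funM => //; exact: measurable_sub_sigma.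
Qed.

Lemma measurable_quad A B : measurable_fun setT (quad A B : sub_sigma X A -> R).
Proof.
apply: measurable_funB => //; apply: measurable_sum_in => i iA.
apply: measurable_sum_in => j jA; apply: measurable_funM => //.
by apply: measurable_funM; exact: measurable_sub_sigma.
Qed.

Lemma set_insert_ind (Q : {set I} -> Prop) : Q (@finset.set0 I) ->
  (forall (A : {set I}) k, k \notin A -> Q A -> Q (k |: A)%SET) -> forall A, Q A.
Proof.
move=> Q0 QS A; have [n] := ubnP #|A|; elim: n A => // n IH A An.
have [->//|[k kA]] := set_0Vmem A.
rewrite -(finset.setD1K kA); apply: QS; first by rewrite !inE eqxx.
by apply: IH; rewrite (cardsD1 k A) kA in An.
Qed.

(** Inserting k is the step with L the constant v_k and b = 0. The form (kappa V)^2 propagates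
    because its increment in V contains both kappa^2 V v_k^2 and kappa v_k^4. *)
Lemma lin_fourth A v :
  Ex (fun w => lin A v w ^+ 4) <= (kappa * \sum_(j in A) v j ^+ 2) ^+ 2.
Proof.
have k1 := kappa_ge1; have k0 : 0 <= kappa by lra.
elim/set_insert_ind: A => [|A k kA IH].
  rewrite /lin; under eq_fun do rewrite big_set0 expr0n.
  by rewrite Ex_cst sqr_ge0.
rewrite big_setU1//=.
have Vg0 : 0 <= \sum_(j in A) v j ^+ 2 by apply: sumr_ge0 => j _; exact: sqr_ge0.
have := fourth_moment_step (S := lin A v) (L := fun=> v k) 0 kA (@Lall_lin A v)
  (Lall_cst P _) (@measurable_lin A v) (measurable_cst _).
rewrite /=.
have -> : (fun w => (lin A v w + X k w * v k + 0 * (X k w ^+ 2 - 1)) ^+ 4) =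
    (fun w => lin (k |: A)%SET v w ^+ 4).
  by apply/funext => w; rewrite /lin big_setU1//= mul0r addr0 addrC mulrC.
move=> /le_trans; apply.
have S2 := Ex_sqr_le (@Lall_lin A v) (mulr_ge0 k0 Vg0) IH.
have -> : Ex (fun w => (lin A v w * v k) ^+ 2) = v k ^+ 2 * Ex (fun w => lin A v w ^+ 2).
  rewrite -ExZ; last by apply: LallX; exact: Lall_lin.
  by congr (Ex _); apply/funext => w; rewrite exprMn mulrC.
rewrite Ex_cst expr0n /= mul0r addr0 expr0n addr0.
have := ler_wpM2l (sqr_ge0 (v k)) S2; set a := v k ^+ 2.
have a0 : 0 <= a by exact: sqr_ge0.
have -> : v k ^+ 4 = a ^+ 2 by rewrite -exprM.
move: IH Vg0; set V := \sum_(j in _) _; set e2 := Ex _; set e4 := Ex _ => IH Vg0 h.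
have := ler_wpM2l k0 h.
have : 0 <= kappa ^+ 2 * (a * V) by rewrite mulr_ge0 ?sqr_ge0// mulr_ge0.
have : kappa * a ^+ 2 <= kappa ^+ 2 * a ^+ 2 by rewrite ler_wpM2r ?sqr_ge0// expr2 ler_peMr.
by move: IH; move: (kappa) => K; clearbody a V e2 e4; lra.
Qed.

(** Inserting k adds X_k times the linear form with coefficients B_kj + B_jk, plus B_kk (X_k^2 - 1).
    The factor 2 absorbs (x + y)^2 <= 2 x^2 + 2 y^2 on these coefficients. The second factor kappa
    is due to the linear form, whose fourth moment already carries kappa^2. *)
Lemma quad_fourth A B :
  Ex (fun w => quad A B w ^+ 4) <=
  (kappa ^+ 2 * (2 * \sum_(i in A) \sum_(j in A) B i j ^+ 2)) ^+ 2.
Proof.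
have k1 := kappa_ge1; have k0 : 0 <= kappa by lra.
elim/set_insert_ind: A => [|A k kA IH].
  rewrite /quad; under eq_fun do rewrite !big_set0 subrr expr0n.
  by rewrite Ex_cst sqr_ge0.
pose v j := B k j + B j k.
have := fourth_moment_step (B k k) kA (@Lall_quad A B) (@Lall_lin A v)
  (@measurable_quad A B) (@measurable_lin A v).
have -> : (fun w => (quad A B w + X k w * lin A v w + B k k * (X k w ^+ 2 - 1)) ^+ 4) =
    (fun w => quad (k |: A)%SET B w ^+ 4).
  apply/funext => w; congr (_ ^+ _); rewrite /quad !big_setU1//=.
  rewrite [X in _ = _ + X - _](eq_bigr (fun i => B i k * (X i w * X k w) +
    \sum_(j in A) B i j * (X i w * X j w))); last by move=> i _; rewrite big_setU1.
  rewrite big_split /= /lin mulr_sumr.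
  have -> : \sum_(i in A) X k w * (v i * X i w) =
    \sum_(i in A) B k i * (X k w * X i w) + \sum_(i in A) B i k * (X i w * X k w).
    by rewrite -big_split; apply: eq_bigr => i _; rewrite /v /=; ring.
  by ring.
move=> /le_trans; apply.
set U := \sum_(i in A) _ in IH; set U' := \sum_(i in _) _.
have U0 : 0 <= U by do 2 (apply: sumr_ge0 => ? _); exact: sqr_ge0.
set l := \sum_(j in A) v j ^+ 2.
have l0 : 0 <= l by apply: sumr_ge0 => ? _; exact: sqr_ge0.
have UU : 2 * U + (l + B k k ^+ 2) <= 2 * U'.
  rewrite /U' big_setU1//= big_setU1//=.
  rewrite [X in _ <= 2 * (_ + X)](eq_bigr (fun i => B i k ^+ 2 + \sum_(j in A) B i j ^+ 2));
    last by move=> i _; rewrite big_setU1.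
  rewrite big_split /= -/U.
  have : l <= 2 * (\sum_(i in A) B k i ^+ 2 + \sum_(i in A) B i k ^+ 2).
    rewrite -big_split mulr_sumr; apply: ler_sum => j _ /=; rewrite /v.
    by have := sqr_ge0 (B k j - B j k); lra.
  by have := sqr_ge0 (B k k); lra.
have M0 : 0 <= kappa ^+ 2 * (2 * U) by rewrite mulr_ge0 ?sqr_ge0// mulr_ge0.
have S2 := Ex_sqr_le (@Lall_quad A B) M0 IH.
have L4 := lin_fourth A v; rewrite -/l in L4.
have SL : Ex (fun w => (quad A B w * lin A v w) ^+ 2) <= kappa ^+ 2 * (2 * U) * (kappa * l).
  have LQ2 : Lall (fun w => quad A B w ^+ 2) by apply: LallX; exact: Lall_quad.
  have LL2 : Lall (fun w => lin A v w ^+ 2) by apply: LallX; exact: Lall_lin.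
  have := CS_Ex LQ2 LL2.
  have -> : (fun w => (quad A B w * lin A v w) ^+ 2) = (fun w => quad A B w ^+ 2 * lin A v w ^+ 2).
    by apply/funext => w; rewrite exprMn.
  have -> : (fun w => (quad A B w ^+ 2) ^+ 2) = (fun w => quad A B w ^+ 4).
    by apply/funext => w; rewrite -exprM.
  have -> : (fun w => (lin A v w ^+ 2) ^+ 2) = (fun w => lin A v w ^+ 4).
    by apply/funext => w; rewrite -exprM.
  move=> h; rewrite -ler_sqr ?nnegrE; last 2 first.
  - by apply: Ex_ge0; [exact: LallM|move=> w; rewrite mulr_ge0 ?sqr_ge0].
  - by rewrite mulr_ge0// mulr_ge0.
  apply: le_trans h _; rewrite [leRHS]exprMn; apply: ler_pM => //.
    by apply: Ex_ge0; [apply: LallX; exact: Lall_quad|move=> w; rewrite exprn_even_ge0].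
  by apply: Ex_ge0; [apply: LallX; exact: Lall_lin|move=> w; rewrite exprn_even_ge0].
set b := B k k ^+ 2 in UU *.
have b0 : 0 <= b by exact: sqr_ge0.
have -> : B k k ^+ 4 = b ^+ 2 by rewrite -exprM.
have bS := ler_wpM2l b0 S2.
apply: (@le_trans _ _ ((kappa ^+ 2 * (2 * U + (l + b))) ^+ 2)); last first.
  have p0 : 0 <= kappa ^+ 2 * (2 * U + (l + b)).
    by rewrite mulr_ge0 ?sqr_ge0// !addr_ge0// mulr_ge0.
  have pU : kappa ^+ 2 * (2 * U + (l + b)) <= kappa ^+ 2 * (2 * U').
    by rewrite ler_wpM2l ?sqr_ge0.
  by rewrite lerXn2r// nnegrE//; exact: le_trans pU.
move: SL bS L4 IH; set e1 := Ex _; set e2 := Ex _; set e3 := Ex _; set e4 := Ex _.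
move=> SL bS L4 IH.
have h1 : kappa * (e1 + b * e2 + (e3 + b ^+ 2)) <=
   kappa * (kappa ^+ 2 * (2 * U) * (kappa * l) + b * (kappa ^+ 2 * (2 * U)) + ((kappa * l) ^+ 2 + b ^+ 2)).
  by rewrite ler_wpM2l// !lerD.
apply: le_trans (lerD IH h1) _.
have k2 : kappa <= kappa ^+ 4 by rewrite -[leLHS]expr1 ler_weXn2l.
have k3 : kappa ^+ 3 <= kappa ^+ 4 by rewrite ler_weXn2l.
have ub : 0 <= U * b by exact: mulr_ge0.
have ul : 0 <= U * l by exact: mulr_ge0.
have lb : 0 <= l * b by exact: mulr_ge0.
have ll : 0 <= l ^+ 2 by exact: sqr_ge0.
have bb : 0 <= b ^+ 2 by exact: sqr_ge0.
have k4 : 0 <= kappa ^+ 4 by exact: exprn_ge0.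
have := ler_wpM2r ub k3; have := ler_wpM2r ll k3; have := ler_wpM2r bb k2.
have := mulr_ge0 k4 ub; have := mulr_ge0 k4 ul; have := mulr_ge0 k4 lb.
by move: (kappa) => K; clearbody U l b; lra.
Qed.

End Step.
End FourthMoments.

(** * Measurability of complex and matrix-valued maps, by real and imaginary parts *)

Section ComplexMeasurability.
Context (R : realType) (d : measure_display) (T : measurableType d).
Local Notation C := R[i].

Definition mC (f : T -> C) := measurable_fun setT (fun t => complex.Re (f t)) /\
  measurable_fun setT (fun t => complex.Im (f t)).

Lemma mC_cst c : mC (fun=> c).
Proof. by split; exact: measurable_cst. Qed.

Lemma mC_toC (f : T -> R) : measurable_fun setT f -> mC (fun t => toC (f t)).
Proof. by move=> mf; split => //=; exact: measurable_cst. Qed.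

Lemma mCD f g : mC f -> mC g -> mC (fun t => f t + g t).
Proof.
move=> [f1 f2] [g1 g2]; split.
  under eq_fun do rewrite raddfD; exact: measurable_funD.
under eq_fun do rewrite raddfD; exact: measurable_funD.
Qed.

Lemma mCN f : mC f -> mC (fun t => - f t).
Proof.
move=> [f1 f2]; split.
  under eq_fun do rewrite raddfN; exact: measurable_funN.
under eq_fun do rewrite raddfN; exact: measurable_funN.
Qed.

Lemma mCB f g : mC f -> mC g -> mC (fun t => f t - g t).
Proof. by move=> mf mg; apply: mCD => //; exact: mCN. Qed.

Lemma mCM f g : mC f -> mC g -> mC (fun t => f t * g t).
Proof.
move=> [f1 f2] [g1 g2].
have ReM (a b : C) : complex.Re (a * b) =
    complex.Re a * complex.Re b - complex.Im a * complex.Im b by case: a; case: b.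
have ImM (a b : C) : complex.Im (a * b) =
    complex.Re a * complex.Im b + complex.Im a * complex.Re b by case: a; case: b.
split.
  under eq_fun do rewrite ReM; apply: measurable_funB; exact: measurable_funM.
under eq_fun do rewrite ImM; apply: measurable_funD; exact: measurable_funM.
Qed.

Lemma measurable_nq f : mC f -> measurable_fun setT (fun t => nq (f t)).
Proof. by move=> [f1 f2]; apply: measurable_funD; exact: measurable_funX. Qed.

Lemma mCV f : mC f -> mC (fun t => (f t)^-1).
Proof.
move=> mf; have mnq := measurable_nq mf; have [f1 f2] := mf.
have minv : measurable_fun setT (fun t => (nq (f t))^-1).
  under eq_fun do rewrite -powR_inv1 ?nq_ge0//.
  exact: (measurableT_comp (measurable_powR (- 1)) mnq).
have ReV (a : C) : complex.Re a^-1 = complex.Re a * (nq a)^-1 by case: a.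
have ImV (a : C) : complex.Im a^-1 = - complex.Im a * (nq a)^-1 by case: a => x y; rewrite /nq /= mulNr.
split.
  under eq_fun do rewrite ReV; exact: measurable_funM.
by under eq_fun do rewrite ImV; apply: measurable_funM => //; exact: measurable_funN.
Qed.

Lemma mC_sum (I : Type) (r : seq I) (Q : pred I) (F : I -> T -> C) :
  (forall i, mC (F i)) -> mC (fun t => \sum_(i <- r | Q i) F i t).
Proof.
move=> mF; elim: r => [|i r IH].
  by under eq_fun do rewrite big_nil; exact: mC_cst.
under eq_fun do rewrite big_cons; case: (Q i) => //; exact: mCD.
Qed.

Lemma mC_prod (I : Type) (r : seq I) (Q : pred I) (F : I -> T -> C) :
  (forall i, mC (F i)) -> mC (fun t => \prod_(i <- r | Q i) F i t).
Proof.
move=> mF; elim: r => [|i r IH].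
  by under eq_fun do rewrite big_nil; exact: mC_cst.
under eq_fun do rewrite big_cons; case: (Q i) => //; exact: mCM.
Qed.

Definition mMx m n (F : T -> 'M[C]_(m, n)) := forall i j, mC (fun t => F t i j).

Lemma mMx_cst m n (A : 'M[C]_(m, n)) : mMx (fun=> A).
Proof. by move=> i j; exact: mC_cst. Qed.

Lemma mMxD m n (F G : T -> 'M[C]_(m, n)) : mMx F -> mMx G -> mMx (fun t => F t + G t).
Proof. by move=> mF mG i j; under eq_fun do rewrite mxE; exact: mCD. Qed.

Lemma mMxB m n (F G : T -> 'M[C]_(m, n)) : mMx F -> mMx G -> mMx (fun t => F t - G t).
Proof. by move=> mF mG i j; under eq_fun do rewrite !mxE; exact: mCB. Qed.

Lemma mMxZ m n (c : T -> C) (F : T -> 'M[C]_(m, n)) :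
  mC c -> mMx F -> mMx (fun t => c t *: F t).
Proof. by move=> mc mF i j; under eq_fun do rewrite mxE; exact: mCM. Qed.

Lemma mMxM m n p (F : T -> 'M[C]_(m, n)) (G : T -> 'M[C]_(n, p)) :
  mMx F -> mMx G -> mMx (fun t => F t *m G t).
Proof.
move=> mF mG i j; under eq_fun do rewrite mxE; apply: mC_sum => k; exact: mCM.
Qed.

Lemma mMxT m n (F : T -> 'M[C]_(m, n)) : mMx F -> mMx (fun t => (F t)^T).
Proof. by move=> mF i j; under eq_fun do rewrite mxE; exact: mF. Qed.

Lemma mC_tr n (F : T -> 'M[C]_n) : mMx F -> mC (fun t => \tr (F t)).
Proof. by move=> mF; apply: mC_sum => i; exact: mF. Qed.

Lemma mC_det n (F : T -> 'M[C]_n) : mMx F -> mC (fun t => \det (F t)).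
Proof.
move=> mF; apply: mC_sum => s; apply: mCM; first exact: mC_cst.
by apply: mC_prod => i; exact: mF.
Qed.

(** Cramer's rule: the entries of the inverse are cofactors divided by the determinant. *)
Lemma mMx_inv n (F : T -> 'M[C]_n) : (forall t, F t \in unitmx) -> mMx F ->
  mMx (fun t => invmx (F t)).
Proof.
move=> uF mF i j; under eq_fun do rewrite /invmx uF mxE.
apply: mCM; first by apply: mCV; exact: mC_det.
under eq_fun do rewrite mxE; apply: mCM; first exact: mC_cst.
by apply: mC_det => k l; under eq_fun do rewrite !mxE; exact: mF.
Qed.

Lemma mMx_Cmx m n (F : T -> 'M[R]_(m, n)) :
  (forall i j, measurable_fun setT (fun t => F t i j)) -> mMx (fun t => Cmx (F t)).
Proof. by move=> mF i j; under eq_fun do rewrite mxE; apply: mC_toC; exact: mF. Qed.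

Lemma mMx_noiseQ n p s (z : C) (F : T -> 'M[R]_(n, p)) : complex.Im z != 0 ->
  (forall i j, measurable_fun setT (fun t => F t i j)) ->
  mMx (fun t => noiseQ s z (F t)).
Proof.
move=> z0 mF; apply: mMx_inv => [t|].
  by apply: resolvent_unit => //; exact: gramc_sym.
apply: mMxB; last exact: mMx_cst.
under eq_fun do rewrite /gramc CmxZ CmxD CmxM -CmxT.
apply: mMxZ; first exact: mC_cst.
apply: mMxD; last exact: mMx_cst.
by apply: mMxM; [|apply: mMxT]; exact: mMx_Cmx.
Qed.

Lemma mC_stieltjes n (F : T -> 'M[C]_n) : mMx F -> mC (fun t => stieltjes (F t)).
Proof. by move=> mF; apply: mCM; [exact: mC_cst|exact: mC_tr]. Qed.

Lemma mC_xstar n (z : C) (F : T -> 'M[C]_n) : mMx F -> mC (fun t => xstar z (F t)).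
Proof.
move=> mF; apply: mCN; apply: mCV; apply: mCD; first exact: mC_cst.
exact: mC_stieltjes.
Qed.

End ComplexMeasurability.

(** * Fourth moment of the error on a diagonal entry *)

Section RowMoment.
Context (R : realType) (d0 : measure_display) (Omega : measurableType d0).
Variable P : probability Omega R.
Local Notation C := R[i].

Definition Wmx n p (X : 'I_n * 'I_p -> Omega -> R) (w : Omega) : 'M[R]_(n, p) :=
  \matrix_(i, j) X (i, j) w.

Lemma quadcE p (M : 'M[C]_p) (w : 'M[R]_(1, p)) :
  quadc M w = \sum_i \sum_j M i j * toC (w 0 i * w 0 j) - \sum_i M i i.
Proof.
rewrite /quadc; congr (_ - _); rewrite mxE exchange_big; apply: eq_bigr => j _ /=.
rewrite !mxE mulr_suml; apply: eq_bigr => i _; rewrite !mxE toCM; ring.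
Qed.

Lemma Re_quadc p (M : 'M[C]_p) (w : 'M[R]_(1, p)) :
  complex.Re (quadc M w) =
  \sum_i \sum_j complex.Re (M i j) * (w 0 i * w 0 j) - \sum_i complex.Re (M i i).
Proof.
rewrite quadcE raddfB !raddf_sum /=; congr (_ + _); apply: eq_bigr => i _.
rewrite raddf_sum; apply: eq_bigr => j _; case: (M i j) => x y /=; ring.
Qed.

Lemma Im_quadc p (M : 'M[C]_p) (w : 'M[R]_(1, p)) :
  complex.Im (quadc M w) =
  \sum_i \sum_j complex.Im (M i j) * (w 0 i * w 0 j) - \sum_i complex.Im (M i i).
Proof.
rewrite quadcE raddfB !raddf_sum /=; congr (_ + _); apply: eq_bigr => i _.
rewrite raddf_sum; apply: eq_bigr => j _; case: (M i j) => x y /=; ring.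
Qed.

(** Real and imaginary parts are real quadratic forms, to which [quad_fourth] applies. The constant
    is 16 = 2 * (4 + 4): the factor 2 comes from (x + y)^2 <= 2 x^2 + 2 y^2, each 4 from
    [quad_fourth]. *)
Lemma quadc_fourth p (Y : 'I_p -> Omega -> R) (M : 'M[C]_p) : gfam P Y ->
  let q w := quadc M (\row_j Y j w) in
  Lall P (fun w => nq (q w) ^+ 2) /\
  Ex P (fun w => nq (q w) ^+ 2) <= 16 * kappa R ^+ 4 * fro2 M ^+ 2.
Proof.
move=> gY q.
pose Q1 := quad Y [set: 'I_p] (fun i j => complex.Re (M i j)).
pose Q2 := quad Y [set: 'I_p] (fun i j => complex.Im (M i j)).
have e1 w : complex.Re (q w) = Q1 w.
  rewrite Re_quadc /Q1 /quad.
  congr (_ - _); last by apply: eq_bigl => i; rewrite inE.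
  apply: eq_big => [i|i _]; first by rewrite inE.
  by apply: eq_big => [j|j _]; rewrite ?inE// !mxE.
have e2 w : complex.Im (q w) = Q2 w.
  rewrite Im_quadc /Q2 /quad.
  congr (_ - _); last by apply: eq_bigl => i; rewrite inE.
  apply: eq_big => [i|i _]; first by rewrite inE.
  by apply: eq_big => [j|j _]; rewrite ?inE// !mxE.
have L1 : Lall P Q1 by exact: Lall_quad.
have L2 : Lall P Q2 by exact: Lall_quad.
have eq w : nq (q w) ^+ 2 = (Q1 w ^+ 2 + Q2 w ^+ 2) ^+ 2 by rewrite /nq e1 e2.
have L12 : Lall P (fun w => nq (q w) ^+ 2).
  by under eq_fun do rewrite eq; apply: LallX; apply: LallD; exact: LallX.
split => //.
have L14 : Lall P (fun w => Q1 w ^+ 4) by exact: LallX.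
have L24 : Lall P (fun w => Q2 w ^+ 4) by exact: LallX.
have LZ c F : Lall P F -> Lall P (fun w => c * F w).
  by move=> LF; apply: LallM => //; exact: Lall_cst.
apply: (@le_trans _ _ (Ex P (fun w => 2 * Q1 w ^+ 4 + 2 * Q2 w ^+ 4))).
  apply: Ex_le => //; first by apply: LallD; exact: LZ.
  move=> w; rewrite eq; have := sqr_ge0 (Q1 w ^+ 2 - Q2 w ^+ 2); lra.
rewrite ExD ?(ExZ 2)//; try exact: LZ.
have h1 := quad_fourth gY [set: 'I_p]%SET (fun i j => complex.Re (M i j)).
have h2 := quad_fourth gY [set: 'I_p]%SET (fun i j => complex.Im (M i j)).
have F (g : C -> R) : (forall x, g x ^+ 2 <= nq x) ->
   0 <= \sum_(i in [set: 'I_p]%SET) \sum_(j in [set: 'I_p]%SET) g (M i j) ^+ 2 <= fro2 M.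
  move=> gn; apply/andP; split.
    by do 2 (apply: sumr_ge0 => ? _); exact: sqr_ge0.
  have -> : \sum_(i in [set: 'I_p]%SET) \sum_(j in [set: 'I_p]%SET) g (M i j) ^+ 2 =
      \sum_i \sum_j g (M i j) ^+ 2.
    apply: eq_big => [i|i _]; first by rewrite inE.
    by apply: eq_bigl => j; rewrite inE.
  by do 2 (apply: ler_sum => ? _); exact: gn.
have /andP[r0 r1] := F _ (@Re2_le_nq R); have /andP[i0 i1] := F _ (@Im2_le_nq R).
have k0 : 0 <= kappa R ^+ 2 by exact: sqr_ge0.
have bnd (S : R) : 0 <= S -> S <= fro2 M ->
    (kappa R ^+ 2 * (2 * S)) ^+ 2 <= 4 * kappa R ^+ 4 * fro2 M ^+ 2.
  move=> S0 SM; have -> : 4 * kappa R ^+ 4 * fro2 M ^+ 2 = (kappa R ^+ 2 * (2 * fro2 M)) ^+ 2.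
    by ring.
  apply: lerXn2r; rewrite ?nnegrE.
  - by rewrite mulr_ge0// mulr_ge0.
  - by rewrite mulr_ge0// mulr_ge0// fro2_ge0.
  - by rewrite ler_wpM2l// ler_wpM2l.
have := le_trans h1 (bnd _ r0 r1); have := le_trans h2 (bnd _ i0 i1).
rewrite -/Q1 -/Q2; lra.
Qed.

(** The square of [row_bound], using (2 q + c)^2 <= 8 q^2 + 2 c^2; 128 is 8 times the 16 of
    [quadc_fourth]. *)
Definition cst3 (K : R) (z : C) : R :=
  (128 * kappa R ^+ 4 * cst1 K z ^+ 2 + 2 * cst2 K z ^+ 2) / (complex.Im z ^+ 2) ^+ 4.

Lemma row_moment n p (X : 'I_(1 + n) * 'I_p -> Omega -> R) (s K : R) (z : C) :
  complex.Im z != 0 -> gfam P X ->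
  s ^+ 2 * (n.+1%:R * p%:R) = 1 -> n.+1%:R ^+ 2 <= K * p%:R ->
  (\int[P]_w (nq (noiseQ s z (Wmx X w) 0 0 - xstar z (noiseQ s z (Wmx X w))) ^+ 2)%:E <=
   (cst3 K z / n.+1%:R ^+ 2)%:E)%E.
Proof.
move=> z0 gX hs hK; set N : R := n.+1%:R.
pose y2 := complex.Im z ^+ 2.
have y2p : 0 < y2 by rewrite exprn_even_gt0.
have y8p : 0 < y2 ^+ 4 by exact: exprn_gt0.
pose o : 'I_(1 + n) := lshift n ord0.
pose A := [set u : 'I_(1 + n) * 'I_p | u.1 == o]%SET.
pose B := (~: A)%SET.
have AB i : i \in A -> i \notin B by rewrite !inE negbK.
pose wr (w : Omega) : 'M[R]_(1, p) := \row_j X (o, j) w.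
pose V (w : Omega) : 'M[R]_(n, p) := \matrix_(i, j) X (rshift 1 i, j) w.
have WE w : Wmx X w = col_mx (wr w) (V w).
  apply/matrixP => i j; rewrite mxE; case: (split_ordP i) => k ->.
    by rewrite col_mxEu mxE (ord1 k).
  by rewrite col_mxEd mxE.
have mwr j : measurable_fun setT (fun w : sub_sigma X A => wr w 0 j).
  by under eq_fun do rewrite mxE; apply: measurable_sub_sigma; rewrite inE.
have mV i j : measurable_fun setT (fun w : sub_sigma X B => V w i j).
  under eq_fun do rewrite mxE; apply: measurable_sub_sigma; rewrite !inE -val_eqE //.
have mrB : mMx (fun w : sub_sigma X B => rowB s z (V w)).
  apply: mMxB; last exact: mMx_cst.
  apply: mMxZ; first exact: mC_cst.
  have mCV' := mMx_Cmx mV.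
  by apply: mMxM => //; apply: mMxM; [exact: mMxT|exact: mMx_noiseQ].
pose g (t : R) : R := (8 * t ^+ 2 + 2 * (cst2 K z / N) ^+ 2) / y2 ^+ 4.
pose f (u : sub_sigma X A * sub_sigma X B) : \bar R :=
  (g (nq (quadc (rowB s z (V u.2)) (wr u.1))))%:E.
have mf : measurable_fun setT f.
  apply/measurable_EFinP; apply: measurable_funM => //; apply: measurable_funD => //.
  apply: measurable_funM => //; apply: measurable_funX; apply: measurable_nq.
  have m1 : mMx (fun u : sub_sigma X A * sub_sigma X B => rowB s z (V u.2)).
    move=> i j; have [r1 r2] := mrB i j.
    by split; [exact: (measurableT_comp r1 measurable_snd)|exact: (measurableT_comp r2 measurable_snd)].
  have m2 : mMx (fun u : sub_sigma X A * sub_sigma X B => Cmx (wr u.1)).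
    apply: mMx_Cmx => i j; rewrite (ord1 i).
    exact: (measurableT_comp (mwr j) measurable_fst).
  apply: mCB; last exact: mC_tr.
  have := mMxM (mMxM m2 m1) (mMxT m2); apply.
have g0 t : 0 <= g t.
  apply: divr_ge0; last by rewrite exprn_ge0// ltW.
  by rewrite addr_ge0// mulr_ge0// sqr_ge0.
have f0 u : (0 <= f u)%E by rewrite lee_fin.
apply: (@le_trans _ _ (\int[P]_w f (w, w))%E).
  apply: ge0_le_integral; [exact: measurableT| | | |].
  - by move=> w _; rewrite lee_fin sqr_ge0.
  - apply/measurable_EFinP; apply: measurable_funX; apply: measurable_nq.
    have mQ : mMx (fun w => noiseQ s z (Wmx X w)).
      by apply: mMx_noiseQ => // i j; under eq_fun do rewrite mxE; exact: gX.1.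
    by apply: mCB; [exact: mQ|exact: mC_xstar].
  - have mA := @measurable_id_sub_sigma _ _ _ P _ _ gX A.
    have mB := @measurable_id_sub_sigma _ _ _ P _ _ gX B.
    exact: (measurableT_comp mf (measurable_fun_pair mA mB)).
  move=> w _; rewrite lee_fin WE.
  have := row_bound (wr w) (V w) z0 hs hK.
  rewrite -/N -/y2; set a := nq _; set q := nq _ => h.
  have a0 : 0 <= a by exact: nq_ge0.
  have q0 : 0 <= q by exact: nq_ge0.
  rewrite /g /f /=; set c := cst2 K z / N in h *.
  have h2 : a ^+ 2 <= ((2 * q + c) / y2 ^+ 2) ^+ 2.
    by rewrite lerXn2r ?nnegrE//; apply: le_trans h.
  apply: le_trans h2 _; rewrite expr_div_n -exprM ler_pM2r ?invr_gt0//.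
  by have := sqr_ge0 (2 * q - c); lra.
have fin : measurable_fun setT (cst (cst3 K z / N ^+ 2)%:E : Omega -> \bar R) by [].
apply: le_trans (independent_le gX AB mf f0 fin _) _; last first.
  by rewrite integral_cst//= probability_setT mule1.
move=> w2; rewrite /f /=.
have gY : gfam P (fun j => X (o, j)).
  by apply: (gfam_inj (f := fun j => (o, j))) => // j j' [].
have [LY EY] := quadc_fourth (rowB s z (V w2)) gY.
have Lg : Lall P (fun w => g (nq (quadc (rowB s z (V w2)) (wr w)))).
  apply: LallM; last exact: Lall_cst.
  apply: LallD; last exact: Lall_cst.
  by apply: LallM => //; exact: Lall_cst.
rewrite ExE// lee_fin.
pose i8 := y2 ^- 4.
have -> : (fun w => g (nq (quadc (rowB s z (V w2)) (wr w)))) =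
   (fun w => 2 * (cst2 K z / N) ^+ 2 * i8 + 8 * i8 * nq (quadc (rowB s z (V w2)) (wr w)) ^+ 2).
  by apply/funext => w; rewrite /g /i8; ring.
rewrite ExD; last 2 first.
- exact: Lall_cst.
- by apply: LallM => //; exact: Lall_cst.
rewrite Ex_cst ExZ//.
have i80 : 0 <= i8 by rewrite invr_ge0 exprn_ge0// ltW.
have fB : fro2 (rowB s z (V w2)) <= cst1 K z / N by exact: (fro2_rowB _ z0 hs hK).
have fB2 : fro2 (rowB s z (V w2)) ^+ 2 <= (cst1 K z / N) ^+ 2.
  by apply: lerXn2r; rewrite ?nnegrE ?fro2_ge0//; apply: le_trans fB; exact: fro2_ge0.
have k4 : 0 <= 16 * kappa R ^+ 4 by rewrite mulr_ge0// exprn_even_ge0.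
have h := le_trans EY (ler_wpM2l k4 fB2).
have h8 : 0 <= 8 * i8 by rewrite mulr_ge0.
apply: le_trans (lerD (lexx _) (ler_wpM2l h8 h)) _.
rewrite /cst3 -/y2 -/i8 !expr_div_n.
by rewrite le_eqVlt; apply/orP; left; apply/eqP; rewrite /i8; ring.
Qed.

End RowMoment.

(** * Invariance of Gaussian matrices under orthogonal matrices *)

Section OrthogonalInvariance.
Context (R : realType) (d0 : measure_display) (Omega : measurableType d0).
Variable P : probability Omega R.

Definition rotX n p (O : 'M[R]_n) (X : 'I_n * 'I_p -> Omega -> R) : 'I_n * 'I_p -> Omega -> R :=
  fun u w => \sum_k O u.1 k * X (k, u.2) w.

Lemma Wmx_rotX n p (O : 'M[R]_n) (X : 'I_n * 'I_p -> Omega -> R) w :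
  Wmx (rotX O X) w = O *m Wmx X w.
Proof.
by apply/matrixP => i j; rewrite !mxE; apply: eq_bigr => k _; rewrite mxE.
Qed.

(* Closed under products and containing the Givens rotations, which suffices
   to move any unit vector to a basis vector. *)
Definition preserves_gaussian n (O : 'M[R]_n) : Prop :=
  O *m O^T = 1%:M /\
  forall p (X : 'I_n * 'I_p -> Omega -> R), gfam P X -> gfam P (rotX O X).

Lemma preserves_gaussian1 n : preserves_gaussian (1%:M : 'M[R]_n).
Proof.
split=> [|p X gX]; first by rewrite trmx1 mulmx1.
suff -> : rotX 1%:M X = X by [].
apply/funext => -[i j]; apply/funext => w; rewrite /rotX /= (bigD1 i)//= mxE eqxx mul1r.
by rewrite big1 ?addr0// => k ki; rewrite mxE eq_sym (negbTE ki) mul0r.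
Qed.

Lemma preserves_gaussianM n (O1 O2 : 'M[R]_n) : preserves_gaussian O1 ->
  preserves_gaussian O2 -> preserves_gaussian (O1 *m O2).
Proof.
move=> [h1 g1] [h2 g2]; split=> [|p X gX].
  by rewrite trmx_mul mulmxA -(mulmxA O1) h2 mulmx1.
suff -> : rotX (O1 *m O2) X = rotX O1 (rotX O2 X) by apply: g1; exact: g2.
apply/funext => -[i j]; apply/funext => w; rewrite /rotX /=.
under eq_bigr do rewrite mxE mulr_suml.
rewrite exchange_big; apply: eq_bigr => k _ /=; rewrite mulr_sumr.
by apply: eq_bigr => l _; rewrite mulrA.
Qed.

Section Givens.
Variables (n : nat) (i0 i1 : 'I_n) (c s : R).
Hypothesis i01 : i0 != i1.
Hypothesis s0 : s != 0.
Hypothesis cs : c ^+ 2 + s ^+ 2 = 1.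

Definition givens : 'M[R]_n := \matrix_(i, j)
  if i == i0 then (if j == i0 then c else if j == i1 then - s else 0)
  else if i == i1 then (if j == i0 then s else if j == i1 then c else 0)
  else (i == j)%:R.

Lemma givens_sum i (F : 'I_n -> R) : \sum_k givens i k * F k =
  if i == i0 then c * F i0 - s * F i1 else if i == i1 then s * F i0 + c * F i1 else F i.
Proof.
have i10 : (i1 == i0) = false by rewrite eq_sym (negbTE i01).
rewrite (bigD1 i0)//= (bigD1 i1) /=; last by rewrite i10.
rewrite !mxE !eqxx i10.
case: (eqVneq i i0) => [->|ii0].
  rewrite big1 ?addr0 ?mulNr// => k /andP[/negbTE k0 /negbTE k1].
  by rewrite mxE eqxx k0 k1 mul0r.
case: (eqVneq i i1) => [->|ii1].
  rewrite big1 ?addr0// => k /andP[/negbTE k0 /negbTE k1].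
  by rewrite mxE i10 eqxx k0 k1 mul0r.
rewrite !mul0r !add0r (bigD1 i)/=; last by rewrite ii0 ii1.
rewrite mxE (negbTE ii0) (negbTE ii1) eqxx mul1r big1 ?addr0// => k /andP[_ ki].
by rewrite mxE (negbTE ii0) (negbTE ii1) eq_sym (negbTE ki) mul0r.
Qed.

(** Each column undergoes a planar rotation of two of its entries. The columns are treated one at a
    time, [js] listing those already rotated, so that each step is [gfam_rotate_pair]. *)
Lemma givens_preserves : preserves_gaussian givens.
Proof.
have i10 : (i1 == i0) = false by rewrite eq_sym (negbTE i01).
split.
  apply/matrixP => i j; rewrite mxE givens_sum !mxE i10 !eqxx.
  case: (eqVneq i i0) => [->|ii0].
    case: (eqVneq j i0) => [ej|ji0]; first by rewrite mulrN opprK -!expr2 cs.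
    case: (eqVneq j i1) => [ej|ji1]; first by rewrite mulrC subrr.
    by rewrite !mulr0 subrr.
  case: (eqVneq i i1) => [->|ii1].
    case: (eqVneq j i0) => [->|ji0]; first by rewrite i10 mulrN mulrC subrr.
    case: (eqVneq j i1) => [ej|ji1]; first by rewrite -!expr2 addrC cs.
    by rewrite !mulr0 addr0.
  case: (eqVneq j i0) => [->|ji0]; first by rewrite ?(negbTE ii0) ?(negbTE ii1).
  case: (eqVneq j i1) => [->|ji1]; first by rewrite ?(negbTE ii1) ?(negbTE ii0).
  by rewrite eq_sym.
move=> p X gX.
pose Xjs (js : seq 'I_p) (u : 'I_n * 'I_p) (w : Omega) :=
  if u.2 \in js then rotX givens X u w else X u w.
have key js : uniq js -> gfam P (Xjs js).
  elim: js => [_|j js IH /= /andP[jjs ujs]].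
    suff -> : Xjs [::] = X by [].
    by apply/funext.
  have nk : (i0, j) != (i1, j) by rewrite xpair_eqE negb_and i01.
  have := gfam_rotate_pair (IH ujs) nk s0 cs.
  suff -> : rotate_pair (Xjs js) (i0, j) (i1, j) c s = Xjs (j :: js) by [].
  apply/funext => -[i k]; apply/funext => w.
  rewrite /rotate_pair /Xjs /= !xpair_eqE inE.
  case: (eqVneq k j) => [->|kj]; rewrite ?andbT ?andbF//.
  by rewrite /= (negbTE jjs) /rotX /= givens_sum.
have := key _ (enum_uniq 'I_p).
suff -> : Xjs (enum 'I_p) = rotX givens X by [].
by apply/funext => -[i j]; rewrite /Xjs /= mem_enum.
Qed.

End Givens.

Definition sqn n (a : 'cV[R]_n) : R := \sum_i a i 0 ^+ 2.

(** Induction on the number of nonzero entries outside i0: a Givens rotation in the plane (i0, i1)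
    kills the entry i1 and leaves the remaining ones unchanged. *)
Lemma exists_rotation n (i0 : 'I_n) (a : 'cV[R]_n) : exists O : 'M[R]_n,
  preserves_gaussian O /\ exists r, O *m a = r *: delta_mx i0 0.
Proof.
pose nz (a : 'cV[R]_n) := [set i | (i != i0) && (a i 0 != 0)]%SET.
have [m] := ubnP #|nz a|; elim: m a => // m IH a am.
have [e|[i1]] := set_0Vmem (nz a).
  exists 1%:M; split; first exact: preserves_gaussian1.
  exists (a i0 0); rewrite mul1mx; apply/matrixP => i j; rewrite !mxE (ord1 j) eqxx andbT.
  case: (eqVneq i i0) => [->|ii0]; first by rewrite mulr1.
  rewrite mulr0; apply/eqP; move/setP: e => /(_ i); rewrite !inE ii0 /=.
  by move/negbT; rewrite negbK.
rewrite inE => /andP[i10 ai1].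
pose rho := Num.sqrt (a i0 0 ^+ 2 + a i1 0 ^+ 2).
have rho2 : rho ^+ 2 = a i0 0 ^+ 2 + a i1 0 ^+ 2 by rewrite sqr_sqrtr// addr_ge0 ?sqr_ge0.
have rho0 : rho != 0.
  rewrite gt_eqF// sqrtr_gt0; apply: ltr_wpDl; first exact: sqr_ge0.
  by rewrite exprn_even_gt0.
(* The sign of s gives s a_i0 + c a_i1 = 0, and s != 0 because an entry a_i1 != 0 was selected. *)
pose c := a i0 0 / rho; pose s := - a i1 0 / rho.
have s0 : s != 0 by rewrite mulf_neq0 ?oppr_eq0 ?invr_eq0.
have cs : c ^+ 2 + s ^+ 2 = 1.
  by rewrite /c /s !expr_div_n sqrrN -mulrDl -rho2 divff// expf_neq0.
have i01 : i0 != i1 by rewrite eq_sym.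
pose G := givens i0 i1 c s.
have [|O [gO [r Or]]] := IH (G *m a).
  rewrite ltnS in am; apply: leq_trans am; apply: proper_card; apply/properP; split.
    apply/fintype.subsetP => i; rewrite !inE => /andP[ii0]; rewrite ii0 mxE givens_sum// (negbTE ii0).
    case: (eqVneq i i1) => [->//|//].
  exists i1; first by rewrite inE i10.
  rewrite inE mxE givens_sum// (negbTE i10) eqxx /= negbK /s /c.
  by apply/eqP; field.
exists (O *m G); split; first by apply: preserves_gaussianM => //; exact: givens_preserves.
by exists r; rewrite -mulmxA.
Qed.

Lemma exists_rotation_unit n (i0 : 'I_n) (a : 'cV[R]_n) : sqn a = 1 ->
  exists O : 'M[R]_n, preserves_gaussian O /\
  exists2 r : R, r ^+ 2 = 1 & a = r *: (O^T *m delta_mx i0 0).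
Proof.
move=> a1; have [ O [gO [r Oa]]] := exists_rotation i0 a.
have OT : O^T *m O = 1%:M by apply: mulmx1C; exact: gO.1.
have aE : a = r *: (O^T *m delta_mx i0 0) by rewrite scalemxAr -Oa mulmxA OT mul1mx.
exists O; split => //; exists r => //.
have : (a^T *m a) 0 0 = 1.
  by rewrite -a1 mxE; apply: eq_bigr => i _; rewrite mxE expr2.
have aT : a^T = r *: ((delta_mx i0 0)^T *m O) by rewrite aE [LHS]linearZ /= trmx_mul trmxK.
rewrite aT {1}aE -scalemxAl -scalemxAr mulmxA -(mulmxA _ O) gO.1 mulmx1.
by rewrite trmx_delta mul_delta_mx scalerA !mxE !eqxx mulr1 -expr2.
Qed.

(** A linear form in the family is, up to sign, |v| times a standard Gaussian variable: the family
    is read as a one-column matrix and v is rotated to a basis vector. *)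
Lemma linear_eighth p (Y : 'I_p -> Omega -> R) (v : 'cV[R]_p) : gfam P Y ->
  Lall P (fun w => \sum_j v j 0 * Y j w) /\
  Ex P (fun w => (\sum_j v j 0 * Y j w) ^+ 8) = sqn v ^+ 4 * gmom R 8.
Proof.
move=> gY.
have LY j : Lall P (Y j).
  by apply: Lall_gauss; [exact: gY.1|move=> B mB; exact: gfam_law].
split; first by apply: Lall_sum => j; apply: LallM => //; exact: Lall_cst.
have [v0|v0] := eqVneq (sqn v) 0.
  have -> : (fun w => (\sum_j v j 0 * Y j w) ^+ 8) = (fun=> 0).
    apply/funext => w; rewrite big1 ?expr0n// => j _.
    have := psumr_eq0P (fun i _ => sqr_ge0 (v i 0)) v0 => /(_ j isT) /eqP.
    by rewrite sqrf_eq0 => /eqP ->; rewrite mul0r.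
  by rewrite Ex_cst v0 expr0n mul0r.
case: p Y v gY LY v0 => [|p] Y v gY LY v0.
  by move: v0; rewrite /sqn big_ord0 eqxx.
have vp : 0 < sqn v by rewrite lt_neqAle eq_sym v0 sumr_ge0// => i _; exact: sqr_ge0.
pose nv := Num.sqrt (sqn v).
have nv2 : nv ^+ 2 = sqn v by rewrite sqr_sqrtr// ltW.
have nv0 : nv != 0 by rewrite gt_eqF// sqrtr_gt0.
pose a := nv^-1 *: v.
have a1 : sqn a = 1.
  rewrite /sqn; under eq_bigr do rewrite mxE exprMn.
  by rewrite -mulr_sumr -/(sqn v) -nv2 exprVn mulVf// expf_neq0.
have [ O [gO [r r1 aE]]] := exists_rotation_unit ord0 a1.
pose X (u : 'I_p.+1 * 'I_1) := Y u.1.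
have gX : gfam P X.
  by apply: (gfam_inj (f := fun u : 'I_p.+1 * 'I_1 => u.1)) => // -[i j] [k l] /= ->; rewrite (ord1 j) (ord1 l).
have gZ := gO.2 _ _ gX.
have vE w : (\sum_j v j 0 * Y j w) ^+ 8 = sqn v ^+ 4 * rotX O X (ord0, ord0) w ^+ 8.
  have -> : \sum_j v j 0 * Y j w = nv * r * rotX O X (ord0, ord0) w.
    rewrite /rotX mulr_sumr; apply: eq_bigr => j _ /=.
    have -> : v = nv *: a by rewrite /a scalerA divff// scale1r.
    rewrite aE -colE !mxE /X /=; ring.
  have -> : (nv * r * rotX O X (ord0, ord0) w) ^+ 8 =
    (nv ^+ 2) ^+ 4 * (r ^+ 2) ^+ 4 * rotX O X (ord0, ord0) w ^+ 8 by ring.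
  by rewrite nv2 r1 expr1n mulr1.
under eq_fun do rewrite vE.
have mZ := gZ.1 (ord0, ord0).
have lZ B : measurable B -> P (rotX O X (ord0, ord0) @^-1` B) = normal_prob 0 1 B.
  by move=> mB; exact: gfam_law.
have LZ := Lall_gauss mZ lZ.
rewrite ExZ; last exact: LallX.
congr (_ * _); rewrite -(Ex_abs_gauss mZ lZ); congr (Ex P _); apply/funext => w.
by rewrite -normrX ger0_norm// exprn_even_ge0.
Qed.

End OrthogonalInvariance.

(** * Bilinear forms of the noise resolvent *)

Section Isotropic.
Context (R : realType) (d0 : measure_display) (Omega : measurableType d0).
Variable P : probability Omega R.
Local Notation C := R[i].

Definition bil n (Q : 'M[C]_n) (a b : 'cV[R]_n) : C := ((Cmx a)^T *m Q *m Cmx b) 0 0.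
Definition dotp n (a b : 'cV[R]_n) : R := (a^T *m b) 0 0.
Definition dev n (z : C) (Q : 'M[C]_n) (a b : 'cV[R]_n) : C :=
  bil Q a b - xstar z Q * toC (dotp a b).

Lemma dev_bil n (z : C) (Q : 'M[C]_n) a b :
  dev z Q a b = bil (Q - (xstar z Q)%:M) a b.
Proof.
have mxB (A B : 'M[C]_1) : (A - B) 0 0 = A 0 0 - B 0 0 by rewrite !mxE.
rewrite /dev /bil mulmxBr mulmxBl mxB; congr (_ - _).
by rewrite mul_mx_scalar -scalemxAl CmxT -CmxM !mxE /dotp mxE.
Qed.

Lemma bilDl n (Q : 'M[C]_n) a a' b : bil Q (a + a') b = bil Q a b + bil Q a' b.
Proof. by rewrite /bil CmxD linearD /= !mulmxDl mxE. Qed.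
Lemma bilDr n (Q : 'M[C]_n) a b b' : bil Q a (b + b') = bil Q a b + bil Q a b'.
Proof. by rewrite /bil CmxD !mulmxDr mxE. Qed.
Lemma bilZl n (Q : 'M[C]_n) t a b : bil Q (t *: a) b = toC t * bil Q a b.
Proof. by rewrite /bil CmxZ linearZ /= -!scalemxAl mxE. Qed.
Lemma bilZr n (Q : 'M[C]_n) t a b : bil Q a (t *: b) = toC t * bil Q a b.
Proof. by rewrite /bil CmxZ -!scalemxAr mxE. Qed.
Lemma bilC n (Q : 'M[C]_n) a b : Q^T = Q -> bil Q a b = bil Q b a.
Proof.
move=> sQ; rewrite /bil; transitivity (((Cmx a)^T *m Q *m Cmx b)^T 0 0); first by rewrite [RHS]mxE.
by rewrite !trmx_mul trmxK sQ mulmxA.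
Qed.

Lemma bil_polar n (Q : 'M[C]_n) a b : Q^T = Q ->
  bil Q a b = toC (1 / 4) * bil Q (a + b) (a + b) + toC (- (1 / 4)) * bil Q (a - b) (a - b).
Proof.
move=> sQ; have -> : a - b = a + (-1) *: b by rewrite scaleN1r.
rewrite !(bilDl, bilDr, bilZl, bilZr) (bilC b a sQ).
have e4 : toC (1 / 4) * 4 = 1 :> C by rewrite -(toC_nat R 4) -toCM mul1r mulVf.
transitivity (toC (1 / 4) * 4 * bil Q a b); first by rewrite e4 mul1r.
by rewrite !toCN toC1; ring.
Qed.

Lemma noiseQ_rot n p (s : R) (z : C) (O : 'M[R]_n) (W : 'M[R]_(n, p)) :
  complex.Im z != 0 -> O *m O^T = 1%:M ->
  noiseQ s z (O *m W) = Cmx O *m noiseQ s z W *m (Cmx O)^T.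
Proof.
move=> z0 OO.
have U V : Cmx (@gramc R n p s V) - z%:M \in unitmx.
  by apply: resolvent_unit => //; exact: gramc_sym.
have OT : O^T *m O = 1%:M by exact: mulmx1C.
have CO : Cmx O *m (Cmx O)^T = 1%:M by rewrite CmxT -CmxM OO Cmx_scalar.
have COT : (Cmx O)^T *m Cmx O = 1%:M by rewrite CmxT -CmxM OT Cmx_scalar.
have DE : Cmx (gramc s (O *m W)) - z%:M = Cmx O *m (Cmx (gramc s W) - z%:M) *m (Cmx O)^T.
  have -> : gramc s (O *m W) = O *m gramc s W *m O^T.
    rewrite /gramc -scalemxAr -scalemxAl; congr (_ *: _).
    rewrite mulmxBr mulmxBl trmx_mul !mulmxA; congr (_ - _).
    by rewrite mul_mx_scalar -scalemxAl OO scalemx1.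
  rewrite !CmxM -CmxT mulmxBr mulmxBl; congr (_ - _).
  by rewrite mul_mx_scalar -scalemxAl CO scalemx1.
rewrite {1}/noiseQ; apply: (can_inj (mulKmx (U (O *m W)))); rewrite mulmxV// DE.
rewrite -!mulmxA (mulmxA _^T) COT mul1mx /noiseQ (mulmxA (_ - _)) mulmxV// mul1mx.
by rewrite CO.
Qed.

Lemma stieltjes_rot n (O : 'M[R]_n) (Q : 'M[C]_n) : O *m O^T = 1%:M ->
  stieltjes (Cmx O *m Q *m (Cmx O)^T) = stieltjes Q.
Proof.
move=> OO; rewrite /stieltjes mxtrace_mulC mulmxA CmxT -CmxM (mulmx1C OO) Cmx_scalar.
by rewrite mul1mx.
Qed.

(** Writing a as plus or minus O^T e_0, the number a^T Q(W) a is the first diagonal entry of Q(O W),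
    while [xstar] is unchanged. As O W is again Gaussian, [row_moment] applies. *)
Lemma integral_dev_unit n p (X : 'I_n * 'I_p -> Omega -> R) (s K : R) (z : C) (a : 'cV[R]_n) :
  complex.Im z != 0 -> gfam P X -> (0 < n)%N ->
  s ^+ 2 * (n%:R * p%:R) = 1 -> n%:R ^+ 2 <= K * p%:R -> sqn a = 1 ->
  (\int[P]_w (nq (dev z (noiseQ s z (Wmx X w)) a a) ^+ 2)%:E <= (cst3 K z / n%:R ^+ 2)%:E)%E.
Proof.
case: n X a => // n' Y a z0 gY _ hs' hK' a1.
have [ O [gO [r r1 aE]]] := exists_rotation_unit P ord0 a1.
have gZ := gO.2 _ _ gY.
have := row_moment z0 gZ hs' hK'.
have -> : (fun w => (nq (noiseQ s z (Wmx (rotX O Y) w) 0 0 -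
     xstar z (noiseQ s z (Wmx (rotX O Y) w))) ^+ 2)%:E) =
   (fun w => (nq (dev z (noiseQ s z (Wmx Y w)) a a) ^+ 2)%:E) => //.
apply/funext => w; rewrite Wmx_rotX noiseQ_rot//; last exact: gO.1.
congr (nq _ ^+ 2)%:E; rewrite /dev /xstar stieltjes_rot//; last exact: gO.1.
have -> : dotp a a = 1 by rewrite -a1 /dotp mxE; apply: eq_bigr => i _; rewrite mxE expr2.
rewrite mulr1; congr (_ - _).
rewrite aE bilZl bilZr mulrA -toCM -expr2 r1 mul1r /bil CmxM -CmxT trmx_mul trmxK.
have -> : Cmx (delta_mx ord0 0 : 'cV[R]_n'.+1) = delta_mx ord0 0 :> 'cV[C]_n'.+1.
  by rewrite CmxE map_delta_mx.
rewrite trmx_delta; set M := Cmx O *m _ *m (Cmx O)^T.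
transitivity (((delta_mx 0 ord0 : 'rV[C]_n'.+1) *m M *m (delta_mx ord0 0 : 'cV[C]_n'.+1)) 0 0); last by rewrite /M !mulmxA.
by rewrite -rowE -colE [RHS]mxE [RHS]mxE.
Qed.

Section Family.
Variables (n p : nat) (X : 'I_n * 'I_p -> Omega -> R) (s K : R) (z : C).
Hypothesis z0 : complex.Im z != 0.
Hypothesis gX : gfam P X.
Hypothesis n0 : (0 < n)%N.
Hypothesis hs : s ^+ 2 * (n%:R * p%:R) = 1.
Hypothesis hK : n%:R ^+ 2 <= K * p%:R.
Let Q w := noiseQ s z (Wmx X w).
Let symQ w : (Q w)^T = Q w.
Proof. by apply: resolvent_tr; exact: gramc_sym. Qed.

Lemma mC_dev a b : mC (fun w => dev z (Q w) a b).
Proof.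
have mQ : mMx Q by apply: mMx_noiseQ => // i j; under eq_fun do rewrite mxE; exact: gX.1.
apply: mCB; last by apply: mCM; [exact: mC_xstar|exact: mC_cst].
by have := mMxM (mMxM (mMx_cst Omega (Cmx a)^T) mQ) (mMx_cst Omega (Cmx b)); apply.
Qed.

(** The resolvent and [xstar] are bounded in terms of Im z, so the deviation is bounded by a
    constant. *)
Lemma Lall_dev a b : Lall P (fun w => nq (dev z (Q w) a b)).
Proof.
pose y2 := complex.Im z ^+ 2.
have y2p : 0 < y2 by rewrite exprn_even_gt0.
pose M := 2 * (fro2 (Cmx a) * (fro2 (Cmx b) / y2)) + 2 * (y2^-1 * dotp a b ^+ 2).
apply: (@Lall_dom _ _ _ _ _ (fun k w => M ^+ k)).
- by apply: measurable_nq; exact: mC_dev.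
- by move=> k; exact: (finite_measure_integrable_cst P (M ^+ k)).
move=> k w; rewrite ger0_norm ?nq_ge0//.
have hM : nq (dev z (Q w) a b) <= M.
  apply: le_trans (nqB _ _) _; apply: lerD; rewrite ler_pM2l//.
    apply: le_trans (fro2_entry _ 0 0) _; rewrite -mulmxA.
    apply: le_trans (fro2M _ _) _; rewrite fro2_tr ler_wpM2l ?fro2_ge0//.
    by apply: resolvent_bound => //; exact: gramc_sym.
  rewrite nqM nq_toC ler_wpM2r ?sqr_ge0//.
  by apply: nq_xstar => //; exact: gramc_sym.
by rewrite lerXn2r ?nnegrE ?nq_ge0//; apply: le_trans hM; exact: nq_ge0.
Qed.

Lemma dev_unit a : sqn a = 1 ->
  Ex P (fun w => nq (dev z (Q w) a a) ^+ 2) <= cst3 K z / n%:R ^+ 2.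
Proof.
move=> a1; have := integral_dev_unit z0 gX n0 hs hK a1.
by rewrite ExE ?lee_fin//; apply: LallX; exact: Lall_dev.
Qed.

Lemma dev_diag a :
  Ex P (fun w => nq (dev z (Q w) a a) ^+ 2) <= sqn a ^+ 4 * (cst3 K z / n%:R ^+ 2).
Proof.
have [v0|v0] := eqVneq (sqn a) 0.
  have -> : (fun w => nq (dev z (Q w) a a) ^+ 2) = (fun=> 0).
    have a0 : a = 0.
      apply/matrixP => i j; rewrite mxE (ord1 j).
      have := psumr_eq0P (fun i _ => sqr_ge0 (a i 0)) v0 => /(_ i isT) /eqP.
      by rewrite sqrf_eq0 => /eqP.
    apply/funext => w; rewrite a0 dev_bil.
    by rewrite -(scale0r 0) bilZl mul0r nq0 expr0n.
  by rewrite Ex_cst v0 expr0n mul0r.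
have vp : 0 < sqn a by rewrite lt_neqAle eq_sym v0 sumr_ge0// => i _; exact: sqr_ge0.
pose nv := Num.sqrt (sqn a).
have nv2 : nv ^+ 2 = sqn a by rewrite sqr_sqrtr// ltW.
have nv0 : nv != 0 by rewrite gt_eqF// sqrtr_gt0.
pose b := nv^-1 *: a.
have b1 : sqn b = 1.
  rewrite /sqn; under eq_bigr do rewrite mxE exprMn.
  by rewrite -mulr_sumr -/(sqn a) -nv2 exprVn mulVf// expf_neq0.
have aE : a = nv *: b by rewrite /b scalerA divff// scale1r.
have -> : (fun w => nq (dev z (Q w) a a) ^+ 2) =
    (fun w => sqn a ^+ 4 * nq (dev z (Q w) b b) ^+ 2).
  apply/funext => w; rewrite !dev_bil {1 2}aE bilZl bilZr !nqM nq_toC nv2; ring.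
rewrite ExZ; last by apply: LallX; exact: Lall_dev.
by rewrite ler_wpM2l ?exprn_even_ge0// dev_unit.
Qed.

Let cst3_ge0 : 0 <= cst3 K z.
Proof.
rewrite /cst3 divr_ge0 ?exprn_even_ge0// addr_ge0// mulr_ge0 ?sqr_ge0//.
by rewrite mulr_ge0// exprn_even_ge0.
Qed.

Lemma dev_unit2 a b : sqn a = 1 -> sqn b = 1 ->
  Ex P (fun w => nq (dev z (Q w) a b) ^+ 2) <= 16 * (cst3 K z / n%:R ^+ 2).
Proof.
move=> a1 b1.
have cn : 0 <= cst3 K z / n%:R ^+ 2 by rewrite divr_ge0 ?sqr_ge0.
pose L1 := Lall_dev (a + b) (a + b); pose L2 := Lall_dev (a - b) (a - b).
have LX1 := LallX 2 L1; have LX2 := LallX 2 L2.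
have LZ c F : Lall P F -> Lall P (fun w => c * F w).
  by move=> LF; apply: LallM => //; exact: Lall_cst.
(* The weights 1/4 of polarisation give |.|^2 <= (|u|^2 + |v|^2) / 8, whose square has weights 1/32.
   As |a + b|^2 and |a - b|^2 are at most 4, the result is 2 * 4^4 / 32 = 16. *)
apply: (@le_trans _ _ (Ex P (fun w => 1 / 32 * nq (dev z (Q w) (a + b) (a + b)) ^+ 2 +
    1 / 32 * nq (dev z (Q w) (a - b) (a - b)) ^+ 2))).
  apply: Ex_le; first by apply: LallX; exact: Lall_dev.
    by apply: LallD; exact: LZ.
  move=> w; rewrite !dev_bil.
  have sQx : (Q w - (xstar z (Q w))%:M)^T = Q w - (xstar z (Q w))%:M.
    by rewrite linearB /= symQ tr_scalar_mx.
  rewrite (bil_polar a b sQx).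
  set u := bil _ (a + b) _; set v := bil _ (a - b) _.
  have h : nq (toC (1 / 4) * u + toC (- (1 / 4)) * v) <= 1 / 8 * (nq u + nq v).
    by apply: le_trans (nqD _ _) _; rewrite !nqM !nq_toC; lra.
  have u0 := nq_ge0 u; have v0 := nq_ge0 v.
  apply: (@le_trans _ _ ((1 / 8 * (nq u + nq v)) ^+ 2)).
    by rewrite lerXn2r ?nnegrE ?nq_ge0// mulr_ge0// addr_ge0.
  by have := sqr_ge0 (nq u - nq v); lra.
rewrite ExD ?ExZ//; try exact: LZ.
have bnd e : (e = 1 \/ e = -1) -> sqn (a + e *: b) ^+ 4 <= 256.
  move=> he; have e2 : e ^+ 2 = 1 by case: he => ->; rewrite ?sqrrN expr1n.
  have h : sqn (a + e *: b) <= 4.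
    have -> : 4 = 2 * sqn a + 2 * sqn b :> R by rewrite a1 b1; lra.
    rewrite /sqn !mulr_sumr -big_split; apply: ler_sum => i _ /=; rewrite !mxE.
    have := sqr_ge0 (a i 0 - e * b i 0).
    have -> : b i 0 ^+ 2 = (e * b i 0) ^+ 2 by rewrite exprMn e2 mul1r.
    lra.
  have h0 : 0 <= sqn (a + e *: b) by apply: sumr_ge0 => i _; exact: sqr_ge0.
  apply: (@le_trans _ _ (4 ^+ 4)); last by rewrite -natrX ler_nat.
  by rewrite lerXn2r ?nnegrE.
have b2 := bnd 1 (or_introl erefl); have b3 := bnd (-1) (or_intror erefl).
rewrite scale1r in b2; rewrite scaleN1r in b3.
have := le_trans (dev_diag (a + b)) (ler_wpM2r cn b2).
have := le_trans (dev_diag (a - b)) (ler_wpM2r cn b3).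
lra.
Qed.

Lemma dev_moment a b : Ex P (fun w => nq (dev z (Q w) a b) ^+ 2) <=
  (sqn a * sqn b) ^+ 2 * (16 * (cst3 K z / n%:R ^+ 2)).
Proof.
have zero (c : 'cV[R]_n) : sqn c = 0 -> c = 0.
  move=> c0; apply/matrixP => i j; rewrite mxE (ord1 j).
  have := psumr_eq0P (fun i _ => sqr_ge0 (c i 0)) c0 => /(_ i isT) /eqP.
  by rewrite sqrf_eq0 => /eqP.
have unit (c : 'cV[R]_n) : sqn c != 0 -> exists2 c', sqn c' = 1 & exists2 t, t ^+ 2 = sqn c & c = t *: c'.
  move=> c0.
  have cp : 0 < sqn c by rewrite lt_neqAle eq_sym c0 sumr_ge0// => i _; exact: sqr_ge0.
  have nv2 : Num.sqrt (sqn c) ^+ 2 = sqn c by rewrite sqr_sqrtr// ltW.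
  have nv0 : Num.sqrt (sqn c) != 0 by rewrite gt_eqF// sqrtr_gt0.
  exists ((Num.sqrt (sqn c))^-1 *: c).
    rewrite /sqn; under eq_bigr do rewrite mxE exprMn.
    by rewrite -mulr_sumr -/(sqn c) exprVn nv2 mulVf.
  by exists (Num.sqrt (sqn c)) => //; rewrite scalerA divff// scale1r.
have [/zero a0|/unit [a' a1 [t tE aE]]] := eqVneq (sqn a) 0.
  have -> : (fun w => nq (dev z (Q w) a b) ^+ 2) = (fun=> 0).
    by apply/funext => w; rewrite a0 dev_bil -(scale0r 0) bilZl mul0r nq0 expr0n.
  by rewrite Ex_cst mulr_ge0 ?sqr_ge0// mulr_ge0// divr_ge0// sqr_ge0.
have [/zero b0|/unit [b' b1 [u uE bE]]] := eqVneq (sqn b) 0.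
  have -> : (fun w => nq (dev z (Q w) a b) ^+ 2) = (fun=> 0).
    by apply/funext => w; rewrite b0 dev_bil -(scale0r 0) bilZr mul0r nq0 expr0n.
  by rewrite Ex_cst mulr_ge0 ?sqr_ge0// mulr_ge0// divr_ge0// sqr_ge0.
have -> : (fun w => nq (dev z (Q w) a b) ^+ 2) =
    (fun w => (sqn a * sqn b) ^+ 2 * nq (dev z (Q w) a' b') ^+ 2).
  by apply/funext => w; rewrite !dev_bil {1}aE {1}bE bilZl bilZr !nqM !nq_toC tE uE; ring.
rewrite ExZ; last by apply: LallX; exact: Lall_dev.
by rewrite ler_wpM2l ?sqr_ge0// dev_unit2.
Qed.

End Family.
End Isotropic.

(** * Moments of sums: columns of the signal, normalised traces, cross term *)

Section SumMoments.
Context (R : realType) (d0 : measure_display) (Omega : measurableType d0).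
Variable P : probability Omega R.
Local Notation C := R[i].

Lemma Ex_sum (I : Type) (r : seq I) (Q : pred I) (F : I -> Omega -> R) :
  (forall i, Lall P (F i)) ->
  Ex P (fun w => \sum_(i <- r | Q i) F i w) = \sum_(i <- r | Q i) Ex P (F i).
Proof.
move=> LF; elim: r => [|i r IH].
  by under eq_fun do rewrite big_nil; rewrite Ex_cst big_nil.
under eq_fun do rewrite big_cons; rewrite big_cons; case: (Q i) => //.
by rewrite ExD ?IH//; exact: Lall_sum.
Qed.

(** Minkowski's inequality in L^2, by expanding the square and applying Cauchy-Schwarz to each
    product. *)
Lemma Ex_sqr_sum (I : finType) (t : I -> Omega -> R) (b : I -> R) :
  (forall i, Lall P (t i)) -> (forall i w, 0 <= t i w) -> (forall i, 0 <= b i) ->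
  (forall i, Ex P (fun w => t i w ^+ 2) <= b i ^+ 2) ->
  Ex P (fun w => (\sum_i t i w) ^+ 2) <= (\sum_i b i) ^+ 2.
Proof.
move=> Lt t0 b0 tb.
have -> : (fun w => (\sum_i t i w) ^+ 2) = (fun w => \sum_i \sum_j t i w * t j w).
  apply/funext => w; rewrite expr2 mulr_suml; apply: eq_bigr => i _; exact: mulr_sumr.
have Lij i j : Lall P (fun w => t i w * t j w) by exact: LallM.
rewrite Ex_sum; last by move=> i; exact: Lall_sum.
rewrite expr2 mulr_suml; apply: ler_sum => i _; rewrite Ex_sum// mulr_sumr.
apply: ler_sum => j _.
rewrite -ler_sqr ?nnegrE ?mulr_ge0//; last by apply: Ex_ge0 => // w; exact: mulr_ge0.
apply: le_trans (CS_Ex (Lt i) (Lt j)) _; rewrite exprMn; apply: ler_pM => //.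
  by apply: Ex_ge0; [exact: LallX|move=> w; exact: sqr_ge0].
by apply: Ex_ge0; [exact: LallX|move=> w; exact: sqr_ge0].
Qed.

Section Family.
Variables (n p : nat) (X : 'I_n * 'I_p -> Omega -> R) (s K : R) (z : C).
Hypothesis z0 : complex.Im z != 0.
Hypothesis gX : gfam P X.
Hypothesis n0 : (0 < n)%N.
Hypothesis hs : s ^+ 2 * (n%:R * p%:R) = 1.
Hypothesis hK : n%:R ^+ 2 <= K * p%:R.
Let Q w := noiseQ s z (Wmx X w).
Let np : 0 < n%:R :> R. Proof. by rewrite ltr0n. Qed.

(** [rate] / n bounds the L^2 norm of the squared deviation for unit vectors; its square is 16
    [cst3]. *)
Definition rate : R := 4 * Num.sqrt (cst3 K z).

Lemma rate_ge0 : 0 <= rate. Proof. by rewrite mulr_ge0// sqrtr_ge0. Qed.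

Let cst3_ge0 : 0 <= cst3 K z.
Proof.
rewrite /cst3 divr_ge0 ?exprn_even_ge0// addr_ge0// mulr_ge0 ?sqr_ge0//.
by rewrite mulr_ge0// exprn_even_ge0.
Qed.

Lemma sqn_ge0 k (a : 'cV[R]_k) : 0 <= sqn a.
Proof. by apply: sumr_ge0 => i _; exact: sqr_ge0. Qed.

Lemma dev_moment_rate a b : Ex P (fun w => nq (dev z (Q w) a b) ^+ 2) <=
  (sqn a * sqn b * (rate / n%:R)) ^+ 2.
Proof.
apply: le_trans (dev_moment z0 gX n0 hs hK a b) _.
rewrite [leRHS]exprMn ler_wpM2l ?sqr_ge0// expr_div_n /rate exprMn sqr_sqrtr//.
by rewrite le_eqVlt; apply/orP; left; apply/eqP; ring.
Qed.

Lemma dev_rows_moment k (a : 'cV[R]_n) (D : 'M[R]_(n, k)) :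
  Ex P (fun w => (\sum_i nq (dev z (Q w) a (col i D))) ^+ 2) <=
  (sqn a * (\sum_i sqn (col i D)) * (rate / n%:R)) ^+ 2.
Proof.
have r0 : 0 <= rate / n%:R by rewrite divr_ge0// ?rate_ge0// ltW.
have := @Ex_sqr_sum _ (fun i w => nq (dev z (Q w) a (col i D)))
  (fun i => sqn a * sqn (col i D) * (rate / n%:R)).
rewrite -mulr_suml -mulr_sumr; apply.
- by move=> i; exact: Lall_dev.
- by move=> i w; exact: nq_ge0.
- by move=> i; rewrite !mulr_ge0 ?sqn_ge0.
- by move=> i; exact: dev_moment_rate.
Qed.

Definition tdev (w : Omega) (A : 'M[R]_n) : C :=
  toC n%:R^-1 * \tr (Cmx A *m (Q w - (xstar z (Q w))%:M)).

Lemma tdevE w A : tdev w A = \sum_i toC n%:R^-1 * dev z (Q w) (delta_mx i 0) (col i A).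
Proof.
rewrite /tdev mxtrace_mulC -mulr_sumr; congr (_ * _); apply: eq_bigr => i _.
rewrite dev_bil /bil.
have -> : (Cmx (delta_mx i 0 : 'cV[R]_n))^T = delta_mx 0 i.
  by rewrite CmxT trmx_delta CmxE map_delta_mx.
rewrite -rowE mxE [RHS]mxE; apply: eq_bigr => k _.
by rewrite !mxE.
Qed.

(** The trace is an average over the basis vectors, and the squared modulus is convex. *)
Lemma nq_tdev_le w A : nq (tdev w A) <=
  \sum_i n%:R^-1 * nq (dev z (Q w) (delta_mx i 0) (col i A)).
Proof.
rewrite tdevE; apply: le_trans (nq_sumCS _ _ _ _) _.
under eq_bigr do rewrite nq_toC.
rewrite sumr_const card_ord -mulr_sumr ler_wpM2r//.
  by apply: sumr_ge0 => i _; exact: nq_ge0.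
by rewrite -[leLHS]mulr_natr expr2 -mulrA mulVf ?mulr1// gt_eqF.
Qed.

Lemma Lall_tdev A : Lall P (fun w => nq (tdev w A)).
Proof.
have LS : Lall P (fun w => \sum_i n%:R^-1 * nq (dev z (Q w) (delta_mx i 0) (col i A))).
  by apply: Lall_sum => i; apply: LallM; [exact: Lall_cst|exact: Lall_dev].
apply: (@Lall_dom _ _ _ _ _ (fun k w =>
  `|\sum_i n%:R^-1 * nq (dev z (Q w) (delta_mx i 0) (col i A))| ^+ k)).
- apply: measurable_nq; under eq_fun do rewrite tdevE.
  by apply: mC_sum => i; apply: mCM; [exact: mC_cst|exact: (mC_dev _ z0 gX)].
- by move=> k; exact: LS.2.
move=> k w; rewrite lerXn2r ?nnegrE// ger0_norm ?nq_ge0//.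
by apply: le_trans (nq_tdev_le _ _) (ler_norm _).
Qed.

Lemma tdev_moment A (M : R) : (forall i, sqn (col i A) <= M) ->
  Ex P (fun w => nq (tdev w A) ^+ 2) <= (M * (rate / n%:R)) ^+ 2.
Proof.
move=> AM.
have r0 : 0 <= rate / n%:R by rewrite divr_ge0// ?rate_ge0// ltW.
have M0 : 0 <= M by apply: le_trans (AM (Ordinal n0)); exact: sqn_ge0.
pose t (i : 'I_n) w := n%:R^-1 * nq (dev z (Q w) (delta_mx i 0) (col i A)).
have Lt i : Lall P (t i) by apply: LallM; [exact: Lall_cst|exact: Lall_dev].
apply: (@le_trans _ _ (Ex P (fun w => (\sum_i t i w) ^+ 2))).
  apply: Ex_le; first by apply: LallX; exact: Lall_tdev.
    by apply: LallX; exact: Lall_sum.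
  move=> w; have h := nq_tdev_le w A.
  by rewrite lerXn2r ?nnegrE ?nq_ge0//; apply: le_trans h; exact: nq_ge0.
have := @Ex_sqr_sum _ t (fun i => n%:R^-1 * (M * (rate / n%:R))) Lt.
have -> : \sum_(i < n) n%:R^-1 * (M * (rate / n%:R)) = M * (rate / n%:R).
  by rewrite sumr_const card_ord -[LHS]mulr_natl mulVKf// gt_eqF.
apply.
- by move=> i w; rewrite mulr_ge0 ?invr_ge0 ?nq_ge0// ltW.
- by move=> i; rewrite !mulr_ge0// invr_ge0 ltW.
move=> i; have -> : (fun w => t i w ^+ 2) =
    (fun w => n%:R^-1 ^+ 2 * nq (dev z (Q w) (delta_mx i 0) (col i A)) ^+ 2).
  by apply/funext => w; rewrite exprMn.
rewrite ExZ; last by apply: LallX; exact: Lall_dev.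
rewrite exprMn ler_wpM2l ?sqr_ge0//.
apply: le_trans (dev_moment_rate _ _) _.
have -> : sqn (delta_mx i 0 : 'cV[R]_n) = 1.
  rewrite /sqn (bigD1 i)//= mxE !eqxx expr1n big1 ?addr0// => j ji.
  by rewrite mxE (negbTE ji) expr0n.
rewrite mul1r lerXn2r ?nnegrE ?mulr_ge0 ?sqn_ge0//.
by rewrite ler_wpM2r.
Qed.

(** Each entry of A W^T is a Gaussian linear form, with eighth moment given by [linear_eighth];
    [Ex_sqr_sum] is applied to pairs of entries to reach the fourth moment of S. That order is
    required later: S, once normalised, is of order N^(-1/2), so its fourth moment is the summable
    one. The summand 1 makes the constant c at least 1, hence c <= c^4. *)
Lemma cross_moment (A : 'M[R]_(n, p)) :
  let S w := \sum_i \sum_j (A *m (Wmx X w)^T) i j ^+ 2 in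
  Lall P S /\ Ex P (fun w => (S w ^+ 2) ^+ 2) <=
    (n%:R * (gmom R 8 + 1) * \sum_i \sum_j A i j ^+ 2) ^+ 4.
Proof.
move=> S; pose c := gmom R 8 + 1.
have g8 := gmom_ge0 R 8.
have c1 : 1 <= c by rewrite /c; lra.
have gY j : gfam P (fun k => X (j, k)) by apply: (gfam_inj (f := fun k => (j, k))) => // ? ? [].
pose t (ij : 'I_n * 'I_n) w := (\sum_k (row ij.1 A)^T k 0 * X (ij.2, k) w) ^+ 2.
pose b (ij : 'I_n * 'I_n) := c * sqn (row ij.1 A)^T.
have Lt ij : Lall P (t ij) by apply: LallX; exact: (linear_eighth _ (gY ij.2)).1.
have t0 ij w : 0 <= t ij w by exact: sqr_ge0.
have b0 ij : 0 <= b ij by rewrite mulr_ge0 ?sqn_ge0//; lra.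
have SE w : S w = \sum_ij t ij w.
  rewrite /S pair_bigA; apply: eq_bigr => -[i j] _; rewrite /t /= mxE; congr (_ ^+ 2).
  by apply: eq_bigr => k _; rewrite !mxE.
have LS : Lall P S.
  by rewrite (_ : S = fun w => \sum_ij t ij w); [exact: Lall_sum|apply/funext].
split=> //.
have t4 ij : Ex P (fun w => t ij w ^+ 4) <= b ij ^+ 4.
  have -> : (fun w => t ij w ^+ 4) = (fun w => (\sum_k (row ij.1 A)^T k 0 * X (ij.2, k) w) ^+ 8).
    by apply/funext => w; rewrite /t -exprM.
  rewrite (linear_eighth _ (gY ij.2)).2 /b exprMn mulrC ler_wpM2r ?exprn_even_ge0//.
  by apply: (@le_trans _ _ c); [rewrite /c; lra|rewrite ler_eXnr].
pose t2 (u : ('I_n * 'I_n) * ('I_n * 'I_n)) w := t u.1 w * t u.2 w.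
have := @Ex_sqr_sum _ t2 (fun u => b u.1 * b u.2).
have -> : (fun w => (\sum_i t2 i w) ^+ 2) = (fun w => (S w ^+ 2) ^+ 2).
  apply/funext => w; congr (_ ^+ 2); rewrite SE expr2 mulr_suml.
  under [in RHS]eq_bigr do rewrite mulr_sumr.
  by rewrite pair_bigA.
have -> : \sum_i b i.1 * b i.2 = (n%:R * c * \sum_i \sum_j A i j ^+ 2) ^+ 2.
  have -> : n%:R * c * \sum_i \sum_j A i j ^+ 2 = \sum_ij b ij.
    rewrite -(pair_bigA _ (fun i j => c * sqn (row i A)^T)) /=.
    under [RHS]eq_bigr do rewrite sumr_const card_ord -mulr_natl.
    rewrite -mulr_sumr -mulr_sumr mulrA; congr (_ * _); apply: eq_bigr => i _.
    by apply: eq_bigr => j _; rewrite !mxE.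
  rewrite expr2 mulr_suml.
  under [in RHS]eq_bigr do rewrite mulr_sumr.
  by rewrite pair_bigA.
rewrite -exprM; apply.
- by move=> u; exact: LallM.
- by move=> u w; rewrite mulr_ge0.
- by move=> u; rewrite mulr_ge0.
move=> u.
have L2 i : Lall P (fun w => t i w ^+ 2) by exact: LallX.
have -> : (fun w => t2 u w ^+ 2) = (fun w => t u.1 w ^+ 2 * t u.2 w ^+ 2).
  by apply/funext => w; rewrite exprMn.
rewrite -ler_sqr ?nnegrE ?sqr_ge0//; last first.
  by apply: Ex_ge0; [exact: LallM|move=> w; rewrite mulr_ge0 ?sqr_ge0].
apply: le_trans (CS_Ex (L2 u.1) (L2 u.2)) _.
have e i : (fun w => (t i w ^+ 2) ^+ 2) = (fun w => t i w ^+ 4).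
  by apply/funext => w; rewrite -exprM.
rewrite !e -exprM exprMn; apply: ler_pM => //.
  by apply: Ex_ge0; [exact: LallX|move=> w; rewrite exprn_even_ge0].
by apply: Ex_ge0; [exact: LallX|move=> w; rewrite exprn_even_ge0].
Qed.

End Family.
End SumMoments.

(** * Almost sure convergence from summable moments *)

Section AlmostSure.
Context (R : realType) (d0 : measure_display) (Omega : measurableType d0).
Variable P : probability Omega R.

Lemma sum_inv_sqr_le (m : nat) : \sum_(k < m) (k.+1%:R : R) ^- 2 <= 2.
Proof.
(* The strengthened bound telescopes: 1 / x^2 <= 2 (1 / x - 1 / (x + 1)) for x >= 1. *)
suff : \sum_(k < m) (k.+1%:R : R) ^- 2 <= 2 - 2 * m.+1%:R^-1.
  move=> /le_trans; apply; rewrite lerBlDl lerDr mulr_ge0//.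
elim: m => [|m IH]; first by rewrite big_ord0 invr1 mulr1 subrr.
rewrite big_ord_recr /=; apply: le_trans (lerD IH (lexx _)) _.
have m0 : 0 < m.+1%:R :> R by rewrite ltr0n.
have -> : m.+2%:R = m.+1%:R + 1 :> R by rewrite -natr1.
move: (m.+1%:R : R) m0 (ler1n R m.+1) => x x0; rewrite ltn0Sn => x1.
have x1p : 0 < x + 1 by lra.
suff h : x ^- 2 <= 2 * (x^-1 - (x + 1)^-1) by lra.
have -> : x^-1 - (x + 1)^-1 = x^-1 * (x + 1)^-1.
  by field; rewrite !gt_eqF.
have -> : x ^- 2 = x^-1 * x^-1 by rewrite expr2 invfM.
rewrite mulrCA ler_wpM2l ?invr_ge0 1?(ltW x0)// ler_pdivlMr// mulrDr mulVf ?gt_eqF// mulr1.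
have : x^-1 <= 1 by rewrite invf_le1.
lra.
Qed.

(** The series of the variables has finite expectation, so it converges almost surely and its terms
    tend to 0. This says nothing about the joint law for different N. *)
Lemma ae_cvg0 (V : nat -> Omega -> R) (C : R) (N1 : nat) :
  (forall N w, 0 <= V N w) ->
  (forall N, (N1 <= N)%N -> Lall P (V N) /\ Ex P (V N) <= C / N%:R ^+ 2) ->
  {ae P, forall w, V N w @[N --> \oo] --> (0 : R)}.
Proof.
move=> V0 VC.
(* The shift by N1 + 1 rather than N1 keeps the index positive even when N1 = 0, so that C / N^2 is
   a genuine quotient. *)
pose f k := V (k + N1.+1)%N.
have Lf k : Lall P (f k).
  by have [] := VC (k + N1.+1)%N (leq_trans (leqnSn _) (leq_addl _ _)).
have f0 k w : (0 <= (f k w)%:E)%E by rewrite lee_fin V0.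
have C0 : 0 <= C.
  have [L E] := VC N1.+1 (leqnSn _).
  have := le_trans (Ex_ge0 L (V0 _)) E.
  by rewrite pmulr_lge0 ?invr_gt0 ?exprn_gt0.
have fC k : Ex P (f k) <= C * k.+1%:R ^- 2.
  have [_ E] := VC (k + N1.+1)%N (leq_trans (leqnSn _) (leq_addl _ _)).
  apply: le_trans E _; rewrite ler_wpM2l// lef_pV2 ?posrE ?exprn_gt0 ?ltr0n ?addnS//.
  by rewrite lerXn2r ?nnegrE// ler_nat ltnS leq_addr.
have mf k : measurable_fun setT (fun w => (f k w)%:E).
  by apply/measurable_EFinP; exact: (Lf k).1.
have sumE : (\int[P]_w (\sum_(k <oo) (f k w)%:E) <= (C * 2)%:E)%E.
  rewrite (@integral_nneseries _ _ _ P setT measurableT (fun k w => (f k w)%:E))//.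
  apply: lime_le.
    by apply: is_cvg_nneseries => k _ _; exact: integral_ge0.
  near=> m; rewrite big_mkord; under eq_bigr do rewrite ExE//.
  rewrite sumEFin lee_fin.
  apply: le_trans (ler_wpM2l C0 (sum_inv_sqr_le m)).
  by rewrite mulr_sumr; apply: ler_sum => k _; exact: fC.
have mS : measurable_fun setT (fun w => \sum_(k <oo) (f k w)%:E)%E.
  by apply: ge0_emeasurable_sum => // k w _ _.
have IS : P.-integrable setT (fun w => \sum_(k <oo) (f k w)%:E)%E.
  apply/integrableP; split => //.
  under eq_integral do rewrite gee0_abs ?nneseries_ge0//.
  by apply: le_lt_trans sumE _; exact: ltry.
apply: filterS (integrable_ae measurableT IS) => w /(_ I) Sw.
rewrite -(cvg_shiftn N1.+1).
suff /fine_cvgP[_] : ((f k w)%:E @[k --> \oo] --> 0%:E)%E by [].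
have tail := @nneseries_tail_cvg R (fun k => (f k w)%:E) xpredT.
have {}tail := tail _ (fun k _ => f0 k w).
apply: squeeze_cvge (cvg_cst 0%E) (tail _); last by rewrite ltey_eq Sw.
near=> k; rewrite f0 /=.
have := @nneseries_lim_ge R (fun k => (f k w)%:E) xpredT k k.+1 (fun k _ _ => f0 k w).
by rewrite big_nat1.
Unshelve. all: by end_near.
Qed.

Lemma ae_cvg0_sqr (U : nat -> Omega -> R) (C : R) (N1 : nat) :
  (forall N w, 0 <= U N w) ->
  (forall N, (N1 <= N)%N -> Lall P (U N) /\ Ex P (fun w => U N w ^+ 2) <= C / N%:R ^+ 2) ->
  {ae P, forall w, U N w @[N --> \oo] --> (0 : R)}.
Proof.
move=> U0 UC.
have : {ae P, forall w, U N w ^+ 2 @[N --> \oo] --> (0 : R)}.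
  apply: (@ae_cvg0 (fun N w => U N w ^+ 2) C N1) => [N w|N /UC[LU E]].
    exact: sqr_ge0.
  by split => //; exact: LallX.
apply: filterS => w h.
have -> : (fun N => U N w) = (fun N => Num.sqrt (U N w ^+ 2)).
  by apply/funext => N; rewrite sqrtr_sqr ger0_norm.
rewrite -(sqrtr0 R); apply: (cvg_comp (fun N => U N w ^+ 2) Num.sqrt h).
exact: sqrt_continuous.
Qed.
End AlmostSure.

(** * Deterministic comparison of Q with its equivalent *)

Section Compare.
Variable R : realType.
Local Notation C := R[i].

Lemma nqD4 (a b c d : C) : nq (a + b + c + d) <= 4 * (nq a + nq b + nq c + nq d).
Proof.
rewrite -addrA; apply: le_trans (nqD _ _) _.
have := nqD a b; have := nqD c d; lra.
Qed.

Lemma nq_mulmx11 n (u : 'rV[C]_n) (v : 'cV[C]_n) : nq ((u *m v) 0 0) <= fro2 u * fro2 v.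
Proof. exact: le_trans (fro2_entry _ _ _) (fro2M _ _). Qed.

Lemma fro2_Cmx_col n (a : 'cV[R]_n) : fro2 (Cmx a) = sqn a.
Proof. by rewrite fro2_Cmx; apply: eq_bigr => i _; rewrite big_ord1. Qed.

(** The isotropic estimates concern real vectors, while Qbar a / m is complex; its two parts are
    treated separately. *)
Definition Remx n (v : 'cV[C]_n) : 'cV[R]_n := map_mx (@complex.Re R) v.
Definition Immx n (v : 'cV[C]_n) : 'cV[R]_n := map_mx (@complex.Im R) v.

Lemma sqn_ReIm n (v : 'cV[C]_n) : sqn (Remx v) + sqn (Immx v) = fro2 v.
Proof.
rewrite /sqn -big_split; apply: eq_bigr => i _.
by rewrite big_ord1 !mxE.
Qed.

Lemma bil_ReIm n (Q : 'M[C]_n) (v : 'cV[C]_n) (b : 'cV[R]_n) :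
  nq ((v^T *m Q *m Cmx b) 0 0) <= 2 * nq (bil Q (Remx v) b) + 2 * nq (bil Q (Immx v) b).
Proof.
have e : v = Cmx (Remx v) + 'i *: Cmx (Immx v).
  apply/matrixP => i j; rewrite !mxE; case: (v i j) => x y.
  by apply/eqP; rewrite eq_complex /=; apply/andP; split; apply/eqP; ring.
have -> : (v^T *m Q *m Cmx b) 0 0 = bil Q (Remx v) b + 'i * bil Q (Immx v) b.
  rewrite {1}e /bil linearD /= linearZ /= !mulmxDl -!scalemxAl.
  by rewrite [LHS]mxE; congr (_ + _); rewrite mxE.
apply: le_trans (nqD _ _) _; rewrite nqM.
have -> : nq ('i : C) = 1 by rewrite /nq /= expr0n add0r expr1n.
by rewrite mul1r.
Qed.

Variables (n : nat) (M0 D E : 'M[R]_n) (z m : C).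
Hypothesis sM : M0^T = M0.
Hypothesis sD : D^T = D.
Hypothesis sE : E^T = E.
Hypothesis z0 : complex.Im z != 0.
Hypothesis hm : m ^+ 2 + z * m + 1 = 0.
Hypothesis zm : 0 < complex.Im z * complex.Im m.
Let Q0 : 'M[C]_n := invmx (Cmx M0 - z%:M).
Let Q : 'M[C]_n := invmx (Cmx (M0 + D + E) - z%:M).
Let Qb : 'M[C]_n := invmx (Cmx D + (m^-1)%:M).
Let y2 := complex.Im z ^+ 2.
Let t2 := complex.Im (m^-1) ^+ 2.

Lemma m_neq0 : m != 0.
Proof. by apply/eqP => m0; move: hm; rewrite m0; move/eqP; rewrite expr0n mulr0 !add0r oner_eq0. Qed.

Lemma Im_minv : complex.Im (m^-1) = - complex.Im m / nq m.
Proof. by case: (m) => x y; rewrite /= /nq /= mulNr. Qed.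

Let nqm0 : 0 < nq m. Proof. by rewrite lt_def nq_eq0 m_neq0 nq_ge0. Qed.

Lemma Im_minv_neq0 : complex.Im (m^-1) != 0.
Proof.
rewrite Im_minv mulf_eq0 negb_or invr_eq0 (gt_eqF nqm0) andbT oppr_eq0.
by apply/eqP => e; move: zm; rewrite e mulr0 ltxx.
Qed.

Let z1 : complex.Im (- m^-1) != 0.
Proof. by rewrite raddfN /= oppr_eq0 Im_minv_neq0. Qed.

(** Qbar is the resolvent of the signal matrix D at the non-real point - 1 / m, so the resolvent
    bounds hold for it with [t2] in the place of [y2]. *)
Let QbE : Qb = invmx (Cmx D - (- m^-1)%:M).
Proof. by rewrite raddfN opprK. Qed.

Let Im2N : complex.Im (- m^-1) ^+ 2 = t2.
Proof. by rewrite raddfN /= sqrrN. Qed.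

Let y2p : 0 < y2. Proof. by rewrite exprn_even_gt0. Qed.
Let t2p : 0 < t2. Proof. by rewrite exprn_even_gt0// Im_minv_neq0. Qed.

Let sMDE : (M0 + D + E)^T = M0 + D + E.
Proof. by rewrite !linearD /= sM sD sE. Qed.

Let U0 : Cmx M0 - z%:M \in unitmx. Proof. exact: resolvent_unit. Qed.
Let U : Cmx (M0 + D + E) - z%:M \in unitmx. Proof. exact: resolvent_unit. Qed.
Let Ub : Cmx D + (m^-1)%:M \in unitmx.
Proof. by have := resolvent_unit sD z1; rewrite raddfN opprK. Qed.

Lemma resolvent_diff : Q - Q0 = - (Q0 *m Cmx (D + E) *m Q).
Proof.
have -> : Cmx (D + E) = (Cmx (M0 + D + E) - z%:M) - (Cmx M0 - z%:M).
  rewrite !CmxD; move: (Cmx M0) (Cmx D) (Cmx E) (z%:M) => a b c e.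
  by apply/matrixP => i j; rewrite !mxE; ring.
by rewrite mulmxBr mulVmx// mulmxBl mul1mx -mulmxA mulmxV// mulmx1 opprB.
Qed.

(* The error only involves Q0 - m between deterministic vectors (a and the
   columns of D), and the small matrix E. *)
Lemma equiv_diff : Q - Qb =
  m^-1 *: (Qb *m ((Q0 - m%:M) *m (1%:M - Cmx D *m Q) - Q0 *m Cmx E *m Q)).
Proof.
have -> : (Q0 - m%:M) *m (1%:M - Cmx D *m Q) - Q0 *m Cmx E *m Q =
    m *: ((Cmx D + (m^-1)%:M) *m Q - 1%:M).
  have -> : (Q0 - m%:M) *m (1%:M - Cmx D *m Q) - Q0 *m Cmx E *m Q =
     Q0 - Q0 *m Cmx (D + E) *m Q - m%:M + m *: (Cmx D *m Q).
    rewrite mulmxBl !mulmxBr !mulmx1 mul_scalar_mx mulmxA CmxD mulmxDr mulmxDl.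
    move: (Q0 *m Cmx D *m Q) (Q0 *m Cmx E *m Q) (m *: _) => x y w.
    by apply/matrixP => i j; rewrite !mxE; ring.
  rewrite -resolvent_diff.
  rewrite mulmxDl scalerBr scalerDr mul_scalar_mx scalerA divff ?m_neq0// scale1r scalemx1.
  move: (m *: _) => x; by apply/matrixP => i j; rewrite !mxE; ring.
rewrite -scalemxAr scalerA mulVf ?m_neq0// scale1r mulmxBr mulmx1 mulKmx//.
Qed.

Lemma const_diff : m%:M - Qb = m *: (Qb *m Cmx D).
Proof.
have -> : m%:M = m *: (Qb *m (Cmx D + (m^-1)%:M)) by rewrite mulVmx// scalemx1.
rewrite mulmxDr scalerDr mul_mx_scalar scalerA divff ?m_neq0// scale1r.
by rewrite addrK.
Qed.

Lemma fro2_resolvent_diff : fro2 (Q - Q0) <=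
  (2 * fro2 (Cmx D) + 2 * fro2 (Cmx E)) / y2 / y2.
Proof.
rewrite resolvent_diff fro2N; apply: le_trans (resolvent_bound_r sMDE z0 (Q0 *m Cmx (D + E))) _.
rewrite ler_wpM2r ?invr_ge0 ?(ltW y2p)//; apply: le_trans (resolvent_bound sM z0 _) _.
rewrite ler_wpM2r ?invr_ge0 ?(ltW y2p)// CmxD; exact: fro2D.
Qed.

Lemma fro2_const_diff : fro2 (m%:M - Qb) <= nq m * (fro2 (Cmx D) / t2).
Proof.
rewrite const_diff fro2Z ler_wpM2l ?nq_ge0// QbE -Im2N.
exact: resolvent_bound.
Qed.

(** The quadratic identity can be divided by its second factor: Im 1/m has the sign opposite to Im z
    and to Im m0, so m0 keeps a distance of at least |Im 1/m| from the other root 1/m. *)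
Lemma stieltjes_m : nq (stieltjes Q0 - m) <=
  nq (stieltjes Q0 - xstar z Q0) * ((2 * nq z + 2 * y2^-1) / t2).
Proof.
set mN := stieltjes Q0.
have e : (mN - m) * (mN - m^-1) = (mN - xstar z Q0) * (z + mN).
  rewrite mulrBl /xstar opprK mulrDl mulVf ?zst_neq0//.
  have em : z = - m - m^-1.
    apply: (mulIf m_neq0); rewrite mulrBl mulVf ?m_neq0//.
    by apply/eqP; rewrite -subr_eq0 -hm; apply/eqP; ring.
  by rewrite em; field; rewrite m_neq0.
have Imm : t2 <= nq (mN - m^-1).
  apply: le_trans (Im2_le_nq _).
  have -> : complex.Im (mN - m^-1) = complex.Im mN - complex.Im m^-1.
    by rewrite raddfB.
  rewrite /t2 sqrrB -subr_ge0.
  have : complex.Im mN * complex.Im m^-1 <= 0.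
    rewrite /mN Im_stieltjes// Im_minv mulrACA [_ * - _]mulrN mulNr oppr_le0.
    rewrite mulr_ge0 ?(ltW zm)// mulr_ge0 ?invr_ge0 ?(ltW nqm0)// divr_ge0//.
    exact: fro2_ge0.
  have := sqr_ge0 (complex.Im mN); lra.
rewrite mulrA ler_pdivlMr//.
apply: le_trans (ler_wpM2l (nq_ge0 _) Imm) _.
rewrite -nqM e nqM ler_wpM2l ?nq_ge0//.
apply: le_trans (nqD _ _) _; rewrite lerD2l ler_wpM2l//.
exact: nq_stieltjes.
Qed.

Definition cst_m : R := 2 + 2 * ((2 * nq z + 2 * y2^-1) / t2).

Lemma xstar_m : nq (xstar z Q0 - m) <= cst_m * nq (stieltjes Q0 - xstar z Q0).
Proof.
have -> : xstar z Q0 - m = (stieltjes Q0 - m) - (stieltjes Q0 - xstar z Q0) by ring.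
apply: le_trans (nqB _ _) _; have := stieltjes_m; rewrite /cst_m; lra.
Qed.

Let Qr := Q0 - (xstar z Q0)%:M.

Variables a b : 'cV[R]_n.
Let av : 'cV[C]_n := m^-1 *: (Qb *m Cmx a).
Let Fa : R := nq m^-1 * (sqn a / t2).

Lemma fro2_av : fro2 av <= Fa.
Proof.
by rewrite fro2Z ler_wpM2l ?nq_ge0// -fro2_Cmx_col QbE -Im2N; exact: resolvent_bound.
Qed.

(** Applies [equiv_diff] with the left vector av = Qbar a / m. The four terms are: the deviation
    tested on b, the deviation tested on the columns of D, the scalar error [xstar] - m, and the
    cross matrix E. *)
Lemma bil_compare :
  nq (bil (Q - Qb) a b) <=
  4 * ((2 * nq (dev z Q0 (Remx av) b) + 2 * nq (dev z Q0 (Immx av) b)) +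
  sqn b / y2 * (2 * (\sum_k nq (dev z Q0 (Remx av) (col k D))) +
                2 * (\sum_k nq (dev z Q0 (Immx av) (col k D)))) +
  nq (xstar z Q0 - m) * (Fa * (2 * sqn b + 2 * (fro2 (Cmx D) * (sqn b / y2)))) +
  Fa * (fro2 (Cmx E) * (sqn b / y2) / y2)).
Proof.
pose u := Q *m Cmx b.
have sQb : Qb^T = Qb by rewrite QbE; exact: resolvent_tr.
have fu : fro2 u <= sqn b / y2 by rewrite -fro2_Cmx_col; exact: resolvent_bound.
have fa := fro2_av.
have Fa0 : 0 <= Fa by exact: le_trans (fro2_ge0 _) fa.
have fb0 : 0 <= sqn b / y2 by exact: le_trans (fro2_ge0 _) fu.
pose T1 := (av^T *m Qr *m Cmx b) 0 0.
pose T2 := (av^T *m Qr *m (Cmx D *m u)) 0 0.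
pose T3 := (xstar z Q0 - m) * (av^T *m (Cmx b - Cmx D *m u)) 0 0.
pose T4 := (av^T *m (Q0 *m (Cmx E *m u))) 0 0.
have -> : bil (Q - Qb) a b = T1 + - T2 + T3 + - T4.
  have -> : bil (Q - Qb) a b = (av^T *m ((Q0 - m%:M) *m (Cmx b - Cmx D *m u) - Q0 *m (Cmx E *m u))) 0 0.
    have -> : av^T = m^-1 *: ((Cmx a)^T *m Qb) by rewrite /av linearZ /= trmx_mul sQb.
    rewrite /bil equiv_diff -!scalemxAl -scalemxAr -scalemxAl.
    congr (fun_of_matrix (_ *: _) _ _); rewrite -!mulmxA; congr (_ *m (_ *m _)).
    by rewrite mulmxBl -!mulmxA [(1%:M - _) *m _]mulmxBl mul1mx -!mulmxA.
  have -> : Q0 - m%:M = Qr + (xstar z Q0 - m)%:M.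
    by rewrite /Qr raddfB /= addrA subrK.
  have eD (A B : 'M[C]_1) : (A + B) 0 0 = A 0 0 + B 0 0 by rewrite mxE.
  have eN (A : 'M[C]_1) : (- A) 0 0 = - A 0 0 by rewrite mxE.
  have eZ t (A : 'M[C]_1) : (t *: A) 0 0 = t * A 0 0 by rewrite mxE.
  have -> : T1 + - T2 = (av^T *m (Qr *m (Cmx b - Cmx D *m u))) 0 0.
    by rewrite !mulmxBr eD eN !mulmxA /T2 !mulmxA.
  by rewrite mulmxBr mulmxDl mulmxDr mul_scalar_mx -scalemxAr !eD eN eZ.
apply: le_trans (nqD4 _ _ _ _) _; rewrite !nqN ler_wpM2l//.
do 3 ?[apply: lerD].
- by apply: le_trans (bil_ReIm _ _ _) _; rewrite -!dev_bil.
(* u = Q b is random; Cauchy-Schwarz over the columns of D separates it from deviations between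
   deterministic vectors. *)
- have -> : T2 = \sum_k u k 0 * (av^T *m Qr *m Cmx (col k D)) 0 0.
    rewrite /T2 mulmxA mxE; apply: eq_bigr => k _; rewrite mulrC; congr (_ * _).
    rewrite !mxE; apply: eq_bigr => j _; congr (_ * _); by rewrite !mxE.
  apply: le_trans (nq_sumCS _ _ _ _) _.
  have -> : \sum_k nq (u k 0) = fro2 u by apply: eq_bigr => k _; rewrite big_ord1.
  apply: ler_pM => //; first exact: fro2_ge0.
    by apply: sumr_ge0 => k _; exact: nq_ge0.
  rewrite !mulr_sumr -big_split; apply: ler_sum => k _.
  by apply: le_trans (bil_ReIm _ _ _) _; rewrite -!dev_bil.
- rewrite nqM ler_wpM2l ?nq_ge0//; apply: le_trans (nq_mulmx11 _ _) _; rewrite fro2_tr.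
  apply: ler_pM => //; rewrite ?fro2_ge0//.
  apply: le_trans (fro2B _ _) _; rewrite fro2_Cmx_col lerD2l ler_wpM2l//.
  by apply: le_trans (fro2M _ _) _; rewrite ler_wpM2l ?fro2_ge0.
apply: le_trans (nq_mulmx11 _ _) _; rewrite fro2_tr.
apply: ler_pM => //; rewrite ?fro2_ge0//.
apply: le_trans (resolvent_bound sM z0 _) _; rewrite ler_wpM2r ?invr_ge0 ?(ltW y2p)//.
by apply: le_trans (fro2M _ _) _; rewrite ler_wpM2l ?fro2_ge0.
Qed.

Hypothesis n0 : (0 < n)%N.
Let np : 0 < n%:R :> R. Proof. by rewrite ltr0n. Qed.

(** With |A|_F^2 <= n K2, a matrix B of bounded Frobenius norm contributes O(1/n) to the square of
    the normalised trace. *)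
Lemma nq_ntr (A : 'M[R]_n) (B : 'M[C]_n) (K2 : R) : fro2 (Cmx A) <= n%:R * K2 ->
  nq (toC n%:R^-1 * \tr (Cmx A *m B)) <= K2 / n%:R * fro2 B.
Proof.
move=> hA; rewrite nqM nq_toC.
have -> : K2 / n%:R * fro2 B = n%:R^-1 ^+ 2 * (n%:R * K2 * fro2 B) by field; rewrite gt_eqF.
rewrite ler_wpM2l ?sqr_ge0//; apply: le_trans (nq_trM _ _) _.
by rewrite ler_wpM2r ?fro2_ge0.
Qed.

(** Q - Qbar is cut into Q0 - x, x - m, Q - Q0 and m - Qbar. The last two are bounded in Frobenius
    norm by D and E, hence negligible after division by n. *)
Lemma trace_compare (A : 'M[R]_n) (K2 : R) : fro2 (Cmx A) <= n%:R * K2 ->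
  nq (toC n%:R^-1 * \tr (Cmx A *m (Q - Qb))) <=
  4 * (nq (toC n%:R^-1 * \tr (Cmx A *m Qr)) +
  nq (xstar z Q0 - m) * K2 +
  K2 / n%:R * ((2 * fro2 (Cmx D) + 2 * fro2 (Cmx E)) / y2 / y2) +
  K2 / n%:R * (nq m * (fro2 (Cmx D) / t2))).
Proof.
move=> hA.
have K20 : 0 <= K2 / n%:R.
  rewrite divr_ge0 ?(ltW np)//; have := le_trans (fro2_ge0 _) hA; by rewrite pmulr_rge0.
have -> : Q - Qb = Qr + (xstar z Q0 - m)%:M + (Q - Q0) + (m%:M - Qb).
  rewrite /Qr raddfB /=; move: (Q) (Q0) (Qb) (m%:M) (xstar _ _)%:M => q1 q2 q3 q4 q5.
  by apply/matrixP => i j; rewrite !mxE; ring.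
have d4 (x y w v : 'M[C]_n) : toC n%:R^-1 * \tr (Cmx A *m (x + y + w + v)) =
   toC n%:R^-1 * \tr (Cmx A *m x) + toC n%:R^-1 * \tr (Cmx A *m y) +
   toC n%:R^-1 * \tr (Cmx A *m w) + toC n%:R^-1 * \tr (Cmx A *m v).
  by rewrite !mulmxDr !linearD /= !mulrDr.
rewrite d4; apply: le_trans (nqD4 _ _ _ _) _.
rewrite ler_wpM2l//; do 3 ?[apply: lerD] => //.
- apply: le_trans (nq_ntr _ hA) _; rewrite fro2_scalar.
  by rewrite [leLHS](_ : _ = nq (xstar z Q0 - m) * K2)//; field; rewrite gt_eqF.
- by apply: le_trans (nq_ntr _ hA) _; rewrite ler_wpM2l// fro2_resolvent_diff.
by apply: le_trans (nq_ntr _ hA) _; rewrite ler_wpM2l// fro2_const_diff.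
Qed.

Lemma stieltjes_compare : nq (stieltjes Q - m) <=
  2 * (n%:R^-1 * ((2 * fro2 (Cmx D) + 2 * fro2 (Cmx E)) / y2 / y2)) +
  2 * (cst_m * nq (stieltjes Q0 - xstar z Q0)).
Proof.
have -> : stieltjes Q - m = toC n%:R^-1 * \tr (Cmx 1%:M *m (Q - Q0)) + (stieltjes Q0 - m).
  by rewrite Cmx_scalar mul1mx linearB /= mulrBr addrA subrK.
apply: le_trans (nqD _ _) _; apply: lerD; rewrite ler_wpM2l//.
  apply: le_trans (nq_ntr (K2 := 1) _ _) _; first by rewrite Cmx_scalar fro2_scalar nq1.
  by rewrite mul1r ler_wpM2l ?invr_ge0 ?(ltW np)// fro2_resolvent_diff.
have h := stieltjes_m; have h0 := le_trans (nq_ge0 _) h.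
have := nq_ge0 (stieltjes Q0 - xstar z Q0); rewrite /cst_m; lra.
Qed.

Lemma stieltjes_dev : stieltjes Q0 - xstar z Q0 =
  toC n%:R^-1 * \tr (Cmx 1%:M *m (Q0 - (xstar z Q0)%:M)).
Proof.
rewrite Cmx_scalar mul1mx linearB /= mulrBr mxtrace_scalar; congr (_ - _).
rewrite -[x in _ * x]mulr_natl mulrA -(toC_nat R n) -toCM mulVf ?gt_eqF//.
by rewrite -[toC 1]/(1 : C) mul1r.
Qed.

End Compare.

(** * Real sequences tending to 0 *)

Section NullSequences.
Variable R : realType.
Implicit Types u v : nat -> R.

Definition null u := u N @[N --> \oo] --> (0 : R).

Lemma nullD u v : null u -> null v -> null (fun N => u N + v N).
Proof. by move=> hu hv; have := cvgD hu hv; rewrite addr0; apply. Qed.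

Lemma nullZ u (c : R) : null u -> null (fun N => c * u N).
Proof. by move=> hu; have := cvgM (cvg_cst c) hu; rewrite mulr0; apply. Qed.

Lemma null_le u v N1 : (forall N, 0 <= u N) -> (forall N, (N1 <= N)%N -> u N <= v N) ->
  null v -> null u.
Proof.
move=> u0 uv; apply: squeeze_cvgr; last exact: cvg_cst.
by exists N1 => // N /= NN; rewrite u0 uv.
Qed.

Lemma null_inv : null (fun N => N%:R^-1).
Proof.
apply: (@null_le _ (fun N => 2 * @harmonic R N) 1) => [N|N N1|].
- by rewrite invr_ge0.
- rewrite /harmonic /= ler_pdivlMr ?ltr0n// mulrC ler_pdivrMr ?ltr0n//.
  by rewrite -natrM ler_nat mul2n -addnn -addn1 leq_add2l.
exact: nullZ (@cvg_harmonic R).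
Qed.
End NullSequences.

(** * Almost sure limits for a sequence of signal-plus-noise matrices *)

Section Sequence.
Context (R : realType) (d0 : measure_display) (Omega : measurableType d0).
Variable P : probability Omega R.
Local Notation C := R[i].
Variables (n p : nat -> nat) (Pm : forall N, 'M[R]_(n N, p N)).
Variables (X : forall N, 'I_(n N) * 'I_(p N) -> Omega -> R).
Local Arguments X : clear implicits.
Variables (sg : nat -> R) (K M : R) (N1 : nat).
Variables (z m : C).
Hypothesis gX : forall N, gfam P (X N).
Hypothesis N1_gt0 : (0 < N1)%N.
Hypothesis n_gt0 : forall N, (N1 <= N)%N -> (0 < n N)%N.
Hypothesis sg_gt0 : forall N, (N1 <= N)%N -> 0 < sg N.
Hypothesis sgE : forall N, (N1 <= N)%N -> (sg N * N%:R) ^+ 2 = (n N)%:R * (p N)%:R.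
Hypothesis nK : forall N, (N1 <= N)%N -> (n N)%:R ^+ 2 <= K * (p N)%:R.
Hypothesis NK : forall N, (N1 <= N)%N -> N%:R <= K * (n N)%:R.
Hypothesis PM : forall N, (N1 <= N)%N -> \sum_i \sum_j Pm N i j ^+ 2 <= M * sg N.
Hypothesis K0 : 0 <= K.
Hypothesis M0 : 0 <= M.
Hypothesis z0 : complex.Im z != 0.
Hypothesis hm : m ^+ 2 + z * m + 1 = 0.
Hypothesis zm : 0 < complex.Im z * complex.Im m.

Let s N := (sg N * N%:R)^-1.
Let G N w := gramc (s N) (Wmx (X N) w).
Let D N := (sg N)^-1 *: (Pm N *m (Pm N)^T).
Let E N w := ((sg N)^-1 * (Num.sqrt N%:R)^-1) *:
   (Pm N *m (Wmx (X N) w)^T + (Pm N *m (Wmx (X N) w)^T)^T).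
Let Tm N w := Pm N + (Num.sqrt N%:R)^-1 *: Wmx (X N) w.
Let S N w := (sg N)^-1 *: (Tm N w *m (Tm N w)^T - (N%:R^-1 * (p N)%:R)%:M).
Let Q N w := invmx (Cmx (S N w) - z%:M).
Let Q0 N w := invmx (Cmx (G N w) - z%:M).
Let Qb N := invmx (Cmx (D N) + (m^-1)%:M).
Let y2 := complex.Im z ^+ 2.
Let t2 := complex.Im (m^-1) ^+ 2.

Let N_gt0 N : (N1 <= N)%N -> 0 < N%:R :> R.
Proof. by move=> NN; rewrite ltr0n (leq_trans N1_gt0). Qed.
Let np N : (N1 <= N)%N -> 0 < (n N)%:R :> R.
Proof. by move=> NN; rewrite ltr0n n_gt0. Qed.

Let hs N : (N1 <= N)%N -> s N ^+ 2 * ((n N)%:R * (p N)%:R) = 1.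
Proof.
move=> NN; rewrite -sgE// /s exprVn mulVf// expf_neq0// mulf_neq0// gt_eqF//.
  exact: sg_gt0.
exact: N_gt0.
Qed.

Let SE N w : (N1 <= N)%N -> S N w = G N w + D N + E N w.
Proof.
move=> NN; rewrite /S /G /D /E /Tm /gramc.
have sN : (Num.sqrt N%:R)^-1 * (Num.sqrt N%:R)^-1 = N%:R^-1 :> R.
  by rewrite -invfM -expr2 sqr_sqrtr// ltW// N_gt0.
rewrite [(_ + _)^T]linearD /= [(_ *: _)^T]linearZ /= !mulmxDl !mulmxDr -!scalemxAl -!scalemxAr scalerA sN.
rewrite trmx_mul trmxK /s invfM -[N%:R^-1 * (p N)%:R]/((N%:R^-1 : R) * (p N)%:R) -scale_scalar_mx.
move: (_ *m _) (_ *m _) (_ *m _) (_ *m _) (_%:M) => a b c e f.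
by apply/matrixP => i j; rewrite !mxE; ring.
Qed.

Let symG N w : (G N w)^T = G N w. Proof. exact: gramc_sym. Qed.
Let symD N : (D N)^T = D N.
Proof. by rewrite /D linearZ /= trmx_mul trmxK. Qed.
Let symE N w : (E N w)^T = E N w.
Proof. by rewrite /E linearZ /= linearD /= trmxK addrC. Qed.

(** |Pm Pm^T|_F <= |Pm|_F^2 <= M sg: this is where the bound on the signal-to-sigma ratio acts. *)
Let fD N : (N1 <= N)%N -> fro2 (Cmx (D N)) <= M ^+ 2.
Proof.
move=> NN; have sp := sg_gt0 NN.
rewrite /D CmxZ fro2Z nq_toC CmxM; apply: le_trans (ler_wpM2l (sqr_ge0 _) (fro2M _ _)) _.
rewrite -CmxT fro2_tr -expr2 -exprMn lerXn2r ?nnegrE// ?mulr_ge0 ?fro2_ge0 ?invr_ge0 ?(ltW sp)//.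
by rewrite mulrC ler_pdivrMr// fro2_Cmx PM.
Qed.

Let S2 N w := \sum_i \sum_j (Pm N *m (Wmx (X N) w)^T) i j ^+ 2.
Let VE N w := 4 * (sg N ^+ 2 * N%:R)^-1 * S2 N w.

Let S2_ge0 N w : 0 <= S2 N w.
Proof. by apply: sumr_ge0 => i _; apply: sumr_ge0 => j _; exact: sqr_ge0. Qed.

Let VE_ge0 N w : 0 <= VE N w.
Proof. by rewrite mulr_ge0// mulr_ge0// invr_ge0 mulr_ge0// sqr_ge0. Qed.

Let fE N w : (N1 <= N)%N -> fro2 (Cmx (E N w)) <= VE N w.
Proof.
move=> NN; rewrite /E CmxZ fro2Z nq_toC CmxD -CmxT /VE.
have -> : ((sg N)^-1 * (Num.sqrt N%:R)^-1) ^+ 2 = (sg N ^+ 2 * N%:R)^-1.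
  by rewrite -invfM exprVn exprMn sqr_sqrtr// ltW// N_gt0.
have q0 : 0 <= (sg N ^+ 2 * N%:R)^-1 by rewrite invr_ge0 mulr_ge0// sqr_ge0.
rewrite [leRHS]mulrAC [leRHS]mulrC ler_wpM2l//.
apply: le_trans (fro2D _ _) _; rewrite fro2_tr fro2_Cmx -/(S2 N w); lra.
Qed.

(** [VE] is of order n / (sg N), whose square is n / p <= K^2 / N. Its fourth moment is therefore
    O(N^-2), and [VE]^2 fits the criterion on second moments. *)
Let nullE : {ae P, forall w, null (fun N => VE N w)}.
Proof.
have : {ae P, forall w, null (fun N => VE N w ^+ 2)}.
  apply: (@ae_cvg0_sqr _ _ _ P (fun N w => VE N w ^+ 2)
     ((4 * (gmom R 8 + 1) * M) ^+ 4 * K ^+ 4) N1) => [N w|N NN]; first exact: sqr_ge0.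
  have [LS ES] := cross_moment (gX N) (Pm N).
  have sp := sg_gt0 NN; have Np := N_gt0 NN; have nN := np NN.
  have LV : Lall P (VE N) by apply: LallM => //; exact: Lall_cst.
  split; first exact: LallX.
  pose q := 4 * (sg N ^+ 2 * N%:R)^-1.
  have q0 : 0 <= q by rewrite mulr_ge0// invr_ge0 mulr_ge0// sqr_ge0.
  have -> : (fun w => (VE N w ^+ 2) ^+ 2) = (fun w => q ^+ 4 * (S2 N w ^+ 2) ^+ 2).
    by apply/funext => w; rewrite /VE -/q; ring.
  rewrite ExZ; last by do 2 apply: LallX.
  apply: le_trans (ler_wpM2l (exprn_ge0 _ q0) ES) _; rewrite -exprMn.
  have g8 := gmom_ge0 R 8.
  set f := \sum_i _; have f0 : 0 <= f.
    by apply: sumr_ge0 => i _; apply: sumr_ge0 => j _; exact: sqr_ge0.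
  have fM : f <= M * sg N by exact: PM.
  pose g := gmom R 8 + 1; have g0 : 0 <= g by rewrite /g addr_ge0.
  have h1 : q * ((n N)%:R * g * f) <= 4 * g * M * ((n N)%:R / (sg N * N%:R)).
    rewrite /q.
    have -> : 4 * g * M * ((n N)%:R / (sg N * N%:R)) =
       4 * (sg N ^+ 2 * N%:R)^-1 * ((n N)%:R * g * (M * sg N)).
      by field; rewrite !gt_eqF.
    by rewrite ler_wpM2l// ler_wpM2l// mulr_ge0// ltW.
  have h2 : ((n N)%:R / (sg N * N%:R)) ^+ 2 <= K ^+ 2 / N%:R.
    rewrite exprMn exprVn sgE// invfM mulrA expr2 mulfK ?gt_eqF//.
    have pN : 0 < (p N)%:R :> R.
      rewrite lt_def ler0n andbT; apply/eqP => p0.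
      have := sgE NN; rewrite p0 mulr0 => /eqP; rewrite expf_eq0/= mulf_eq0.
      by rewrite !gt_eqF.
    rewrite ler_pdivrMr// mulrAC ler_pdivlMr//.
    apply: le_trans (ler_wpM2l (ltW nN) (NK NN)) _.
    have -> : (n N)%:R * (K * (n N)%:R) = K * (n N)%:R ^+ 2 by ring.
    by rewrite [K ^+ 2]expr2 -mulrA ler_wpM2l// nK.
  have h3 : (q * ((n N)%:R * g * f)) ^+ 4 <= (4 * g * M * ((n N)%:R / (sg N * N%:R))) ^+ 4.
    rewrite lerXn2r ?nnegrE//.
      by rewrite mulr_ge0// mulr_ge0// mulr_ge0// ltW.
    by apply: le_trans h1; rewrite mulr_ge0// mulr_ge0// mulr_ge0// ltW.
  apply: le_trans h3 _; rewrite exprMn -/g -[leRHS]mulrA ler_wpM2l ?exprn_even_ge0//.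
  rewrite (exprM _ 2 2); apply: (le_trans (y := (K ^+ 2 / N%:R) ^+ 2)).
    by rewrite lerXn2r ?nnegrE ?sqr_ge0 ?divr_ge0 ?sqr_ge0.
  by rewrite exprMn exprVn -exprM.
apply: filterS => w h.
rewrite (_ : (fun N => VE N w) = (fun N => Num.sqrt (VE N w ^+ 2))).
  rewrite /null -(sqrtr0 R); apply: (cvg_comp (fun N => VE N w ^+ 2) Num.sqrt h).
  exact: sqrt_continuous.
by apply/funext => N; rewrite sqrtr_sqr ger0_norm.
Qed.

(** Passes from the rate 1/n to the summable rate 1/N by N <= K n. *)
Let rateN N c : (N1 <= N)%N -> 0 <= c ->
  (c * (rate K z / (n N)%:R)) ^+ 2 <= (c * (rate K z * K)) ^+ 2 / N%:R ^+ 2.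
Proof.
move=> NN c0; have nN := np NN; have Np := N_gt0 NN; have r0 := rate_ge0 K z.
rewrite -exprVn -exprMn lerXn2r ?nnegrE ?mulr_ge0 ?divr_ge0 ?invr_ge0 ?(ltW nN) ?(ltW Np)//.
move: (rate K z) r0 => r r0; rewrite -!mulrA ler_wpM2l// ler_wpM2l// ler_pdivlMr// ler_pdivrMl// mulrC; exact: NK.
Qed.

Let null_dev (a b : forall N, 'cV[R]_(n N)) (ca cb : R) :
  (forall N, (N1 <= N)%N -> sqn (a N) <= ca) -> (forall N, (N1 <= N)%N -> sqn (b N) <= cb) ->
  {ae P, forall w, null (fun N => nq (dev z (Q0 N w) (a N) (b N)))}.
Proof.
move=> ha hb; apply: (@ae_cvg0_sqr _ _ _ P (fun N w => nq (dev z (Q0 N w) (a N) (b N)))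
  ((ca * cb * (rate K z * K)) ^+ 2) N1) => [N w|N NN]; first exact: nq_ge0.
split; first exact: Lall_dev.
have ca0 := le_trans (sqn_ge0 _) (ha N NN); have cb0 := le_trans (sqn_ge0 _) (hb N NN).
apply: le_trans (dev_moment_rate z0 (gX N) (n_gt0 NN) (hs NN) (nK NN) _ _) _.
apply: le_trans (rateN NN (mulr_ge0 ca0 cb0)).
have r0 := rate_ge0 K z.
rewrite lerXn2r ?nnegrE ?mulr_ge0 ?sqn_ge0 ?divr_ge0//.
by rewrite ler_wpM2r ?divr_ge0// ler_pM ?sqn_ge0 ?ha ?hb.
Qed.

Let null_rows (a : forall N, 'cV[R]_(n N)) (ca : R) :
  (forall N, (N1 <= N)%N -> sqn (a N) <= ca) ->
  {ae P, forall w, null (fun N => \sum_k nq (dev z (Q0 N w) (a N) (col k (D N))))}.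
Proof.
move=> ha; apply: (@ae_cvg0_sqr _ _ _ P
  (fun N w => \sum_k nq (dev z (Q0 N w) (a N) (col k (D N))))
  ((ca * M ^+ 2 * (rate K z * K)) ^+ 2) N1) => [N w|N NN].
  by apply: sumr_ge0 => k _; exact: nq_ge0.
split; first by apply: Lall_sum => k; exact: Lall_dev.
have ca0 := le_trans (sqn_ge0 _) (ha N NN).
apply: le_trans (dev_rows_moment z0 (gX N) (n_gt0 NN) (hs NN) (nK NN) _ _) _.
apply: le_trans (rateN NN (mulr_ge0 ca0 (sqr_ge0 M))).
have r0 := rate_ge0 K z.
have q0 : 0 <= \sum_i sqn (col i (D N)) by apply: sumr_ge0 => i _; exact: sqn_ge0.
rewrite lerXn2r ?nnegrE ?mulr_ge0 ?sqn_ge0 ?divr_ge0 ?sqr_ge0//.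
rewrite ler_wpM2r ?divr_ge0// ler_pM ?sqn_ge0 ?ha//.
apply: le_trans (fD NN); rewrite fro2_col le_eqVlt; apply/orP; left; apply/eqP.
by apply: eq_bigr => i _; rewrite -fro2_Cmx_col /Cmx map_col.
Qed.

Let null_tdev (A : forall N, 'M[R]_(n N)) (K2 : R) :
  (forall N i, (N1 <= N)%N -> sqn (col i (A N)) <= K2) ->
  {ae P, forall w, null (fun N => nq (toC (n N)%:R^-1 *
     \tr (Cmx (A N) *m (Q0 N w - (xstar z (Q0 N w))%:M))))}.
Proof.
move=> hA; apply: (@ae_cvg0_sqr _ _ _ P (fun N w => nq (tdev (X N) (s N) z w (A N)))
  ((K2 * (rate K z * K)) ^+ 2) N1) => [N w|N NN]; first exact: nq_ge0.
split; first by apply: Lall_tdev => //; exact: n_gt0.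
have K20 : 0 <= K2 by apply: le_trans (hA N (Ordinal (n_gt0 NN)) NN); exact: sqn_ge0.
apply: le_trans (tdev_moment z0 (gX N) (n_gt0 NN) (hs NN) (nK NN) _) (rateN NN K20).
by move=> i; exact: hA.
Qed.

Let null_stieltjes : {ae P, forall w,
  null (fun N => nq (stieltjes (Q0 N w) - xstar z (Q0 N w)))}.
Proof.
have : {ae P, forall w, null (fun N => nq (toC (n N)%:R^-1 *
     \tr (Cmx (1%:M : 'M[R]_(n N)) *m (Q0 N w - (xstar z (Q0 N w))%:M))))}.
  apply: (@null_tdev (fun N => 1%:M) 1) => N i NN.
  rewrite /sqn (bigD1 i)//= big1 ?addr0 ?mxE ?eqxx ?expr1n// => j ji.
  by rewrite !mxE (negbTE ji) expr0n.
apply: filterS => w; apply: (@null_le _ _ _ N1) => [N|N NN]; first exact: nq_ge0.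
by rewrite -stieltjes_dev// n_gt0.
Qed.

Let y2p : 0 < y2. Proof. by rewrite exprn_even_gt0. Qed.
Let t2p : 0 < t2. Proof. by rewrite exprn_even_gt0// (Im_minv_neq0 hm zm). Qed.

Let inv_n N : (N1 <= N)%N -> (n N)%:R^-1 <= K * N%:R^-1.
Proof.
move=> NN; rewrite -ler_pdivrMr ?invr_gt0 ?N_gt0// invrK mulrC ler_pdivrMr ?np//; exact: NK.
Qed.

Let small N w : (N1 <= N)%N ->
  (n N)%:R^-1 * ((2 * fro2 (Cmx (D N)) + 2 * fro2 (Cmx (E N w))) / y2 / y2) <=
  (2 * M ^+ 2 / y2 / y2 * K) * N%:R^-1 + (2 / y2 / y2) * VE N w.
Proof.
move=> NN; have hD := fD NN; have hE := fE w NN.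
have i0 : 0 <= (n N)%:R^-1 :> R by rewrite invr_ge0.
have i1 : (n N)%:R^-1 <= 1 :> R by rewrite invf_le1 ?np// ler1n n_gt0.
have iy : 0 <= y2^-1 by rewrite invr_ge0 ltW.
have -> : (n N)%:R^-1 * ((2 * fro2 (Cmx (D N)) + 2 * fro2 (Cmx (E N w))) / y2 / y2) =
  2 * fro2 (Cmx (D N)) / y2 / y2 * (n N)%:R^-1 + (2 / y2 / y2) * (fro2 (Cmx (E N w)) * (n N)%:R^-1).
  by ring.
apply: lerD.
  rewrite -[leRHS]mulrA; apply: ler_pM => //; last exact: inv_n.
    by rewrite !mulr_ge0// fro2_ge0.
  by do 2 rewrite ler_wpM2r//; rewrite ler_wpM2l.
rewrite ler_wpM2l ?mulr_ge0//; apply: le_trans hE.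
by rewrite -[leRHS]mulr1 ler_wpM2l// fro2_ge0.
Qed.

Lemma seq_stieltjes : {ae P, forall w, null (fun N => nq (stieltjes (Q N w) - m))}.
Proof.
apply: filterS2 nullE null_stieltjes => w hE hs0.
pose v N := 2 * ((2 * M ^+ 2 / y2 / y2 * K) * N%:R^-1 + (2 / y2 / y2) * VE N w) +
   2 * (cst_m z m * nq (stieltjes (Q0 N w) - xstar z (Q0 N w))).
apply: (@null_le _ _ v N1) => [N|N NN|]; first exact: nq_ge0.
  rewrite /Q SE//; apply: le_trans (stieltjes_compare _ _ _ z0 hm zm (n_gt0 NN)) _ => //.
  by rewrite lerD2r ler_wpM2l//; exact: small.
apply: nullD; apply: nullZ; last exact: nullZ.
by apply: nullD; apply: nullZ => //; exact: null_inv.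
Qed.

Lemma seq_trace (A : forall N, 'M[R]_(n N)) (K2 : R) :
  (forall N i, (N1 <= N)%N -> sqn (col i (A N)) <= K2) -> 0 <= K2 ->
  {ae P, forall w, null (fun N => nq (toC (n N)%:R^-1 * \tr (Cmx (A N) *m (Q N w - Qb N))))}.
Proof.
move=> hA K20.
apply: filterS3 nullE null_stieltjes (null_tdev hA) => w hE hs0 ht.
pose v N := 4 * (nq (toC (n N)%:R^-1 * \tr (Cmx (A N) *m (Q0 N w - (xstar z (Q0 N w))%:M))) +
   K2 * (cst_m z m * nq (stieltjes (Q0 N w) - xstar z (Q0 N w))) +
   K2 * ((2 * M ^+ 2 / y2 / y2 * K) * N%:R^-1 + (2 / y2 / y2) * VE N w) +
   K2 * K * (nq m * (M ^+ 2 / t2)) * N%:R^-1).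
apply: (@null_le _ _ v N1) => [N|N NN|]; first exact: nq_ge0.
  have fA : fro2 (Cmx (A N)) <= (n N)%:R * K2.
    rewrite fro2_col; apply: (le_trans (y := \sum_(i < n N) K2)).
      by apply: ler_sum => i _; rewrite /Cmx -map_col -/(Cmx _) fro2_Cmx_col hA.
    by rewrite sumr_const card_ord mulr_natl.
  rewrite /Q SE//; apply: le_trans (trace_compare _ _ _ z0 hm zm (n_gt0 NN) fA) _ => //.
  rewrite /v ler_wpM2l//; apply: lerD; first (apply: lerD; first apply: lerD) => //.
  - by rewrite mulrC ler_wpM2l//; exact: (xstar_m (symG N w) z0 hm zm).
  - by rewrite -mulrA ler_wpM2l//; exact: small.
  have -> : K2 * K * (nq m * (M ^+ 2 / t2)) * N%:R^-1 =
     K2 * (K * N%:R^-1) * (nq m * (M ^+ 2 / t2)) by ring.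
  apply: ler_pM.
  - by rewrite divr_ge0.
  - by rewrite mulr_ge0 ?nq_ge0// divr_ge0 ?fro2_ge0// ltW.
  - by rewrite ler_wpM2l// inv_n.
  by rewrite ler_wpM2l ?nq_ge0// ler_wpM2r ?invr_ge0 ?(ltW t2p)// fD.
apply: nullZ; do 3 ?[apply: nullD] => //.
- by do 2 apply: nullZ.
- by apply: nullZ; apply: nullD; apply: nullZ => //; exact: null_inv.
by apply: nullZ; exact: null_inv.
Qed.

Lemma seq_bil (a b : forall N, 'cV[R]_(n N)) (ca cb : R) :
  (forall N, (N1 <= N)%N -> sqn (a N) <= ca) -> (forall N, (N1 <= N)%N -> sqn (b N) <= cb) ->
  0 <= ca -> 0 <= cb ->
  {ae P, forall w, null (fun N => nq (bil (Q N w - Qb N) (a N) (b N)))}.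
Proof.
move=> ha hb ca0 cb0.
(* Deterministic and bounded along the sequence, so its real and imaginary parts are admissible in
   [null_dev] and [null_rows]. *)
pose av N := m^-1 *: (Qb N *m Cmx (a N)).
pose F := nq m^-1 * (ca / t2).
have F0 : 0 <= F by rewrite mulr_ge0 ?nq_ge0// divr_ge0// ltW.
have Fa N : (N1 <= N)%N -> nq m^-1 * (sqn (a N) / t2) <= F.
  by move=> NN; rewrite ler_wpM2l ?nq_ge0// ler_wpM2r ?invr_ge0 ?(ltW t2p)// ha.
have fa N : (N1 <= N)%N -> fro2 (av N) <= F.
  by move=> NN; apply: le_trans (fro2_av (symD N) hm zm _) (Fa N NN).
have h1 N : (N1 <= N)%N -> sqn (Remx (av N)) <= F.
  by move=> NN; apply: le_trans (fa N NN); rewrite -sqn_ReIm lerDl sqn_ge0.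
have h2 N : (N1 <= N)%N -> sqn (Immx (av N)) <= F.
  by move=> NN; apply: le_trans (fa N NN); rewrite -sqn_ReIm lerDr sqn_ge0.
move: nullE; apply: filter_app; move: null_stieltjes; apply: filter_app.
move: (null_rows h2); apply: filter_app; move: (null_rows h1); apply: filter_app.
apply: filterS2 (null_dev h1 hb) (null_dev h2 hb) => w d1 d2 r1 r2 hs0 hE.
pose v N := 4 * ((2 * nq (dev z (Q0 N w) (Remx (av N)) (b N)) +
                  2 * nq (dev z (Q0 N w) (Immx (av N)) (b N))) +
  cb / y2 * (2 * (\sum_k nq (dev z (Q0 N w) (Remx (av N)) (col k (D N)))) +
                2 * (\sum_k nq (dev z (Q0 N w) (Immx (av N)) (col k (D N))))) +
  (F * (2 * cb + 2 * (M ^+ 2 * (cb / y2)))) * (cst_m z m * nq (stieltjes (Q0 N w) - xstar z (Q0 N w))) +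
  (F * (cb / y2) / y2) * VE N w).
apply: (@null_le _ _ v N1) => [N|N NN|]; first exact: nq_ge0.
  rewrite /Q SE//; apply: le_trans (bil_compare _ _ _ z0 hm zm _ _) _ => //.
  have iy : 0 <= y2^-1 by rewrite invr_ge0 ltW.
  have b0 := sqn_ge0 (b N); have a0 := sqn_ge0 (a N).
  have bc : sqn (b N) / y2 <= cb / y2 by rewrite ler_wpM2r// hb.
  have Fa0 : 0 <= nq m^-1 * (sqn (a N) / t2) by rewrite mulr_ge0 ?nq_ge0// divr_ge0// ltW.
  have xm := xstar_m (symG N w) z0 hm zm.
  rewrite /v ler_wpM2l//; apply: lerD; first (apply: lerD; first apply: lerD) => //.
  - rewrite ler_wpM2r// addr_ge0// mulr_ge0//; apply: sumr_ge0 => k _; exact: nq_ge0.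
  - rewrite mulrC; apply: ler_pM; [|exact: nq_ge0| |exact: xm].
      by rewrite mulr_ge0// addr_ge0 ?mulr_ge0// ?fro2_ge0// divr_ge0// ltW.
    apply: ler_pM => //; first by rewrite addr_ge0 ?mulr_ge0// fro2_ge0.
      exact: Fa.
    apply: lerD; rewrite ler_wpM2l ?hb//; apply: ler_pM; rewrite ?fro2_ge0 ?mulr_ge0//; exact: fD.
  have -> : F * (cb / y2) / y2 * VE N w = F * (VE N w * (cb / y2) / y2) by ring.
  apply: ler_pM => //; first by rewrite !mulr_ge0 ?fro2_ge0.
    exact: Fa.
  by rewrite ler_wpM2r//; apply: ler_pM; rewrite ?fro2_ge0 ?mulr_ge0//; exact: fE.
apply: nullZ; do 3 ?[apply: nullD].
- by apply: nullD; apply: nullZ.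
- by apply: nullZ; apply: nullD; apply: nullZ.
- by do 2 apply: nullZ.
by apply: nullZ.
Qed.
End Sequence.

(** * The mode-l unfolding as a matrix with numbered columns *)

Section Unfolding.
Variables (R : realType) (d : nat) (n : 'I_d -> nat) (l : 'I_d).
Hypothesis n0 : forall l', (0 < n l')%N.

Definition upd (k : midx d n) (i : 'I_(n l)) : midx d n := finfun (eqtype.dfwith k i).

Lemma upd_in k i : upd k i l = i. Proof. by rewrite ffunE eqtype.dfwith_in. Qed.

Lemma upd_out k i l' : l' != l -> upd k i l' = k l'.
Proof. by move=> ll; rewrite ffunE eqtype.dfwith_out// eq_sym. Qed.

Lemma upd_upd k i j : upd (upd k i) j = upd k j.
Proof.
apply/ffunP => l'; have [->|ll] := eqVneq l' l; first by rewrite !upd_in.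
by rewrite !upd_out.
Qed.

Lemma upd_id k i : (upd k i == k) = (k l == i).
Proof.
apply/eqP/eqP => [<-|<-]; first by rewrite upd_in.
apply/ffunP => l'; have [->|ll] := eqVneq l' l; first by rewrite upd_in.
by rewrite upd_out.
Qed.

Let i0 : 'I_(n l) := Ordinal (n0 l).

(* The columns of the mode-l unfolding are indexed by the multi-indices whose
   l-th coordinate is 0. *)
Definition colidx : pred (midx d n) := [pred k : midx d n | k l == i0].
Definition ncol : nat := #|colidx|.

Let k0_colidx : (finfun (fun l' => Ordinal (n0 l')) : midx d n) \in colidx.
Proof. by rewrite inE ffunE; apply/eqP/val_inj. Qed.

Definition fiber (ic : 'I_(n l) * 'I_ncol) : midx d n := upd (enum_val ic.2) ic.1.

Lemma upd_fiber i j c : upd (fiber (i, c)) j = fiber (j, c).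
Proof. exact: upd_upd. Qed.

Lemma fiber_bij : bijective fiber.
Proof.
exists (fun k : midx d n => (k l, enum_rank_in k0_colidx (upd k i0))) => [[i c]|k].
  rewrite /fiber /= upd_in upd_upd; congr pair.
  have /= : enum_val c \in colidx by exact: enum_valP.
  by rewrite inE -upd_id => /eqP ->; rewrite enum_valK_in.
have ki : upd k i0 \in colidx by rewrite inE upd_in.
rewrite /fiber /= enum_rankK_in// upd_upd.
by apply/eqP; rewrite upd_id.
Qed.

(** Pairs (row, column) are in bijection with multi-indices; the positive factor n_l is cancelled
    from the two counts. *)
Lemma ncolE : ncol = (\prod_(l' < d | l' != l) n l')%N.
Proof.
apply/eqP; rewrite -(eqn_pmul2l (n0 l)); apply/eqP.
transitivity (\prod_(l' < d) n l')%N; last by rewrite (bigD1 l).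
have := bij_eq_card fiber_bij; rewrite card_prod !card_ord => ->.
rewrite card_dep_ffun foldrE big_map big_enum /=.
by apply: eq_bigr => i _; rewrite card_ord.
Qed.

Definition unfold (A : midx d n -> R) : 'M[R]_(n l, ncol) := \matrix_(i, c) A (fiber (i, c)).

Lemma frob2_unfold A : frob2 A = \sum_i \sum_c unfold A i c ^+ 2.
Proof.
rewrite /frob2 (reindex fiber) /=; last by apply: onW_bij; exact: fiber_bij.
rewrite pair_bigA; apply: eq_bigr => -[i c] _; by rewrite mxE.
Qed.

(** For given k and j a single k' agrees with k outside l and has k'_l = j, namely [upd k j]; the
    double sum collapses to a sum along columns. *)
Lemma unfold_gramE A : unfold_gram A l = unfold A *m (unfold A)^T.
Proof.
apply/matrixP => i j; rewrite !mxE.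
transitivity (\sum_(k : midx d n | k l == i) A k * A (upd k j)).
  rewrite [RHS]big_mkcond; apply: eq_bigr => k _; case: eqP => [ki|ki]; last first.
    by rewrite big_pred0.
  rewrite (big_pred1 (upd k j))// => k' /=; apply/andP/eqP => [[/eqP kj /forallP h]|->].
    apply/ffunP => l'; have [->|ll] := eqVneq l' l; first by rewrite upd_in.
    by rewrite upd_out//; have := h l'; rewrite ll => /eqP ->.
  rewrite upd_in; split=> //; apply/forallP => l'; apply/implyP => ll.
  by rewrite upd_out.
rewrite (reindex fiber) /=; last by apply: onW_bij; exact: fiber_bij.
rewrite (eq_bigl (fun ic : 'I_(n l) * 'I_ncol => (ic.1 == i) && true)); last first.
  by move=> [i' c]; rewrite upd_in andbT.
rewrite -(pair_big (fun i' => i' == i) xpredT (fun i' c => A (fiber (i', c)) * A (upd (fiber (i', c)) j))) /=.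
rewrite big_pred1_eq; apply: eq_bigr => c _; by rewrite upd_fiber !mxE.
Qed.
End Unfolding.

(** * The root of m^2 + z m + 1 in the half plane of z *)

Section SemicircleRoot.
Variable R : realType.
Local Notation C := R[i].

(** The roots are r and 1/r. Imaginary parts in z = - m - 1/m give Im z = Im m (1 / |m|^2 - 1), so a
    root of modulus less than 1 lies in the half plane of z, and modulus 1 would force Im z = 0. *)
Lemma semicircle_root (z : C) : complex.Im z != 0 ->
  exists m : C, m ^+ 2 + z * m + 1 = 0 /\ 0 < complex.Im z * complex.Im m.
Proof.
move=> z0.
have [r hr] : exists r : C, r ^+ 2 + z * r + 1 = 0.
  pose s := sqrtC (z ^+ 2 - 4); exists ((s - z) / 2).
  have ss : s ^+ 2 = z ^+ 2 - 4 by rewrite sqrtCK.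
  have -> : ((s - z) / 2) ^+ 2 + z * ((s - z) / 2) + 1 = (s ^+ 2 - (z ^+ 2 - 4)) / 4 by field.
  by rewrite ss subrr mul0r.
have key (m : C) : m ^+ 2 + z * m + 1 = 0 -> nq m != 0 /\
    complex.Im m * (1 - (nq m)^-1) = - complex.Im z.
  move=> hm; have m0 : m != 0.
    by apply/eqP => m0; move: hm; rewrite m0; move/eqP; rewrite expr0n mulr0 !add0r oner_eq0.
  split; first by rewrite nq_eq0.
  have -> : z = - m - m^-1.
    apply: (mulIf m0); rewrite mulrBl mulVf//.
    by apply/eqP; rewrite -subr_eq0 -hm; apply/eqP; ring.
  by rewrite !raddfB raddfN /= Im_minv; field; rewrite nq_eq0.
have [q0 hI] := key r hr.
have r0 : r != 0 by rewrite -nq_eq0.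
have qp : 0 < nq r by rewrite lt_def q0 nq_ge0.
have big (m : C) : m ^+ 2 + z * m + 1 = 0 -> nq m < 1 -> 0 < complex.Im z * complex.Im m.
  move=> hm m1; have [mq hmI] := key m hm.
  have mp : 0 < nq m by rewrite lt_def mq nq_ge0.
  have c1 : 0 < (nq m)^-1 - 1 by rewrite subr_gt0 invf_gt1.
  have hz : complex.Im z = complex.Im m * ((nq m)^-1 - 1) by move: hmI; lra.
  have mI : complex.Im m != 0 by apply/eqP => e; move: z0; rewrite hz e mul0r eqxx.
  by rewrite hz mulrAC -expr2 mulr_gt0// exprn_even_gt0.
have [r1|r1|r1] := ltgtP (nq r) 1.
- by exists r; split => //; exact: big.
- have hV : r^-1 ^+ 2 + z * r^-1 + 1 = 0.
    apply: (mulIf r0); apply: (mulIf r0); rewrite mul0r mul0r -hr.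
    by field.
  by exists r^-1; split => //; apply: big => //; rewrite nqV invf_lt1.
by move: hI z0; rewrite r1 invr1 subrr mulr0 => /eqP; rewrite eq_sym oppr_eq0 => ->.
Qed.
End SemicircleRoot.

(** * From squared errors to the notions of convergence and boundedness in the statement *)

Section Convergence.
Variable R : realType.

Lemma null_sqr (u : nat -> R) : null (fun N => u N ^+ 2) -> null u.
Proof.
move=> h; apply/norm_cvg0P.
rewrite (_ : (fun N => `|u N|) = (fun N => Num.sqrt (u N ^+ 2))); last first.
  by apply/funext => N; rewrite sqrtr_sqr.
rewrite -(sqrtr0 R); apply: (cvg_comp (fun N => u N ^+ 2) Num.sqrt h).
exact: sqrt_continuous.
Qed.

Lemma null_cvgC (u : nat -> R[i]) (z : R[i]) : null (fun N => nq (u N - z)) -> cvgC u z.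
Proof.
move=> h; split; apply/subr_cvg0; apply: null_sqr.
  apply: null_le h => [N|N _]; first exact: sqr_ge0.
  have := Re2_le_nq (u N - z); rewrite raddfB; exact.
apply: null_le h => [N|N _]; first exact: sqr_ge0.
have := Im2_le_nq (u N - z); rewrite raddfB; exact.
Unshelve. all: exact: 0%N.
Qed.

Lemma sqn_vnorm (k : nat) (v : 'cV[R]_k) : sqn v = vnorm v ^+ 2.
Proof. by rewrite /vnorm sqr_sqrtr// sqn_ge0. Qed.

Lemma vnorm_ge0 (k : nat) (v : 'cV[R]_k) : 0 <= vnorm v.
Proof. exact: sqrtr_ge0. Qed.

Lemma vec_bounded_sqn (n : nat -> nat) (a : forall N, 'cV[R]_(n N)) : vec_bounded a ->
  exists2 K : R, 0 <= K & forall N, sqn (a N) <= K.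
Proof.
move=> [K hK]; exists (K ^+ 2) => [|N]; first exact: sqr_ge0.
by rewrite sqn_vnorm lerXn2r ?nnegrE ?vnorm_ge0// (le_trans (vnorm_ge0 _) (hK N)).
Qed.

(** The bound on basis vectors; summed over the columns it yields |A|_F^2 <= n K, the form used for
    traces. *)
Lemma spec_bounded_sqn (n : nat -> nat) (A : forall N, 'M[R]_(n N)) : spec_bounded A ->
  exists2 K : R, 0 <= K & forall N i, sqn (col i (A N)) <= K.
Proof.
move=> [K hK]; exists (K ^+ 2) => [|N i]; first exact: sqr_ge0.
have := hK N (delta_mx i 0); rewrite -colE.
have -> : vnorm (delta_mx i 0 : 'cV[R]_(n N)) = 1.
  apply/eqP; rewrite -(@eqrXn2 _ 2)// ?vnorm_ge0// -sqn_vnorm expr1n; apply/eqP.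
  rewrite /sqn (bigD1 i)//= mxE !eqxx expr1n big1 ?addr0// => j ji.
  by rewrite mxE (negbTE ji) expr0n.
rewrite mulr1 => h; rewrite sqn_vnorm lerXn2r ?nnegrE ?vnorm_ge0//.
exact: le_trans (vnorm_ge0 _) h.
Qed.

Lemma ImCE (z : R[i]) : Im z = toC (complex.Im z).
Proof. by rewrite -complexIm. Qed.
End Convergence.

Theorem theorem1
  (R : realType) (d0 : measure_display) (Omega : measurableType d0)
  (P : probability Omega R)
  (d : nat) (hd : (3 <= d)%N)
  (c : 'I_d -> R) (hc : forall l, 0 < c l)
  (n : nat -> 'I_d -> nat)
  (hn : exists N0 : nat, forall N : nat, (N0 <= N)%N ->
          forall l, (n N l)%:R = c l * N%:R)
  (r : 'I_d -> nat) (hr : forall l, (0 < r l)%N)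
  (H : forall N : nat, midx d r -> R)
  (X : forall (N : nat) (l : 'I_d), 'M[R]_(n N l, r l))
  (hX : forall N l, (X N l)^T *m X N l = 1%:M)
  (W : forall N : nat, midx d (n N) -> {RV P >-> R})
  (hWind : forall N, mutually_independent P (fun k w => W N k w))
  (hWgauss : forall N k (B : set R), measurable B ->
      P (W N k @^-1` B) = normal_prob 0 1 B)
  (hbound : exists M : R, forall N,
      frob2 (signal (H N) (X N)) / @sigma_N R d (n N) N <= M) :
  let T := fun N (w : Omega) (k : midx d (n N)) =>
             signal (H N) (X N) k + (Num.sqrt N%:R)^-1 * W N k w in
  let Qt := fun (l : 'I_d) (z : R[i]) N (w : Omega) =>
      invmx (map_mx (@toC R) ((@sigma_N R d (n N) N)^-1 *:
                (unfold_gram (T N w) l - (@mu_N R d (n N) N l)%:M))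
             - z%:M) in
  exists mt : R[i] -> R[i],
    forall z : R[i], Im z != 0 ->
      [/\ mt z ^+ 2 + z * mt z + 1 = 0,
          0 < Im z * Im (mt z) &
          forall l : 'I_d,
            as_cvgC P (fun N w => toC (n N l)%:R^-1 * \tr (Qt l z N w)) (mt z)
            /\ det_equiv P (Qt l z)
                 (fun N => invmx (map_mx (@toC R)
                     ((@sigma_N R d (n N) N)^-1 *:
                        unfold_gram (signal (H N) (X N)) l)
                     + (mt z)^-1%:M))].
Proof.
move=> T Qt; have [N0 hN0] := hn; have [M hM] := hbound.
(* An orthonormal family of r_l >= 1 columns cannot live in dimension 0; positivity thus holds for
   every N, including small ones. *)
have n0 N l : (0 < n N l)%N.
  rewrite lt0n; apply/eqP => e.
  have := congr1 (fun A : 'M[R]_(r l) => A (Ordinal (hr l)) (Ordinal (hr l))) (hX N l).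
  rewrite !mxE eqxx big1 => [/eqP|k _]; first by rewrite eq_sym oner_eq0.
  by have := ltn_ord k; rewrite [X in (_ < X)%N]e ltn0.
(* The root is chosen before l is introduced, hence common to all modes; 0 is a default value at
   real z. *)
have /boolp.choice[mt hmt] : forall z : R[i], exists m : R[i], complex.Im z != 0 ->
    m ^+ 2 + z * m + 1 = 0 /\ 0 < complex.Im z * complex.Im m.
  move=> z; have [e|z0] := eqVneq (complex.Im z) 0; first by exists 0.
  by have [m hm] := semicircle_root z0; exists m.
exists mt => z; rewrite !ImCE toC_eq0 -toCM => z0; have [hm zm] := hmt z z0.
split=> // [|l]; first by rewrite ltcR.
pose p N := ncol l (n0 N).
pose Pm N := unfold l (n0 N) (signal (H N) (X N)).
pose Y N (ic : 'I_(n N l) * 'I_(p N)) w : R := W N (@fiber _ _ l (n0 N) ic) w.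
pose sg N := @sigma_N R d (n N) N.
pose N1 := maxn N0 1.
pose cp := \prod_(l' < d | l' != l) c l'.
(* The first summand serves N <= K n_l, the second n_l^2 <= K p. *)
pose K := (c l)^-1 + c l ^+ 2 / cp.
have cp0 : 0 < cp by apply: prodr_gt0.
have N1_gt0 : (0 < N1)%N by rewrite /N1 leq_max orbT.
have N_gt0 N : (N1 <= N)%N -> 0 < N%:R :> R.
  by move=> NN; rewrite ltr0n (leq_trans N1_gt0).
have nE N l' : (N1 <= N)%N -> (n N l')%:R = c l' * N%:R.
  by move=> NN; apply: hN0; apply: leq_trans NN; rewrite /N1 leq_max leqnn.
have K0 : 0 <= K by rewrite addr_ge0 ?invr_ge0 ?divr_ge0 ?sqr_ge0 ?ltW.
have pE N : (p N)%:R = \prod_(l' < d | l' != l) (n N l')%:R :> R.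
  by rewrite /p ncolE natr_prod.
(* At each fixed N, the entries of the noise tensor are relabelled as those of a matrix. *)
have gY N : gfam P (@Y N).
  apply: (@gfam_inj _ _ _ P _ _ (fun k w => W N k w) (@fiber _ _ l (n0 N))).
    exact: bij_inj (fiber_bij l (n0 N)).
  by apply: gfam_of_independent => // k; exact: hWgauss.
have sg_gt0 N : (N1 <= N)%N -> 0 < sg N.
  move=> NN; rewrite /sg /sigma_N mulr_gt0 ?invr_gt0 ?N_gt0// sqrtr_gt0.
  by apply: prodr_gt0 => l' _; rewrite ltr0n.
have sgE N : (N1 <= N)%N -> (sg N * N%:R) ^+ 2 = (n N l)%:R * (p N)%:R.
  move=> NN; rewrite /sg /sigma_N mulrAC mulVf ?gt_eqF ?N_gt0// mul1r sqr_sqrtr.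
    by rewrite (bigD1 l)//= pE.
  by apply: prodr_ge0.
have nK N : (N1 <= N)%N -> (n N l)%:R ^+ 2 <= K * (p N)%:R.
  move=> NN; have Np := N_gt0 N NN.
  have pc : cp * N%:R ^+ 2 <= (p N)%:R.
    rewrite pE; under eq_bigr do rewrite nE//.
    rewrite big_split /= ler_wpM2l ?(ltW cp0)//.
    rewrite (eq_bigl (fun l' => l' \in predC1 l)) // prodr_const cardC1 card_ord.
    (* The product over the other modes contributes N^(d-1), and d - 1 >= 2. *)
    rewrite ler_weXn2l// ?ler1n ?(leq_trans N1_gt0)//.
    by case: (d) hd => [|[|[|d']]].
  apply: (le_trans (y := c l ^+ 2 / cp * (p N)%:R)); last first.
    by rewrite ler_wpM2r// lerDr invr_ge0 ltW.
  rewrite nE// exprMn -mulrA ler_wpM2l ?sqr_ge0// ler_pdivlMl//.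
have NK N : (N1 <= N)%N -> N%:R <= K * (n N l)%:R.
  move=> NN; rewrite nE// mulrA ler_peMl//.
  by rewrite mulrDl mulVf ?gt_eqF// lerDl mulr_ge0 ?divr_ge0 ?sqr_ge0 ?ltW.
(* The absolute value of M supplies the nonnegative bound that the limit lemmas require. *)
have PM N : (N1 <= N)%N -> \sum_i \sum_j Pm N i j ^+ 2 <= `|M| * sg N.
  move=> NN; rewrite -frob2_unfold -ler_pdivrMr ?sg_gt0//.
  by apply: le_trans (hM N) (ler_norm _).
pose Q N w := invmx (Cmx ((sg N)^-1 *:
  ((Pm N + (Num.sqrt N%:R)^-1 *: Wmx (@Y N) w) *m
   (Pm N + (Num.sqrt N%:R)^-1 *: Wmx (@Y N) w)^T - (N%:R^-1 * (p N)%:R)%:M)) - z%:M).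
have QE N w : Qt l z N w = Q N w.
  rewrite /Qt /Q (unfold_gramE l (n0 N)) /mu_N -pE.
  have -> : unfold l (n0 N) (T N w) = Pm N + (Num.sqrt N%:R)^-1 *: Wmx (@Y N) w.
    by apply/matrixP => i j; rewrite !mxE.
  by [].
split.
  apply: filterS (seq_stieltjes gY N1_gt0 (fun N _ => n0 N l) sg_gt0 sgE nK NK PM K0
    (normr_ge0 M) z0 hm zm) => w h.
  apply: null_cvgC; rewrite (_ : (fun N => nq _) = fun N => nq (stieltjes (Q N w) - mt z))//.
  by apply/funext => N; rewrite QE.
move=> A a b /spec_bounded_sqn[KA KA0 hA] /vec_bounded_sqn[ca ca0 ha] /vec_bounded_sqn[cb cb0 hb].
split.
  apply: filterS (seq_trace gY N1_gt0 (fun N _ => n0 N l) sg_gt0 sgE nK NK PM K0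
    (normr_ge0 M) z0 hm zm (fun N i _ => hA N i) KA0) => w.
  move=> h; apply: null_cvgC; move: h; congr (null _); apply/funext => N.
  by rewrite subr0 QE (unfold_gramE l (n0 N)).
apply: filterS (seq_bil gY N1_gt0 (fun N _ => n0 N l) sg_gt0 sgE nK NK PM K0
  (normr_ge0 M) z0 hm zm (fun N _ => ha N) (fun N _ => hb N) ca0 cb0) => w.
move=> h; apply: null_cvgC; move: h; congr (null _); apply/funext => N.
by rewrite subr0 QE (unfold_gramE l (n0 N)).
Qed.
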